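(* Let $h\colon[n]\to[n]$ be a Hessenberg function and let $\lambda_1<\cdots<\lambda_n$ be real numbers. Then the space $X_h$ of Hermitian staircase matrices of type $h$ with spectrum $\lambda$, with the conjugation action of the torus $T=T^n$, is equivariantly formal.
   Context: $[n]=\{1,\ldots,n\}$. A Hessenberg function is a function $h\colon[n]\to[n]$ with $h(i)\ge i$ for all $i$ and $h(i+1)\ge h(i)$ for $1\le i\le n-1$. $M_h$ is the real vector space of Hermitian $n\times n$ matrices $A=(a_{ij})$ with $a_{ij}=0$ whenever $j>h(i)$ or $i>h(j)$; $M_\lambda$ is the set of Hermitian $n\times n$ matrices with spectrum $\lambda=\{\lambda_1,\ldots,\lambda_n\}$; $X_h=M_h\cap M_\lambda$. The torus $T^n$ of diagonal unitary matrices acts on $X_h$ by $A\mapsto DAD^{-1}$. For a space $X$ with an action of a compact torus $T$, the Borel construction is $X_T=X\times_T ET$, with fibration $p\colon X_T\to BT$ with fiber $X$, and $H^*_T(X)=H^*(X_T)$. Cohomology has integer coefficients. $X$ is called equivariantly formal if the Serre spectral sequence of $p$, $E_2^{p,q}\cong H^p(BT;H^q(X))\cong H^p(BT)\otimes H^q(X)\Rightarrow H^*_T(X)$, collapses at the second page. *)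

(* Defs.v *)
From HB Require Import structures.
From mathcomp Require Import all_boot all_order all_algebra.
From mathcomp Require Import generic_quotient spectral sesquilinear complex.
From mathcomp Require Import all_classical all_reals all_analysis.
Import Order.TTheory GRing.Theory Num.Theory.
Import numFieldNormedType.Exports.

Set Implicit Arguments.
Unset Strict Implicit.
Unset Printing Implicit Defensive.

Local Open Scope classical_set_scope.
Local Open Scope ring_scope.
Local Open Scope complex_scope.
Local Open Scope quotient_scope.
Local Open Scope sesquilinear_scope.

(* The alias [R[i]^o] of the complex field carries the norm topology. *)
Notation cplx R := (R[i]^o).

Section MatrixContinuity.

Lemma continuous_mxP (X Y : topologicalType) m n (f : X -> 'M[Y]_(m, n)) :
  (forall i j, continuous (fun x => f x i j)) -> continuous f.
Proof.
move=> fc x A [P nP PA].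
have H : \forall y \near x, forall i j, P i j (f y i j).
  apply: filter_forall => i; apply: filter_forall => j.
  exact: (fc i j x _ (nP i j)).
by apply: filterS H => y Py; exact: PA.
Qed.

Lemma continuous_val (X : topologicalType) (A : set X) :
  continuous (\val : A -> X).
Proof. by rewrite -set_valE; exact: initial_continuous. Qed.

Lemma continuous_mx_entry (Y : topologicalType) m n i j :
  continuous (fun M : 'M[Y]_(m, n) => M i j).
Proof.
move=> M A nA; exists (fun i' j' => if (i' == i) && (j' == j) then A else setT).
  move=> i' j'; case: ifP => [/andP[/eqP -> /eqP ->] //|_]; exact: filterT.
by move=> N /(_ i j) /=; rewrite !eqxx.
Qed.

Lemma continuous_ptwsP (X V : topologicalType) (I : Type)
  (f : X -> {ptws I -> V}) :
  (forall i, continuous (fun x => f x i)) -> continuous f.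
Proof.
move=> fc x; apply/cvg_sup => i A [U [[W oW <-] Wx] UA].
by apply: filterS UA _; apply: (fc i x W); exact: open_nbhs_nbhs.
Qed.

Lemma continuous_pair (X Y Z : topologicalType) (f : X -> Y) (g : X -> Z) :
  continuous f -> continuous g -> continuous (fun x => (f x, g x)).
Proof. by move=> fc gc x; apply: cvg_pair; [exact: fc | exact: gc]. Qed.

Lemma continuous_mulmx (X : topologicalType) (K : numFieldType) m n p
  (f : X -> 'M[K]_(m, n)) (g : X -> 'M[K]_(n, p)) :
  continuous f -> continuous g -> continuous (fun x => f x *m g x).
Proof.
move=> fc gc; apply: continuous_mxP => i j.
under [X in continuous X]eq_fun do rewrite mxE.
move=> x; apply: cvg_big => [|k _]; first exact: add_continuous.
apply: cvgM.
  exact: (continuous_comp (@fc x) (@continuous_mx_entry _ _ _ i k (f x))).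
exact: (continuous_comp (@gc x) (@continuous_mx_entry _ _ _ k j (g x))).
Qed.

Lemma continuous_trmxC (X : topologicalType) (R : realType) m n
  (f : X -> 'M[cplx R]_(m, n)) :
  continuous f -> continuous (fun x => (f x)^t* : 'M[cplx R]_(n, m)).
Proof.
move=> fc; apply: continuous_mxP => i j.
under [X in continuous X]eq_fun do rewrite !mxE.
move=> x; apply/cvgrPdist_lt => e e0.
have /cvgrPdist_lt/(_ e e0) :=
  continuous_comp (@fc x) (@continuous_mx_entry _ _ _ j i (f x)).
by apply: filterS => y; rewrite -rmorphB norm_conjC.
Qed.

End MatrixContinuity.

Section Cubes.
Variable R : realType.

Definition cube k : set 'rV[R]_k := [set t | forall i, 0 <= t ord0 i <= 1].
Arguments cube : clear implicits.

Definition singular_cube k (E : topologicalType) := continuousType (cube k) E.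

Definition face_row k (i : 'I_k.+1) (e : bool) (t : 'rV[R]_k) : 'rV[R]_k.+1 :=
  \row_j (if unlift i j is Some j' then t ord0 j' else e%:R).

Lemma face_row_cube k (i : 'I_k.+1) e (t : cube k) :
  face_row i e (\val t) \in cube k.+1.
Proof.
apply/mem_set => j; rewrite mxE; case: unlift => [j'|].
  exact: (set_valP t).
by case: e; rewrite ?lexx ?ler01.
Qed.

Definition face k (i : 'I_k.+1) (e : bool) (t : cube k) : cube k.+1 :=
  exist _ (face_row i e (\val t)) (face_row_cube i e t).

Lemma continuous_face k (i : 'I_k.+1) e : continuous (@face k i e).
Proof.
apply: continuous_comp_initial; apply: continuous_mxP => a j.
rewrite (_ : (fun _ => _) = (fun t : cube k =>
  if unlift i j is Some j' then (\val t) ord0 j' else e%:R)); last first.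
  by apply/funext => t /=; rewrite mxE.
case: unlift => [j'|]; last exact: cst_continuous.
move=> t; exact: (continuous_comp (@continuous_val _ (cube k) t)
  (@continuous_mx_entry _ _ _ ord0 j' (\val t))).
Qed.

HB.instance Definition _ k (i : 'I_k.+1) e :=
  isContinuous.Build _ _ (face i e) (@continuous_face k i e).

Definition cube_face (E : topologicalType) k (u : singular_cube k.+1 E)
  (i : 'I_k.+1) (e : bool) : singular_cube k E := u \o face i e.

Definition depends_on_first (Y : Type) k (m : nat) (g : cube k -> Y) :=
  forall s t : cube k,
    (forall i : 'I_k, (i < m)%N -> (\val s) ord0 i = (\val t) ord0 i) ->
    g s = g t.

(* Serre's convention for cubical chains: only cubes that are independent of
   their last coordinate are degenerate. *)
Definition degenerate (E : topologicalType) k (u : singular_cube k E) :=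
  (0 < k)%N /\ depends_on_first k.-1 u.

(* The normalization condition, vanishing on degenerate cubes, is imposed in
   [serre_filtration]. *)
Definition cochain (E : topologicalType) k := singular_cube k E -> int.

Definition coboundary (E : topologicalType) k (f : cochain E k) :
    cochain E k.+1 :=
  fun u => \sum_(i < k.+1) (-1) ^+ i.+1 *
    (f (cube_face u i false) - f (cube_face u i true)).

End Cubes.

Arguments cube : clear implicits.

Section FilteredComplex.
Variables (C : nat -> zmodType) (d : forall k, C k -> C k.+1).
Variable F : int -> forall k, set (C k).

(* With [k] the total degree, so that the complementary degree is [k - p],
     Z_r^p = {x in F^p | d x in F^(p+r)},
     E_r^p = Z_r^p / (Z_(r-1)^(p+1) + d Z_(r-1)^(p-r+1)),
   and d_r : E_r^p -> E_r^(p+r) sends the class of x to the class of d x. *)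
Definition ss_cycles (r : nat) (p : int) k : set (C k) :=
  [set x | F p x /\ F (p + r%:Z) (d x)].

(* The denominator of E_r^p in total degree [k.+1]; every target of a
   differential has positive total degree. *)
Definition ss_null (r : nat) (p : int) k : set (C k.+1) :=
  [set z + d b | z in @ss_cycles r.-1 (p + 1) k.+1
               & b in @ss_cycles r.-1 (p - r%:Z + 1) k].

Definition ss_differential_eq0 (r : nat) :=
  forall p k (x : C k), @ss_cycles r p k x -> @ss_null r (p + r%:Z) k (d x).

Definition ss_collapses_at (s : nat) :=
  forall r, (s <= r)%N -> ss_differential_eq0 r.

End FilteredComplex.

Section Serre.
Variables (R : realType) (E : topologicalType) (B : Type) (prj : E -> B).

(* Serre's filtration: a cube [u] has filtration at most [m] when [prj \o u]
   depends only on the first [m] coordinates, and F^p consists of the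
   normalized cochains vanishing on the cubes of filtration at most [p - 1].
   For [p <= 0] this is the whole normalized cubical cochain complex of [E],
   so the spectral sequence converges to H^*(E) with integer coefficients. *)
Definition serre_filtration (p : int) k : set (cochain R E k) :=
  [set f : cochain R E k |
    (forall u : singular_cube R k E, degenerate u -> f u = 0) /\
    (forall (m : nat) (u : singular_cube R k E),
       m%:Z < p -> depends_on_first m (prj \o u) -> f u = 0)].

Definition serre_collapses_at (s : nat) :=
  ss_collapses_at (C := fun k => cochain R E k : zmodType)
    (@coboundary R E) serre_filtration s.

End Serre.

Section Torus.
Variables (R : realType) (n : nat).
Local Notation C := (cplx R).

Definition torus : set 'M[C]_n :=
  [set D | is_diag_mx D /\ D \is unitarymx].

Lemma torus_unitary (D : torus) : \val D \is unitarymx.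
Proof. by case: (set_valP D). Qed.

Lemma torus1_subproof : (1%:M : 'M[C]_n) \in torus.
Proof.
apply/mem_set; split; first exact: scalar_mx_is_diag.
by apply/unitarymxP; rewrite trmx1 map_mx1 mulmx1.
Qed.

Lemma torusM_subproof (D D' : torus) : \val D *m \val D' \in torus.
Proof.
case: D D' => [D /= /set_mem[dD uD]] [D' /= /set_mem[dD' uD']].
apply/mem_set; split; last exact: (mul_unitarymx uD uD').
by have [a ->] := diag_mxP _ dD; have [b ->] := diag_mxP _ dD';
  rewrite mulmx_diag diag_mx_is_diag.
Qed.

Lemma torusV_subproof (D : torus) : invmx (\val D) \in torus.
Proof.
case: D => [D /= /set_mem[dD uD]]; rewrite invmx_unitary //.
apply/mem_set; split; last by rewrite trmxC_unitary.
by have [a ->] := diag_mxP _ dD; rewrite tr_diag_mx map_diag_mx diag_mx_is_diag.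
Qed.

Definition torus1 : torus := exist _ 1%:M torus1_subproof.
Definition torusM (D D' : torus) : torus :=
  exist _ (\val D *m \val D') (torusM_subproof D D').
Definition torusV (D : torus) : torus :=
  exist _ (invmx (\val D)) (torusV_subproof D).

Structure torus_action (X : topologicalType) := TorusAction {
  act :> torus -> X -> X;
  act1 : forall x, act torus1 x = x;
  actM : forall D D' x, act (torusM D D') x = act D (act D' x);
  act_continuous : continuous (fun p : torus * X => act p.1 p.2)
}.

(* A model of E(T^n): the product of n copies of the infinite sphere, the i-th
   one consisting of the finitely supported sequences (z k i)_k of norm 1, with
   the coordinatewise topology, which agrees there with the l^2-norm topology.
   This is a contractible space on which T^n acts freely, and its projection
   to the orbit space BT = (CP^oo)^n is a principal bundle. *)
Definition ET : set {ptws nat -> 'cV[C]_n} :=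
  [set z : {ptws nat -> 'cV[C]_n} | exists N : nat,
     (forall k, (N <= k)%N -> z k = 0) /\
     forall i, \sum_(k < N) `|z k i ord0| ^+ 2 = 1].

Lemma diag_unitary_entry (D : 'M[C]_n) : is_diag_mx D -> D \is unitarymx ->
  exists d : 'rV[C]_n, D = diag_mx d /\ forall i, `|d ord0 i| = 1.
Proof.
move=> /diag_mxP[d ->] /unitarymxP U; exists d; split=> // i.
have := congr1 (fun M : 'M[C]_n => M i i) U.
rewrite tr_diag_mx map_diag_mx mulmx_diag !mxE eqxx !mulr1n -normCK => H.
by apply/eqP; rewrite -(@eqrXn2 _ 2) ?normr_ge0 ?ler01 // expr1n; apply/eqP.
Qed.

Lemma ET_act_subproof (D : torus) (z : ET) :
  (fun k => \val D *m (\val z) k) \in ET.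
Proof.
case: D z => [D /= /set_mem[dD uD]] [z /= /set_mem[N [z0 z1]]].
have [d [-> d1]] := diag_unitary_entry dD uD.
apply/mem_set; exists N; split=> [k /z0 ->|i]; first by rewrite mulmx0.
rewrite -[RHS](z1 i); apply: eq_bigr => k _.
by rewrite mul_diag_mx mxE normrM d1 mul1r.
Qed.

Definition ET_act (D : torus) (z : ET) : ET :=
  exist _ (fun k => \val D *m (\val z) k) (ET_act_subproof D z).

Lemma ET_act1 z : ET_act torus1 z = z.
Proof. by apply/val_inj/funext => k /=; rewrite mul1mx. Qed.

Lemma ET_actM D D' z : ET_act (torusM D D') z = ET_act D (ET_act D' z).
Proof. by apply/val_inj/funext => k /=; rewrite mulmxA. Qed.

Lemma continuous_ET_act :
  continuous (fun p : torus * ET => ET_act p.1 p.2).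
Proof.
apply: continuous_comp_initial; rewrite set_valE.
apply: continuous_ptwsP => k /=.
apply: continuous_mulmx => p.
  exact: (continuous_comp (@cvg_fst _ _ _ _ _) (@continuous_val _ torus p.1)).
exact: (continuous_comp (continuous_comp (@cvg_snd _ _ _ _ _)
  (@continuous_val _ ET p.2))
  (@proj_continuous _ (fun=> 'cV[C]_n : topologicalType) k (\val p.2))).
Qed.

Definition ET_action : torus_action ET :=
  TorusAction ET_act1 ET_actM continuous_ET_act.

End Torus.

Arguments torus : clear implicits.
Arguments ET : clear implicits.
Arguments torus1 : clear implicits.

Section OrbitSpace.
Variables (R : realType) (n : nat) (X : topologicalType).
Variable a : torus_action R n X.

Definition orbit_rel : rel X := fun x y => `[< exists D, a D x = y >].

Lemma orbit_rel_refl : reflexive orbit_rel.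
Proof. by move=> x; apply/asboolP; exists (torus1 R n); exact: act1. Qed.

Lemma orbit_rel_sym : symmetric orbit_rel.
Proof.
suff H x y : orbit_rel x y -> orbit_rel y x by move=> x y; apply/idP/idP; exact: H.
move=> /asboolP[D <-]; apply/asboolP; exists (torusV D).
rewrite -actM (_ : torusM _ _ = torus1 R n) ?act1 //; apply: val_inj => /=.
by rewrite mulVmx // unitarymx_unit // torus_unitary.
Qed.

Lemma orbit_rel_trans : transitive orbit_rel.
Proof.
move=> y x z /asboolP[D <-] /asboolP[D' <-]; apply/asboolP.
by exists (torusM D' D); rewrite actM.
Qed.

Canonical orbit_equiv :=
  EquivRel orbit_rel orbit_rel_refl orbit_rel_sym orbit_rel_trans.

Definition orbit_space : topologicalType :=
  quotient_topology {eq_quot orbit_equiv}.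

Definition orbit (x : X) : orbit_space := \pi_{eq_quot orbit_equiv} x.

End OrbitSpace.

Section Borel.
Variables (R : realType) (n : nat).

Definition BT : topologicalType := orbit_space (ET_action R n).

Variables (X : topologicalType) (a : torus_action R n X).

Definition diag_act (D : torus R n) (p : X * ET R n) : X * ET R n :=
  (a D p.1, ET_act D p.2).

Lemma diag_act1 p : diag_act (torus1 R n) p = p.
Proof. by case: p => x z; rewrite /diag_act act1 ET_act1. Qed.

Lemma diag_actM D D' p :
  diag_act (torusM D D') p = diag_act D (diag_act D' p).
Proof. by rewrite /diag_act actM ET_actM. Qed.

Lemma continuous_diag_act :
  continuous (fun p : torus R n * (X * ET R n) => diag_act p.1 p.2).
Proof.
have c1 : continuous (fun p : torus R n * (X * ET R n) => (p.1, p.2.1)).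
  apply: continuous_pair => p; first exact: cvg_fst.
  exact: (continuous_comp (@cvg_snd _ _ _ _ _) (@cvg_fst _ _ _ _ _)).
have c2 : continuous (fun p : torus R n * (X * ET R n) => (p.1, p.2.2)).
  apply: continuous_pair => p; first exact: cvg_fst.
  exact: (continuous_comp (@cvg_snd _ _ _ _ _) (@cvg_snd _ _ _ _ _)).
apply: continuous_pair => p.
  exact: (continuous_comp (c1 p) (@act_continuous _ _ _ a _)).
exact: (continuous_comp (c2 p) (@continuous_ET_act _ _ _)).
Qed.

Definition diag_action : torus_action R n (X * ET R n)%type :=
  TorusAction diag_act1 diag_actM continuous_diag_act.

Definition borel : topologicalType := orbit_space diag_action.

Definition borel_proj (y : borel) : BT :=
  orbit (ET_action R n) (repr (y : {eq_quot orbit_equiv diag_action})).2.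

Lemma borel_projE x z :
  borel_proj (orbit diag_action (x, z)) = orbit (ET_action R n) z.
Proof.
rewrite /borel_proj /orbit; set q := \pi_{eq_quot orbit_equiv diag_action} _.
have /eqmodP/asboolP[D /= rD] :
    repr q = (x, z) %[mod {eq_quot orbit_equiv diag_action}].
  by rewrite reprK.
by apply/eqmodP/asboolP; exists D; rewrite -[z]/((x, z).2) -rD.
Qed.

(* The E_2 page of the spectral sequence of the fibration [borel_proj], with
   fiber [X], is H^p(BT; H^q(X)). *)
Definition equivariantly_formal := serre_collapses_at R borel_proj 2.

End Borel.

Section Staircase.
Variables (R : realType) (n : nat).
Local Notation C := (cplx R).

Definition hessenberg_function (h : 'I_n -> 'I_n) :=
  (forall i : 'I_n, (i <= h i)%N) /\
  (forall i j : 'I_n, j = i.+1 :> nat -> (h i <= h j)%N).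

Variables (h : 'I_n -> 'I_n) (lambda : 'I_n -> R).

Definition staircase : set 'M[C]_n :=
  [set A | A \is hermsymmx /\
     forall i j : 'I_n, (h i < j)%N \/ (h j < i)%N -> A i j = 0].

(* Used for pairwise distinct [lambda i] only, where the spectrum of an
   [n]-by-[n] matrix carries no multiplicities. *)
Definition isospectral : set 'M[C]_n :=
  [set A | A \is hermsymmx /\
     [set c : C | eigenvalue A c] = range (fun i => (lambda i)%:C : C)].

Definition staircase_isospectral : set 'M[C]_n := staircase `&` isospectral.
Local Notation Xh := staircase_isospectral.

Definition conj_mx (D A : 'M[C]_n) := D *m A *m invmx D.

Lemma eigenvalue_conj_mx (D A : 'M[C]_n) c :
  D \in unitmx -> eigenvalue (conj_mx D A) c = eigenvalue A c.
Proof.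
move=> uD; apply/eigenvalueP/eigenvalueP => -[v vA v0].
  exists (v *m D).
    rewrite scalemxAl -vA /conj_mx !mulmxA mulmxKV //.
  apply: contra v0 => /eqP vD0.
  by rewrite -(mulmxK uD v) vD0 mul0mx.
exists (v *m invmx D).
  by rewrite /conj_mx !mulmxA mulmxKV // vA scalemxAl.
apply: contra v0 => /eqP vD0.
by rewrite -(mulmxKV uD v) vD0 mul0mx.
Qed.

Lemma hermsymmx_conj_mx (D A : 'M[C]_n) :
  D \is unitarymx -> A \is hermsymmx -> conj_mx D A \is hermsymmx.
Proof.
move=> uD /is_hermitianmxP; rewrite expr0 scale1r => HA.
apply/is_hermitianmxP; rewrite expr0 scale1r /conj_mx invmx_unitary //.
rewrite {1}HA trmx_mul map_mxM trmx_mul map_mxM trmxCK mulmxA.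
by [].
Qed.

Lemma staircase_conj_mx (D A : 'M[C]_n) :
  is_diag_mx D -> D \is unitarymx -> staircase A -> staircase (conj_mx D A).
Proof.
move=> dD uD [hA sA]; split; first exact: hermsymmx_conj_mx.
move=> i j /sA Aij; rewrite /conj_mx invmx_unitary //.
have [d ->] := diag_mxP _ dD.
rewrite tr_diag_mx map_diag_mx mul_diag_mx mul_mx_diag !mxE Aij.
by rewrite mulr0 mul0r.
Qed.

Lemma conj_subproof (D : torus R n) (A : Xh) :
  conj_mx (\val D) (\val A) \in Xh.
Proof.
case: D A => [D /= /set_mem[dD uD]] [A /= /set_mem[sA [hA eA]]].
apply/mem_set; split; first exact: staircase_conj_mx.
split; first exact: hermsymmx_conj_mx.
rewrite -eA; apply/seteqP.
by split=> c /=; rewrite eigenvalue_conj_mx // unitarymx_unit.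
Qed.

Definition conj_act (D : torus R n) (A : Xh) : Xh :=
  exist _ (conj_mx (\val D) (\val A)) (conj_subproof D A).

Lemma conj_act1 A : conj_act (torus1 R n) A = A.
Proof. by apply/val_inj; rewrite /= /conj_mx mul1mx invmx1 mulmx1. Qed.

Lemma conj_actM D D' A :
  conj_act (torusM D D') A = conj_act D (conj_act D' A).
Proof.
apply/val_inj; rewrite /= /conj_mx !mulmxA !invmx_unitary ?torus_unitary //.
  by rewrite trmx_mul map_mxM mulmxA.
by rewrite mul_unitarymx ?torus_unitary.
Qed.

Lemma continuous_conj_act :
  continuous (fun p : torus R n * Xh => conj_act p.1 p.2).
Proof.
have cD : continuous (fun p : torus R n * Xh => \val p.1).
  move=> p.
  exact: (continuous_comp (@cvg_fst _ _ _ _ _) (@continuous_val _ _ p.1)).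
have cA : continuous (fun p : torus R n * Xh => \val p.2).
  move=> p.
  exact: (continuous_comp (@cvg_snd _ _ _ _ _) (@continuous_val _ _ p.2)).
have cM : continuous (fun p : torus R n * Xh =>
    conj_mx (\val p.1) (\val p.2) : 'M[C]_n).
  have -> : (fun p : torus R n * Xh => conj_mx (\val p.1) (\val p.2)) =
      (fun p => \val p.1 *m \val p.2 *m (\val p.1)^t*).
    by apply/funext => p; rewrite /conj_mx invmx_unitary // torus_unitary.
  exact: continuous_mulmx (continuous_mulmx cD cA) (continuous_trmxC cD).
by apply: continuous_comp_initial; rewrite set_valE.
Qed.

Definition conj_action : torus_action R n Xh :=
  TorusAction conj_act1 conj_actM continuous_conj_act.

End Staircase.

(* Main.v *)
Require Import Defs.
From HB Require Import structures.
From mathcomp Require Import all_boot all_order all_algebra.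
From mathcomp Require Import fingroup perm.
From mathcomp Require Import generic_quotient spectral sesquilinear complex.
From mathcomp Require Import all_classical all_reals all_analysis.
From mathcomp Require Import zify ring lra.
Import Defs.
Import Order.TTheory GRing.Theory Num.Theory.
Import numFieldNormedType.Exports.

Set Implicit Arguments.
Unset Strict Implicit.
Unset Printing Implicit Defensive.

Local Open Scope classical_set_scope.
Local Open Scope ring_scope.

(* The odd integral cohomology of [X_h] vanishes.  Choose unit eigenvectors of [A]
   as the rows of a unitary [G]; for every permutation [w], the [A] for which the
   leading minors of the [w]-permuted [G] are invertible form an open set, which is
   a retract of a real vector space: [A] is determined by the lower triangular
   staircase matrix [b A b^-1], with [b] upper triangular with positive diagonal.
   Ordering the permutations along the Bruhat order, each such open set meets the
   union of the previous ones in the complement of a linear subspace of even real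
   codimension, and such a pair has no odd cohomology.  The same argument applies
   to [BT], a union of charts in which some coordinates do not vanish.

   Let [y] be an odd cochain in [F^p] with [d y] in [F^(p+2)].  Restricted to the
   products of a fixed lift of a [p]-cube of [BT] with cubes of [X_h], it is a
   cocycle on [X_h].  If [p] is even this cocycle has odd degree, hence bounds; if
   [p] is odd, the torus being connected, these cocycles form a cocycle on [BT] with
   coefficients in the cohomology of [X_h], hence a coboundary.  Either way [y] lies
   in [d F^(p-1) + F^(p+1)].  Applied to a representative [x] of odd degree, or
   repeatedly to [d x] when [x] has even degree, this kills every differential
   [d_r] with [r >= 2]. *)

(** * Singular cubes as functions of a sequence of coordinates *)

(** The second page is never computed: a cochain of odd degree is corrected one filtration step at a
    time, so two vanishing statements suffice, both in odd degrees. This is why the relative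
    computations only follow the parity of a codimension, and why they allow an arbitrary
    coefficient group: over base cubes of odd dimension the coefficients are a cohomology group of
    the fiber, about which nothing is assumed. A Bruhat cell is linear in its chart for the
    following reason. Let the rows of [M] be the eigenvectors in the order [w], let [L] be the
    diagonal matrix of eigenvalues in that order, [v] lower unipotent and [b = v M] upper
    triangular. Then [b A b^-1 = v L v^-1]. The left side shows that the zeros of [A] below the
    staircase are kept, [h] being monotone; the right side is lower triangular with known diagonal
    and, the eigenvalues being distinct, has the zero pattern of the cell exactly when [v] has it.
    The remaining entries are free complex numbers, whence the even codimension. Charts only have to
    be retracts of their models, so the models may carry spare coordinates. *)

Section RawCubes.
Variable R : realType.

Definition itv01 := {x : R | 0 <= x <= 1}.
Local Notation I := itv01.
Local Notation seqI := (nat -> I).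
Local Notation raw T := (seqI -> T).

Lemma i0_subproof : 0 <= (0 : R) <= 1. Proof. by rewrite lexx ler01. Qed.
Lemma i1_subproof : 0 <= (1 : R) <= 1. Proof. by rewrite lexx ler01. Qed.
Definition i0 : I := exist _ 0 i0_subproof.
Definition i1 : I := exist _ 1 i1_subproof.

Lemma imul_subproof (a b : I) : 0 <= val a * val b <= 1.
Proof.
case: a b => [a /= /andP[a0 a1]] [b /= /andP[b0 b1]].
by rewrite mulr_ge0 //= mulr_ile1.
Qed.
Definition imul (a b : I) : I := exist _ (val a * val b) (imul_subproof a b).

Lemma ihalf_subproof (e : bool) (a : I) : 0 <= (val a + e%:R) / 2 <= 1.
Proof. by case: a => [a /= /andP[a0 a1]]; apply/andP; case: e; split => /=; lra. Qed.
Definition ihalf (e : bool) (a : I) : I :=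
  exist _ ((val a + e%:R) / 2) (ihalf_subproof e a).

Lemma imul0 a : imul i0 a = i0. Proof. by apply: val_inj; rewrite /= mul0r. Qed.
Lemma imulr0 a : imul a i0 = i0. Proof. by apply: val_inj; rewrite /= mulr0. Qed.
Lemma imul1 a : imul i1 a = a. Proof. by apply: val_inj; rewrite /= mul1r. Qed.

Lemma ihalf_00 : ihalf false i0 = i0.
Proof. by apply: val_inj; rewrite /= addr0 mul0r. Qed.
Lemma ihalf_11 : ihalf true i1 = i1.
Proof. by apply: val_inj; rewrite /=; lra. Qed.
Lemma ihalf_mid : ihalf false i1 = ihalf true i0.
Proof. by apply: val_inj; rewrite /=; lra. Qed.

Definition ins (i : nat) (e : I) (a : seqI) : seqI :=
  fun j => if (j < i)%N then a j else if j == i then e else a j.-1.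

Definition shift (a : seqI) : seqI := fun j => a j.+1.

Definition trunc (k : nat) (a : seqI) : seqI :=
  fun j => if (j < k)%N then a j else i0.

(* A cube of dimension [k] is a function of infinitely many coordinates that
   only looks at the first [k] ones; it is degenerate when it only looks at the
   first [k.-1] ones. *)
Definition valid (T : Type) (k : nat) (u : raw T) :=
  forall a b, (forall j, (j < k)%N -> a j = b j) -> u a = u b.

Lemma ins_shift e a : shift (ins 0 e a) = a.
Proof. by apply/funext => j; rewrite /shift /ins. Qed.

Lemma ins0 e a : ins 0 e a 0%N = e. Proof. by []. Qed.

Lemma ins_ins i j e f a : (j <= i)%N ->
  ins i.+1 e (ins j f a) = ins j f (ins i e a).
Proof.
move=> ji; apply/funext => l; rewrite /ins.
have [lj|jl|->] := ltngtP l j.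
- by rewrite (leq_trans lj (leqW ji)) (leq_trans lj ji).
- case: l jl => // l; rewrite /= ltnS eqSS => jl.
  rewrite ltnS; case: (ltngtP l i) => // li; by have [] := ltngtP l j => //; lia.
- by rewrite ltnS ji.
Qed.

Lemma valid_le T k m (u : raw T) : (k <= m)%N -> valid k u -> valid m u.
Proof. by move=> km vu a b ab; apply: vu => j jk; apply: ab; apply: leq_trans km. Qed.

Lemma valid_trunc T k (u : raw T) : valid k u -> u \o trunc k = u.
Proof. by move=> vu; apply/funext => a; apply: vu => j jk; rewrite /trunc jk. Qed.

Lemma valid_ins T k i e (u : raw T) : (i <= k)%N -> valid k.+1 u ->
  valid k (u \o ins i e).
Proof.
move=> ik vu a b ab; apply: vu => j jk; rewrite /ins.
case: ltngtP => // [ji|ij]; apply: ab; first exact: leq_trans ji ik.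
by case: j ij jk.
Qed.

Lemma ins_last T k e (u : raw T) : valid k u -> u \o ins k e = u.
Proof. by move=> vu; apply/funext => a; apply: vu => j jk; rewrite /ins jk. Qed.

Lemma subrACA (V : zmodType) (a b c e : V) : a - b - (c - e) = a - c - (b - e).
Proof. by rewrite !opprB addrACA [RHS]addrACA [- b + _]addrC. Qed.

(** * Cubical coboundary, subdivision, and its homotopy to the identity *)

Section Coefficients.
Variable M : zmodType.
Implicit Types T : Type.

Definition fdiff T (F : raw T -> M) (u : raw T) i :=
  F (u \o ins i i0) - F (u \o ins i i1).

Definition cob (k : nat) T (F : raw T -> M) (u : raw T) : M :=
  \sum_(0 <= i < k.+1) fdiff F u i *~ (-1) ^+ i.+1.

Lemma cobS k T (F : raw T -> M) u :
  cob k.+1 F u = cob k F u + fdiff F u k.+1 *~ (-1) ^+ k.+2.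
Proof. by rewrite /cob big_nat_recr. Qed.

Lemma cob0 T (F : raw T -> M) u : cob 0 F u = F (u \o ins 0 i1) - F (u \o ins 0 i0).
Proof. by rewrite /cob big_nat1 /fdiff expr1 mulrN1z opprB. Qed.

Lemma eq_cob k T (F G : raw T -> M) u :
  (forall i e, (i <= k)%N -> F (u \o ins i e) = G (u \o ins i e)) ->
  cob k F u = cob k G u.
Proof. by move=> FG; apply: eq_big_nat => i /= ik; rewrite /fdiff !FG. Qed.

Lemma cobB k T (F G : raw T -> M) u : cob k (F \- G) u = cob k F u - cob k G u.
Proof.
rewrite /cob -sumrB; apply: eq_bigr => i _; rewrite -mulrzBl /fdiff /=.
by congr (_ *~ _); rewrite subrACA.
Qed.

Lemma cobD k T (F G : raw T -> M) u : cob k (F \+ G) u = cob k F u + cob k G u.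
Proof.
rewrite /cob -big_split /=; apply: eq_bigr => i _; rewrite -mulrzDl /fdiff /=.
by congr (_ *~ _); rewrite opprD addrACA.
Qed.

Lemma cob_sum k T (J : Type) (r : seq J) (F : J -> raw T -> M) u :
  cob k (fun v => \sum_(j <- r) F j v) u = \sum_(j <- r) cob k (F j) u.
Proof.
rewrite /cob exchange_big /=; apply: eq_bigr => i _.
by rewrite /fdiff -sumrB mulrz_suml.
Qed.

Lemma cob_eq0 k T (F : raw T -> M) u :
  (forall i e, (i <= k)%N -> F (u \o ins i e) = 0) -> cob k F u = 0.
Proof.
by move=> F0; rewrite /cob big_nat big1 // => i ik; rewrite /fdiff !F0 // subr0 mul0rz.
Qed.

Lemma cob_eq0b k T (F : raw T -> M) u :
  (forall i (b : bool), (i <= k)%N -> F (u \o ins i (if b then i1 else i0)) = 0) ->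
  cob k F u = 0.
Proof.
move=> F0; rewrite /cob big_nat big1 // => i ik.
by rewrite /fdiff (F0 i false ik) (F0 i true ik) subrr mul0rz.
Qed.

(** In the induction the new last row cancels the new last column term by term: the hypothesis
    identifies the entries, and the exponents of their signs differ by one. *)
Lemma alt_sum_eq0 (T : nat -> nat -> M) k :
  (forall i j, (j <= i)%N -> T i.+1 j = T j i) ->
  \sum_(0 <= i < k.+2) \sum_(0 <= j < k.+1) T i j *~ (-1) ^+ (i + j) = 0.
Proof.
move=> Tij; elim: k => [|k IH].
  by rewrite big_nat_recr //= !big_nat1 Tij //= mulrN1z expr0 mulr1z subrr.
rewrite big_nat_recr //=.
rewrite (eq_bigr (fun i => \sum_(0 <= j < k.+1) T i j *~ (-1) ^+ (i + j) +
  T i k.+1 *~ (-1) ^+ (i + k.+1))); last by move=> i _; rewrite big_nat_recr.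
rewrite big_split /= IH add0r -big_split /= big_nat big1 // => i ik.
by rewrite Tij 1?addSn 1?addnC 1?exprS ?mulN1r ?mulrNz ?subrr //; lia.
Qed.

Lemma cob_cob k T (F : raw T -> M) u : cob k.+1 (cob k F) u = 0.
Proof.
(* [X i j] gathers the four double faces in directions [i] and [j], with the signs of the two ends;
   the cubical identity [ins_ins] gives it the symmetry that [alt_sum_eq0] asks for. *)
pose X i j := \sum_(e <- [:: false; true]) \sum_(f <- [:: false; true])
  F (u \o ins i (if e then i1 else i0) \o ins j (if f then i1 else i0))
  *~ (-1) ^+ (e + f).
rewrite -[RHS](@alt_sum_eq0 (fun i j => X i j) k); last first.
  move=> i j ji; rewrite /X exchange_big /=; apply: eq_bigr => e _.
  apply: eq_bigr => f _; rewrite addnC; congr (F _ *~ _).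
  by apply/funext => a /=; rewrite ins_ins.
apply: eq_bigr => i _; rewrite {1}/fdiff /cob -sumrB mulrz_suml.
apply: eq_bigr => j _; rewrite -mulrzBl -mulrzA !exprS mulrACA mulrNN mulr1 mul1r.
rewrite -exprD [(j + i)%N]addnC; congr (_ *~ _).
rewrite /X !big_cons !big_nil /fdiff /= !addr0 !(addn0, add0n, addn1) expr0 expr1 sqrrN expr1n.
by rewrite !mulrN1z !mulr1z opprB; congr (_ + _); rewrite addrC.
Qed.

(** Vanishing is required on every degenerate raw cube, continuous or not, so that normalization can
    be used without any continuity argument. *)
Definition nrm (k : nat) T (F : raw T -> M) :=
  forall u, (0 < k)%N -> valid k.-1 u -> F u = 0.

Lemma nrm_cob k T (F : raw T -> M) : nrm k F -> nrm k.+1 (cob k F).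
Proof.
move=> nF u _ /= vu; case: k nF vu => [|k] nF vu.
  by rewrite cob0 !ins_last // subrr.
rewrite cobS /fdiff !ins_last // subrr mul0rz addr0.
by apply: cob_eq0 => i e ik; apply: nF => //; exact: valid_ins.
Qed.

Lemma nrmB k T (F G : raw T -> M) : nrm k F -> nrm k G -> nrm k (F \- G).
Proof. by move=> nF nG u k0 vu /=; rewrite nF // nG // subr0. Qed.

Lemma nrmD k T (F G : raw T -> M) : nrm k F -> nrm k G -> nrm k (F \+ G).
Proof. by move=> nF nG u k0 vu /=; rewrite nF // nG // addr0. Qed.

(** Prism formula: [C] adds a new first coordinate, whose two faces give the end terms; the other
    faces move up by one direction and change sign. *)
Lemma cob_cone k T T' (F : raw T -> M) (C : raw T' -> raw T) u :
  (forall i e, C u \o ins i.+1 e = C (u \o ins i e)) ->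
  cob k.+1 F (C u) =
    F (C u \o ins 0 i1) - F (C u \o ins 0 i0) - cob k (F \o C) u.
Proof.
move=> Cu; rewrite /cob big_nat_recl // {1}/fdiff expr1 mulrN1z opprB.
congr (_ + _); rewrite -sumrN; apply: eq_bigr => i _.
by rewrite /fdiff /= !Cu exprS mulN1r mulrNz.
Qed.

Definition half (j : nat) (e : bool) (a : seqI) : seqI :=
  fun l => if l == j then ihalf e (a l) else a l.

(** Halving an edge preserves orientation, so the 2^k subcubes are summed without signs. *)
Fixpoint Sd (k : nat) T (F : raw T -> M) (u : raw T) : M :=
  if k is k'.+1 then Sd k' F (u \o half k' false) + Sd k' F (u \o half k' true)
  else F u.

Lemma SdB k T (F G : raw T -> M) u : Sd k (F \- G) u = Sd k F u - Sd k G u.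
Proof. by elim: k u => [//|k IH] u /=; rewrite !IH opprD addrACA. Qed.

Lemma SdMz k T (F : raw T -> M) u n : Sd k (fun v => F v *~ n) u = Sd k F u *~ n.
Proof. by elim: k u => [//|k IH] u /=; rewrite !IH mulrzDl. Qed.

Lemma Sd_comp k T T' (F : raw T -> M) (C : raw T' -> raw T) u :
  (forall j e v, (j < k)%N -> C v \o half j e = C (v \o half j e)) ->
  Sd k F (C u) = Sd k (F \o C) u.
Proof.
elim: k u => [//|k IH] u CE /=; rewrite !CE // !IH // => j e v jk; apply: CE.
  exact: ltnW.
exact: ltnW.
Qed.

Lemma half_ins_gt i j e f : (i < j)%N -> ins i e \o half j.-1 f = half j f \o ins i e.
Proof.
case: j => // j ij; apply/funext => a; apply/funext => l; rewrite /half /ins /=.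
have [li|il|->] := ltngtP l i.
- have -> : (l == j) = false by lia.
  by have -> : (l == j.+1) = false by lia.
- by case: l il => // l il; rewrite eqSS.
- by have -> : (i == j.+1) = false by lia.
Qed.

Lemma half_ins_lt i j e f : (j < i)%N -> ins i e \o half j f = half j f \o ins i e.
Proof.
move=> ji; apply/funext => a; apply/funext => l; rewrite /half /ins /=.
have [//|il|->] := ltngtP l i; last by have -> : (i == j) = false by lia.
have -> : (l == j) = false by lia.
by have -> : (l.-1 == j) = false by lia.
Qed.

Lemma half_ins_eq i e f : half i f \o ins i e = ins i (ihalf f e).
Proof.
by apply/funext => a; apply/funext => l; rewrite /half /ins /=; case: ltngtP.
Qed.

(** Cutting one direction in two creates an interior face, common to both halves by [ihalf_mid] and
    counted with opposite signs, so only the outer faces survive. The induction peels off the last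
    direction. *)
Lemma cob_Sd k T (F : raw T -> M) u : cob k (Sd k F) u = Sd k.+1 (cob k F) u.
Proof.
have E m (G : raw T -> M) v e :
    Sd m G (v \o ins m e) = Sd m (fun w => G (w \o ins m e)) v.
  apply: (@Sd_comp m T T G (fun w => w \o ins m e)) => l f w lm.
  by rewrite -[LHS]/(w \o (ins m e \o half l f)) half_ins_lt.
have last m (G : raw T -> M) v :
    fdiff (Sd m G) v m = Sd m.+1 (fun w => fdiff G w m) v.
  have H f : Sd m (fun w => fdiff G w m) (v \o half m f) =
      Sd m G (v \o ins m (ihalf f i0)) - Sd m G (v \o ins m (ihalf f i1)).
    rewrite -!half_ins_eq -![_ \o (_ \o ins _ _)]/((v \o half m f) \o ins m _).
    by rewrite !E -SdB.
  by rewrite /= !H ihalf_00 ihalf_11 ihalf_mid /fdiff subrKA.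
elim: k u => [|k IH] u.
  by rewrite {1}/cob big_nat1 last -SdMz /= /cob !big_nat1.
have -> : cob k.+1 (Sd k.+1 F) u =
    Sd k.+2 (cob k F) u + fdiff (Sd k.+1 F) u k.+1 *~ (-1) ^+ k.+2.
  rewrite cobS; congr (_ + _) => /=; rewrite -!/(Sd k.+1 _ _) -!IH.
  rewrite /cob -big_split /= big_nat [RHS]big_nat; apply: eq_bigr => i /andP[_ ik].
  rewrite -mulrzDl; congr (_ *~ _); rewrite /fdiff /=.
  have H e f : (u \o ins i e) \o half k f = (u \o half k.+1 f) \o ins i e.
    by rewrite -[LHS]/(u \o (ins i e \o half k.+1.-1 f)) half_ins_gt.
  by rewrite !H opprD addrACA.
rewrite last -SdMz.
set n := (-1) ^+ _; elim: (k.+2) u => [|m IHm] u; first by rewrite /= cobS.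
by rewrite /= -!IHm addrACA.
Qed.

Lemma SdS k T (F : raw T -> M) u :
  Sd k.+1 F u = Sd k F (u \o half k false) + Sd k F (u \o half k true).
Proof. by []. Qed.

Arguments Sd : simpl never.

(** Straight-line cone with vertex the origin; coordinate 0 is the cone parameter. It acts on
    reparametrizations because the model cube is convex while the target space need not be. *)
Definition coneR (s : raw seqI) : raw seqI :=
  fun a j => imul (a 0%N) (s (shift a) j).

Lemma coneR_ins s i e : coneR s \o ins i.+1 e = coneR (s \o ins i e).
Proof.
apply/funext => a; apply/funext => j; rewrite /coneR /=; congr imul.
congr (s _ j); apply/funext => l; rewrite /shift /ins /= ltnS eqSS.
by case: ltngtP => //; case: l.
Qed.

(** Acyclic models, dualized: on the universal cube [trunc k] the chain homotopy is the cone over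
    (identity - subdivision - homotopy of the boundary), and it is carried to other cubes along [u].
    Here [F] has degree [k.+1] and the result has degree [k]. *)
Fixpoint Kh (k : nat) T (F : raw T -> M) (u : raw T) : M :=
  let G := fun s : raw seqI => F (u \o coneR s) in
  G (trunc k) - Sd k G (trunc k) -
  (if k is k'.+1 then cob k' (Kh k' G) (trunc k) else 0).

Lemma Kh_comp k T (F : raw T -> M) u s :
  Kh k (fun s' : raw seqI => F (u \o s')) s = Kh k F (u \o s).
Proof. by case: k. Qed.

Lemma KhS k T (F : raw T -> M) u : Kh k.+1 F u =
  F (u \o coneR (trunc k.+1)) -
  Sd k.+1 (fun s : raw seqI => F (u \o coneR s)) (trunc k.+1) -
  cob k (Kh k (fun s : raw seqI => F (u \o coneR s))) (trunc k.+1).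
Proof. by []. Qed.

Arguments Kh : simpl never.

Lemma KhB k T (F G : raw T -> M) u : Kh k (F \- G) u = Kh k F u - Kh k G u.
Proof.
elim: k T F G u => [|k IH] T F G u; first by rewrite /Kh /Sd !subr0 !subrr ?subr0.
rewrite !KhS -[fun s => _ - _]/((fun s : raw seqI => F (u \o coneR s)) \-
  (fun s : raw seqI => G (u \o coneR s))) SdB.
rewrite (@eq_cob _ _ _ (Kh k (fun s : raw seqI => F (u \o coneR s)) \-
  Kh k (fun s : raw seqI => G (u \o coneR s)))); last by move=> i e ik; rewrite IH.
by rewrite cobB /= (subrACA (F _)) subrACA.
Qed.

Lemma valid_comp T k m (u : raw T) (s : raw seqI) : valid k u ->
  (forall j, (j < k)%N -> valid m (fun a => s a j)) -> valid m (u \o s).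
Proof. by move=> vu vs a b ab; apply: vu => j jk; apply: vs jk _ _ ab. Qed.

Lemma coneR_valid k s j :
  valid k (fun a => s a j) -> valid k.+1 (fun a => coneR s a j).
Proof.
move=> vs a b ab; rewrite /coneR ab //; congr imul; apply: vs => l lk.
by rewrite /shift ab.
Qed.

Lemma trunc_valid k m j : (j < m)%N -> valid m (fun a => trunc k a j).
Proof. by move=> jm a b ab; rewrite /trunc ab. Qed.

Lemma trunc_valid' k j : valid k (fun a => trunc k a j).
Proof. by move=> a b ab; rewrite /trunc; case: ifP => // /ab. Qed.

(** Prism formula for cones: the face at parameter 1 returns the cube, the face at parameter 0 is
    constant and killed by normalization, and the remaining term is controlled by the induction
    hypothesis on the faces of the universal cube, up to a double coboundary. *)
Lemma Kh_homotopy k T (F : raw T -> M) u : nrm k F -> valid k u ->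
  (if k is k'.+1 then cob k' (Kh k' F) u else 0) + Kh k (cob k F) u =
  F u - Sd k F u.
Proof.
elim: k T F u => [|k IH] T F u nF vu.
  by rewrite add0r /Kh /Sd subr0 !subrr.
set t := trunc k.+1.
pose G1 (s : raw seqI) := F (u \o s).
pose G0 (s : raw seqI) := F (u \o coneR s).
have GE : (fun s => cob k.+1 F (u \o coneR s)) = G1 \- cob k G0.
  apply/funext => s; rewrite -[LHS]/(cob k.+1 G1 (coneR s)) cob_cone; last first.
    exact: coneR_ins.
  congr (_ - _); rewrite /G1.
  have -> : coneR s \o ins 0 i1 = s.
    by apply/funext => a; apply/funext => j; rewrite /coneR /= imul1 ins_shift.
  rewrite [X in _ - X]nF ?subr0 // => a b ab /=; congr u.
  by apply/funext => j; rewrite /coneR /= !imul0.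
have nG0 : nrm k G0.
  case: k {IH t GE} nF vu => // k nF vu s _ /= vs; apply: nF => // /=.
  apply: valid_comp (vu) _ => j jk; apply: coneR_valid => a b ab.
  by rewrite (vs _ _ ab).
have KE : cob k (Kh k (cob k G0)) t = cob k G0 t - cob k (Sd k G0) t.
  rewrite -cobB; case: k IH @t G1 @G0 GE nG0 nF vu => [|k] IH t G1 G0 GE nG0 nF vu.
    apply: eq_cob => i e ik /=; have := IH _ G0 (t \o ins i e) nG0.
    by rewrite add0r => -> // a b ab; rewrite /t; apply/funext => j; rewrite /= /trunc; case: ifP => // j1; move: i ik j j1 => [|//] _ [|//].
  rewrite -[RHS]subr0 -(cob_cob k (Kh k G0) t) -cobB.
  apply: eq_cob => i e ik /=; rewrite -(IH _ G0) //; first by rewrite addrAC subrr add0r.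
  apply: valid_ins => // a b ab; apply/funext => j; exact: trunc_valid'.
have -> : Kh k.+1 (cob k.+1 F) u =
   (G1 \- cob k G0) t - Sd k.+1 (G1 \- cob k G0) t - cob k (Kh k (G1 \- cob k G0)) t.
  by rewrite -GE.
have -> : cob k (Kh k (G1 \- cob k G0)) t =
    cob k (Kh k F) u - cob k (Kh k (cob k G0)) t.
  have -> : cob k (Kh k F) u = cob k (Kh k G1) t.
    rewrite -{1}(valid_trunc vu); apply: eq_bigr => i _.
    by rewrite /fdiff /G1 !Kh_comp.
  by rewrite -cobB; apply: eq_cob => i e ik; rewrite KhB.
rewrite KE SdB -cob_Sd /= -!/(Sd k.+1 _ _).
have -> : G1 t = F u by rewrite /G1 valid_trunc.
have -> : Sd k.+1 G1 t = Sd k.+1 F u.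
  rewrite -[in RHS](valid_trunc vu).
  by rewrite -(@Sd_comp k.+1 T _ F (fun s => u \o s)).
set a := F u; set b := cob k G0 t; set e := Sd k.+1 F u; set f := cob k (Sd k G0) t.
set g := cob k _ u.
by rewrite (subrACA a) (subrACA _ _ g) subrr subr0 addrC subrK.
Qed.

Definition sub (e : seq bool) (a : seqI) : seqI :=
  fun j => if (j < size e)%N then ihalf (nth false e j) (a j) else a j.

Lemma half_sub e b : half (size e) b \o sub e = sub (rcons e b).
Proof.
apply/funext => a; apply/funext => j; rewrite /half /sub /= size_rcons nth_rcons ltnS.
by case: ltngtP.
Qed.

Lemma Sd_eq0 k T (F : raw T -> M) u :
  (forall e, size e = k -> F (u \o sub e) = 0) -> Sd k F u = 0.
Proof.
elim: k u => [|k IH] u Fu.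
  exact: Fu [::] erefl.
have H b : Sd k F (u \o half k b) = 0.
  apply: IH => e ek; have := Fu (rcons e b); rewrite size_rcons ek => <- //.
  by rewrite -half_sub ek.
by rewrite SdS !H addr0.
Qed.

Lemma nrm_Sd k T (F : raw T -> M) : nrm k F -> nrm k (Sd k F).
Proof.
move=> nF u k0 vu; apply: Sd_eq0 => e _; apply: nF => //.
apply: (valid_comp vu) => j jk a b ab.
by rewrite /sub ab.
Qed.

(** Cones over, and subdivisions of, a degenerate cube are degenerate, which disposes of the first
    two terms; the boundary term needs the truncation argument below. *)
Lemma nrm_Kh k T (F : raw T -> M) : nrm k.+1 F -> nrm k (Kh k F).
Proof.
elim: k T F => [|k IH] T F nF u // _ /= vu.
set G := fun s : raw seqI => F (u \o coneR s).
have G0 s : (forall j, (j < k)%N -> valid k (fun a => s a j)) -> G s = 0.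
  by move=> vs; apply: nF => //; apply: (valid_comp vu) => j jk; exact: coneR_valid (vs j jk).
rewrite -[Kh _ _ _]/(G (trunc k.+1) - Sd k.+1 G (trunc k.+1) -
  cob k (Kh k G) (trunc k.+1)) G0 ?sub0r; last by move=> j jk; apply: trunc_valid.
rewrite Sd_eq0 ?oppr0 ?sub0r; last first.
  move=> e _; apply: G0 => j jk a b ab; rewrite /= /trunc; case: ifP => // _.
  by rewrite /sub ab.
(* As [u] ignores coordinate [k], the universal cube may be truncated one coordinate earlier; it
   then becomes degenerate itself. *)
have GE s : G (trunc k \o s) = G s.
  rewrite /G -[in RHS](valid_trunc vu); congr F; apply/funext => a /=; congr u.
  apply/funext => j; rewrite /coneR /trunc /=; case: ifP => // _.
  by rewrite imulr0.
have -> : cob k (Kh k G) (trunc k.+1) = cob k (Kh k G) (trunc k).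
  have -> : trunc k = trunc k \o trunc k.+1.
    apply/funext => a; apply/funext => j; rewrite /trunc /=; case: ifP => // jk.
    by rewrite ltnW.
  have KE s : Kh k G (trunc k \o s) = Kh k G s.
    rewrite -(Kh_comp k G (trunc k) s); congr Kh.
    by apply/funext => s'; rewrite GE.
  by apply: eq_bigr => i _; rewrite /fdiff -(KE (trunc k.+1 \o ins i i0))
    -(KE (trunc k.+1 \o ins i i1)).
rewrite (@nrm_cob k _ (Kh k G)) ?oppr0 //.
  by apply: IH => s _ vs; apply: G0 => j jk a b ab; rewrite (vs _ _ ab).
by move=> a b ab; apply/funext => j; exact: trunc_valid'.
Qed.

End Coefficients.
End RawCubes.

Arguments Sd : simpl never.
Arguments Kh : simpl never.

Arguments i0 {R}.
Arguments i1 {R}.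

Section ContinuousArithmetic.
Variables (K : numFieldType) (X : topologicalType).
Implicit Types f g : X -> K.

Lemma contM f g : continuous f -> continuous g -> continuous (fun x => f x * g x).
Proof. by move=> fc gc x; apply: cvgM; [exact: fc|exact: gc]. Qed.

Lemma contD f g : continuous f -> continuous g -> continuous (fun x => f x + g x).
Proof. by move=> fc gc x; apply: cvgD; [exact: fc|exact: gc]. Qed.

Lemma contB f g : continuous f -> continuous g -> continuous (fun x => f x - g x).
Proof. by move=> fc gc x; apply: cvgB; [exact: fc|exact: gc]. Qed.

Lemma cont_cst (c : K) : continuous (fun _ : X => c).
Proof. exact: cst_continuous. Qed.

End ContinuousArithmetic.

(** * Continuous cubes, reparametrizations and Lebesgue numbers *)

Section TopologicalCubes.
Variable R : realType.
Local Notation I := (itv01 R).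
Local Notation seqI := (nat -> I).
Local Notation raw T := (seqI -> T).

Lemma cube_of_subproof k (a : seqI) : (\row_(j < k) val (a j)) \in cube R k.
Proof. by apply/mem_set => j; rewrite mxE; exact: valP (a j). Qed.

Definition cube_of k (a : seqI) : cube R k :=
  exist _ (\row_(j < k) val (a j)) (cube_of_subproof k a).

Definition seq_of k (t : cube R k) : seqI := fun j =>
  if insub j is Some i then exist _ (val t ord0 i) (set_valP t i) else i0.

Lemma seq_of_ord k (t : cube R k) (i : 'I_k) : val (seq_of t i) = val t ord0 i.
Proof. by rewrite /seq_of valK. Qed.

Lemma seq_of_lt k (t : cube R k) j (jk : (j < k)%N) :
  val (seq_of t j) = val t ord0 (Ordinal jk).
Proof. by rewrite -seq_of_ord. Qed.

Lemma seq_of_ge k (t : cube R k) j : (k <= j)%N -> seq_of t j = i0.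
Proof. by move=> kj; rewrite /seq_of insubF // ltnNge kj. Qed.

Lemma seq_ofK k (t : cube R k) : cube_of k (seq_of t) = t.
Proof.
apply/val_inj/rowP => i; rewrite mxE; exact: seq_of_ord.
Qed.

Lemma cube_ofK k a j : (j < k)%N -> seq_of (cube_of k a) j = a j.
Proof. by move=> jk; apply/val_inj; rewrite seq_of_lt /= mxE. Qed.

Lemma continuous_coord k j : continuous (fun t : cube R k => val (seq_of t j) : R).
Proof.
have [jk|kj] := ltnP j k; last first.
  rewrite (_ : (fun _ => _) = (fun=> 0)); first exact: cst_continuous.
  by apply/funext => t; rewrite seq_of_ge.
rewrite (_ : (fun _ => _) = (fun t : cube R k => val t ord0 (Ordinal jk))).
  move=> t; exact: (continuous_comp (@continuous_val _ (cube R k) t)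
  (@continuous_mx_entry _ _ _ ord0 (Ordinal jk) (\val t))).
by apply/funext => t; rewrite seq_of_lt.
Qed.

Lemma continuous_cube_of (X : topologicalType) k (f : X -> seqI) :
  (forall j, (j < k)%N -> continuous (fun x => val (f x j) : R)) ->
  continuous (fun x => cube_of k (f x)).
Proof.
move=> fc; apply: continuous_comp_initial; apply: continuous_mxP => i j.
under [X in continuous X]eq_fun do rewrite /= mxE.
exact: fc.
Qed.

Definition std m (s : raw seqI) := forall j,
  valid m (fun a => s a j) /\
  continuous (fun t : cube R m => val (s (seq_of t) j) : R).

Definition scube (E : topologicalType) (A : set E) k (u : raw E) :=
  [/\ valid k u, continuous (fun t : cube R k => u (seq_of t)) & forall a, A (u a)].

Lemma scubeS (E : topologicalType) (A B : set E) k u :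
  A `<=` B -> scube A k u -> scube B k u.
Proof. by move=> AB [vu cu Au]; split=> // a; exact: AB. Qed.

Lemma comp_std_cont (E : topologicalType) k m (u : raw E) (s : raw seqI) :
  valid k u -> continuous (fun t : cube R k => u (seq_of t)) ->
  (forall j, (j < k)%N -> continuous (fun t : cube R m => val (s (seq_of t) j) : R)) ->
  continuous (fun t : cube R m => u (s (seq_of t))).
Proof.
move=> vu cu cs.
rewrite (_ : (fun _ => _) =
  (fun t : cube R k => u (seq_of t)) \o (fun t => cube_of k (s (seq_of t)))).
  by move=> t; exact: (continuous_comp (@continuous_cube_of _ k _ cs t) (cu _)).
by apply/funext => t /=; apply: vu => j jk; rewrite cube_ofK.
Qed.

Lemma scube_std (E : topologicalType) (A : set E) k m u s :
  scube A k u -> (forall j, (j < k)%N -> valid m (fun a => s a j)) ->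
  (forall j, (j < k)%N -> continuous (fun t : cube R m => val (s (seq_of t) j) : R)) ->
  scube A m (u \o s).
Proof.
move=> [vu cu Au] vs cs; split; first exact: valid_comp vu vs.
- exact: (comp_std_cont vu cu cs).
- by move=> a; exact: Au.
Qed.

Lemma scube_comp (E : topologicalType) (A : set E) k m u s :
  scube A k u -> std m s -> scube A m (u \o s).
Proof. by move=> Au ss; apply: scube_std Au _ _ => j _; case: (ss j). Qed.

Lemma std_comp k m s s' : std k s -> std m s' -> std m (s \o s').
Proof.
move=> ss ss' j; have [vj cj] := ss j; split.
  by apply: valid_comp vj _ => l _; case: (ss' l).
have vj' : valid k (fun a => val (s a j)) by move=> a b ab; rewrite (vj a b ab).
by apply: (@comp_std_cont R k m _ s' vj' cj) => l _; case: (ss' l).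
Qed.

Lemma scube_ins (E : topologicalType) (A : set E) k u i e :
  (i <= k)%N -> scube A k.+1 u -> scube A k (u \o ins i e).
Proof.
move=> ik Au; apply: (scube_std Au) => j jk.
  move=> a b ab; rewrite /ins; case: (ltngtP j i) => ji; rewrite ?ab //; lia.
rewrite /ins; case: (ltngtP j i) => _; [exact: continuous_coord|exact: continuous_coord|].
exact: cst_continuous.
Qed.

Lemma std_ins k i e : (i <= k)%N -> std k.+1 (trunc k.+1) -> std k (trunc k.+1 \o ins i e).
Proof.
move=> ik _ j; split.
  move=> a b ab; rewrite /trunc /ins /=; case: ifP => // jk.
  by case: (ltngtP j i) => ji; rewrite ?ab //; lia.
rewrite /trunc /ins /=; case: (ltnP j k.+1) => _; last exact: cst_continuous.
case: (ltngtP j i) => _; [exact: continuous_coord|exact: continuous_coord|].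
exact: cst_continuous.
Qed.

Lemma std_trunc k : std k (trunc k).
Proof.
move=> j; split; first by apply: trunc_valid'.
by rewrite /trunc; case: (ltnP j k) => _; [exact: continuous_coord|exact: cst_continuous].
Qed.

Lemma continuous_half (X : topologicalType) (f : X -> I) e :
  continuous (fun x => val (f x) : R) -> continuous (fun x => val (ihalf e (f x)) : R).
Proof.
move=> fc; rewrite /ihalf /=; apply: contM; last exact: cont_cst.
by apply: contD => //; exact: cont_cst.
Qed.

Lemma std_shift k : std k.+1 (fun a => shift (trunc k.+1 a)).
Proof.
move=> j; rewrite /shift; split; first exact: trunc_valid'.
by case: (std_trunc k.+1 j.+1).
Qed.

Lemma std_sub k e : std k (trunc k \o sub e).
Proof.
move=> j; split.
  by move=> a b ab; rewrite /sub /trunc /=; case: ifP => // jk; rewrite ab.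
rewrite /trunc /sub /=; case: (ltnP j k) => // jk; last exact: cst_continuous.
case: (ltnP j (size e)) => _; last exact: continuous_coord.
exact/continuous_half/continuous_coord.
Qed.

Lemma std_cone k s : std k s -> std k.+1 (coneR s).
Proof.
move=> ss j; split; first by apply: coneR_valid; case: (ss j).
rewrite /coneR /=; apply: contM; first exact: continuous_coord.
have [vj cj] := ss j.
rewrite (_ : (fun _ => _) = (fun t : cube R k.+1 => val (s (shift (trunc k.+1 (seq_of t))) j))).
  have [_ H] := std_comp ss (@std_shift k) j; exact: H.
apply/funext => t'; congr val; apply: vj => l lk.
by rewrite /shift /trunc ltnS lk.
Qed.

Lemma scube_cst (E : topologicalType) (A : set E) k x : A x -> scube A k (fun=> x).
Proof. by move=> Ax; split=> // ; exact: cst_continuous. Qed.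

Section Support.
Variable M : zmodType.

(** Unfolding the recursion, [F] is only evaluated on reparametrizations of [u] taken from a finite
    list independent of [F] and [u]. Finiteness gives uniform bounds in excision; [std] makes each
    [u \o L j] a continuous cube inside any set that contains the image of [u]. *)
Lemma Kh_support k : exists (J : finType) (L : J -> raw seqI),
  (forall j, std k.+1 (L j)) /\
  forall (T : Type) (F : raw T -> M) u,
    (forall j, F (u \o L j) = 0) -> Kh k F u = 0.
Proof.
elim: k => [|k [J [L [sL HL]]]].
  exists unit, (fun=> coneR (trunc 0)); split=> [_|T F u F0].
    exact/std_cone/std_trunc.
  by rewrite /Kh /Sd !F0 // !subrr.
pose JJ : finType := (unit + k.+1.-tuple bool + 'I_k.+1 * bool * J)%type.
exists JJ, (fun x : JJ => match x with
  | inl (inl _) => coneR (trunc k.+1)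
  | inl (inr e) => coneR (trunc k.+1 \o sub (tval e))
  | inr (i, b, j) =>
      coneR (trunc k.+1 \o ins (nat_of_ord i) (if b then i1 else i0) \o L j)
  end); split.
  move=> [[_|e]|[[i b] j]].
  - exact/std_cone/std_trunc.
  - exact/std_cone/std_sub.
  - apply/std_cone/(std_comp _ (sL j)); apply: std_ins; first by case: i.
    exact: std_trunc.
move=> T F u F0; rewrite KhS.
have -> := F0 (inl (inl tt)).
rewrite Sd_eq0 ?subrr ?sub0r; last first.
  by move=> e /eqP ek; have := F0 (inl (inr (Tuple ek))).
rewrite cob_eq0b ?oppr0 // => i b ik.
by apply: HL => j; have := F0 (inr (Ordinal (ik : (i < k.+1)%N), b, j)).
Qed.

Definition small (n : nat) (s : raw seqI) :=
  forall a b j, `|val (s a j) - val (s b j)| <= (2 : R) ^- n.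

(** The iterated subdivision is a sum over subcubes of side 2^-n, each of the form [u \o s] with [s]
    small. *)
Lemma iter_Sd_eq0 k T (F : raw T -> M) n u :
  (forall s, std k s -> small n s -> F (u \o s) = 0) ->
  valid k u -> iter n (Sd k (T := T)) F u = 0.
Proof.
elim: n u => [|n IH] u F0 vu.
  rewrite /= -(valid_trunc vu); apply: F0; first exact: std_trunc.
  move=> a b j; rewrite expr0 invr1; have := valP (trunc k a j).
  have := valP (trunc k b j); move=> /andP[? ?] /andP[? ?].
  by rewrite ler_norml; apply/andP; split; lra.
rewrite iterS; apply: Sd_eq0 => e ek; apply: IH.
  move=> s ss sm; rewrite -[_ \o s]/(u \o (sub e \o s)).
  have E : u \o (sub e \o s) = u \o (trunc k \o sub e \o s).
    by apply/funext => a; apply: vu => j jk; rewrite /= /trunc jk.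
  rewrite E; apply: F0; first exact: std_comp (std_sub k e) ss.
  move=> a b j; rewrite /= /trunc; case: ifP => jk; last first.
    by rewrite subrr normr0 invr_ge0 exprn_ge0.
  rewrite /sub ek jk /= -mulrBl opprD addrACA subrr addr0 normrM.
  rewrite [`|2^-1|]ger0_norm ?invr_ge0// exprSr invfM.
  by rewrite ler_wpM2r ?invr_ge0 //; exact: sm.
by apply: valid_comp vu _ => j jk a b ab; rewrite /sub ab.
Qed.

End Support.

Lemma nbhs_cube k (t : cube R k) (B : set (cube R k)) :
  nbhs t B <-> exists2 e : R, 0 < e &
    forall t' : cube R k,
      (forall j, `|val (seq_of t j) - val (seq_of t' j)| < e) -> B t'.
Proof.
split=> [|[e e0 eB]].
  rewrite nbhsE => -[U [[W oW <-] Wt] UB].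
  have /nbhs_ballP[e e0 eW] : nbhs (\val t) W by exact: (open_nbhs_nbhs (conj oW Wt)).
  exists e => // t' tt'; apply/UB/eW; split=> // i j.
  by rewrite (ord1 i) -!seq_of_ord; exact: tt'.
have : nbhs (\val t) (ball (\val t) e) by apply/nbhs_ballP; exists e.
move=> /(@continuous_val _ (cube R k) t) H.
apply: (@filterS _ (nbhs t) _ _ _ _ H) => t' [_ tt'].
apply: eB => j; have [jk|kj] := ltnP j k; last by rewrite !seq_of_ge // subrr normr0.
by rewrite !seq_of_lt; exact: tt'.
Qed.

Lemma cube_compact k : compact [set: cube R k].
Proof.
move=> F PF _.
have cK : compact [set v : 'rV[R]_k | forall i, `[0, 1]%classic (v ord0 i)].
  by apply: (@rV_compact R k (fun=> `[0, 1]%classic)) => _; exact: segment_compact.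
have Fv : F (\val @^-1` [set v : 'rV[R]_k | forall i, `[0, 1]%classic (v ord0 i)]).
  by apply: filterE => t i /=; rewrite in_itv; exact: (set_valP t i).
have [p [Kp clp]] := cK (\val @ F) _ Fv.
have cp : p \in cube R k.
  by apply/mem_set => i; have := Kp i; rewrite /= in_itv.
exists (exist _ p cp); split=> // A B FA.
rewrite nbhsE => -[U [[W oW <-] Wp] UB].
have FvA : F (\val @^-1` (\val @` A)) by apply: (filterS _ FA) => t At; exists t.
have [v [[t At <-] Wt]] := clp (\val @` A) W FvA (open_nbhs_nbhs (conj oW Wp)).
by exists t; split=> //; exact: UB.
Qed.

(** The form of compactness used everywhere below: for Lebesgue numbers, for the stage that contains
    a cube, and for the step size when cubes are lifted to [ET]. *)
Lemma cube_near_cover k (P : nat -> cube R k -> Prop) :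
  (forall t : cube R k, \forall t' \near t & n \near \oo, P n t') ->
  \forall n \near \oo, forall t, P n t.
Proof.
move=> H; have /compact_near_coveringP/(_ _ \oo P _) := @cube_compact k.
move=> /(_ (fun t _ => H t)) [N _ HN].
by exists N => // n /HN Pn t; exact: Pn.
Qed.

Lemma small_std_near k (t : cube R k) (B : set (cube R k)) : nbhs t B ->
  \forall t' \near t & n \near \oo, forall t'' : cube R k,
    (forall j, `|val (seq_of t' j) - val (seq_of t'' j)| <= (2 : R) ^- n) -> B t''.
Proof.
move=> /nbhs_cube[e e0 eB].
have e20 : 0 < e / 2 by rewrite divr_gt0.
exists ([set t' | forall j, `|val (seq_of t j) - val (seq_of t' j)| < e / 2],
        [set n | 1 / 2 ^+ n < e / 2]).
  split; first by apply/nbhs_cube; exists (e / 2).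
  exact: (near_infty_natSinv_expn_lt (PosNum e20)).
move=> [t' n] [/= tt' ne] t'' t't''; apply: eB => j.
rewrite -(subrK (val (seq_of t' j)) (val (seq_of t j))) -addrA.
rewrite (le_lt_trans (ler_normD _ _)) // [ltRHS]splitr; apply: ltrD.
  exact: tt'.
by rewrite (le_lt_trans (t't'' j)) // -div1r.
Qed.

Lemma lebesgue (E : topologicalType) (A B : set E) k u : open A -> open B ->
  scube (A `|` B) k u -> \forall n \near \oo, forall s, small n s ->
  (forall a, A (u (s a))) \/ (forall a, B (u (s a))).
Proof.
move=> oA oB [vu cu ABu].
pose P n (t : cube R k) := let Q (C : set E) := forall t'' : cube R k,
  (forall j, `|val (seq_of t j) - val (seq_of t'' j)| <= (2 : R) ^- n) ->
  C (u (seq_of t'')) in Q A \/ Q B.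
have Pt : \forall n \near \oo, forall t, P n t.
  apply: cube_near_cover => t; case: (ABu (seq_of t)) => ut.
    have /small_std_near := cu t A (open_nbhs_nbhs (conj oA ut)).
    by apply: filterS => -[t' n] /= ?; left.
  have /small_std_near := cu t B (open_nbhs_nbhs (conj oB ut)).
  by apply: filterS => -[t' n] /= ?; right.
apply: filterS Pt => n Pn s sm.
have H a : u (s a) = u (seq_of (cube_of k (s a))).
  by apply: vu => j jk; rewrite cube_ofK.
(* All points of the small cube are compared with its corner, so the choice between [A] and [B] is
   made once. *)
have D a j : `|val (seq_of (cube_of k (s (fun=> i0))) j) -
               val (seq_of (cube_of k (s a)) j)| <= (2 : R) ^- n.
  have [jk|kj] := ltnP j k; first by rewrite !cube_ofK.
  by rewrite !seq_of_ge // subrr normr0 invr_ge0 exprn_ge0.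
by case: (Pn (cube_of k (s (fun=> i0)))) => Q; [left|right] => a; rewrite H; exact: Q.
Qed.

End TopologicalCubes.

(** * Excision and relative acyclicity *)

Section RelativeCohomology.
Variables (R : realType) (M : zmodType).
Local Notation I := (itv01 R).
Local Notation seqI := (nat -> I).
Local Notation raw T := (seqI -> T).

(* Vanishing of the cohomology in degree [k] of the pair [(A, B)] with
   coefficients in [M]. *)
Definition acyclic (E : topologicalType) (k : nat) (A B : set E) :=
  forall F : raw E -> M, nrm k F ->
  (forall u, scube B k u -> F u = 0) ->
  (forall u, scube A k.+1 u -> cob k F u = 0) ->
  if k is k'.+1 then exists G : raw E -> M,
    [/\ nrm k' G, forall u, scube B k' u -> G u = 0 &
        forall u, scube A k u -> cob k' G u = F u]
  else forall u, scube A 0 u -> F u = 0.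

Section Excision.
Variables (E : topologicalType) (A B : set E).
Hypotheses (oA : open A) (oB : open B).

Lemma iter_cob_Sd n k (F : raw E -> M) :
  cob k (iter n (Sd k (T := E)) F) = iter n (Sd k.+1 (T := E)) (cob k F).
Proof.
elim: n => [//|n IH]; rewrite !iterS -IH; apply/funext => u; exact: cob_Sd.
Qed.

Lemma nrm_iter_Sd n k (F : raw E -> M) : nrm k F -> nrm k (iter n (Sd k (T := E)) F).
Proof. by move=> nF; elim: n => [//|n IH]; rewrite iterS; exact: nrm_Sd. Qed.

(** A fine subdivision of any cube consists of cubes in [A] and cubes in [B], where [F] vanishes.
    Hence summing the homotopies between successive subdivisions of [F] gives a primitive. *)
Lemma small_cubes k (F : raw E -> M) : nrm k.+1 F ->
  (forall u, scube A k.+1 u -> F u = 0) -> (forall u, scube B k.+1 u -> F u = 0) ->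
  (forall u, scube (A `|` B) k.+2 u -> cob k.+1 F u = 0) ->
  exists G : raw E -> M, [/\ nrm k G, forall u, scube A k u -> G u = 0 &
        forall u, scube (A `|` B) k.+1 u -> cob k G u = F u].
Proof.
move=> nF FA FB dF.
pose Fi i := iter i (Sd k.+1 (T := E)) F.
pose t i := Kh k (Fi i).
have small u : scube (A `|` B) k.+1 u -> \forall n \near \oo, Fi n u = 0.
  move=> ABu; apply: filterS (lebesgue oA oB ABu) => n Hn.
  apply: iter_Sd_eq0; last by case: ABu.
  move=> s ss /Hn; have [vu cu _] := scube_comp ABu ss.
  by case=> H; [apply: FA|apply: FB].
have [J [L [sL HL]]] := Kh_support R M k.
have tsmall u : scube (A `|` B) k u -> \forall n \near \oo, t n u = 0.
  move=> ABu.
  have : \forall n \near \oo, forall j, Fi n (u \o L j) = 0.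
    by apply: filter_forall => j; apply/small/(scube_comp ABu).
  by apply: filterS => n; exact: HL.
pose fin u := exists N, forall i, (N <= i)%N -> t i u = 0.
(* The infinite sum of the [t i] is finite on each cube of the union, with a number of terms that
   depends on the cube. Raw cubes without such a bound get the value 0. *)
pose G u := if pselect (fin u) is left e then \sum_(0 <= i < projT1 (cid e)) t i u else 0.
have GE m u : (forall i, (m <= i)%N -> t i u = 0) -> G u = \sum_(0 <= i < m) t i u.
  move=> tm; rewrite /G; case: pselect => [e|[]]; last by exists m.
  case: cid => N /= tN.
  wlog mN : m N tm tN / (m <= N)%N.
    by move=> W; case/orP: (leq_total m N) => mN; [|symmetry]; apply: W.
  rewrite (big_cat_nat (leq0n m) mN) //=.
  have -> : \sum_(m <= i < N) t i u = 0 by rewrite big_nat big1 // => i /andP[/tm].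
  by rewrite addr0.
exists G; split=> [u k0 vu|u Au|u ABu].
- rewrite (GE 0%N) ?big_nil // => i _.
  exact: (nrm_Kh (nrm_iter_Sd i nF)).
- rewrite (GE 0%N) ?big_nil // => i _; apply: HL => j.
  have Auj := scube_comp Au (sL j).
  apply: iter_Sd_eq0; last by case: Auj.
  by move=> s ss _; exact: FA _ (scube_comp Auj ss).
- have faces : \forall n \near \oo, forall i : 'I_k.+1, forall b : bool,
      t n (u \o ins i (if b then i1 else i0)) = 0.
    apply: filter_forall => i; apply: filter_forall => b; apply: tsmall.
    by apply: scube_ins => //; rewrite -ltnS.
  have [m1 _ H1] := faces; have [m2 _ H2] := small _ ABu.
  pose m := maxn m1 m2.
  have -> : cob k G u = \sum_(0 <= i < m) cob k (t i) u.
    rewrite -cob_sum /cob; rewrite big_nat [RHS]big_nat.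
    apply: eq_bigr => i /andP[_ ik]; rewrite /fdiff.
    rewrite (GE m) ?(GE m) // => j mj.
      exact: (H1 j (leq_trans (leq_maxl _ _) mj) (Ordinal ik) true).
    exact: (H1 j (leq_trans (leq_maxl _ _) mj) (Ordinal ik) false).
  have [J' [L' [sL' HL']]] := Kh_support R M k.+1.
  (* The other half of the homotopy formula involves subdivisions of [cob k.+1 F], which vanish; the
     sum therefore telescopes. *)
  have cE i : cob k (t i) u = Fi i u - Fi i.+1 u.
    rewrite -[Fi i.+1]/(Sd k.+1 (Fi i)).
    have vu : valid k.+1 u by case: ABu.
    have /= <- := @Kh_homotopy R M k.+1 E (Fi i) u (nrm_iter_Sd i nF) vu.
    rewrite iter_cob_Sd HL' ?addr0 // => j.
    have ABuj := scube_comp ABu (sL' j).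
    apply: iter_Sd_eq0; last by case: ABuj.
    by move=> s ss _; exact: dF _ (scube_comp ABuj ss).
  have tel p : \sum_(0 <= i < p) cob k (t i) u = F u - Fi p u.
    elim: p => [|p IH]; first by rewrite big_nil subrr.
    by rewrite big_nat_recr //= IH cE subrKA.
  by rewrite tel (H2 m) ?subr0 //= leq_maxr.
Qed.

(** A primitive found on [B] is extended by zero to the cubes outside [B]. Its coboundary then
    differs from [F] by a cochain that vanishes on cubes in [A] and on cubes in [B], to which
    [small_cubes] applies. *)
Lemma excision k : acyclic k B (A `&` B) -> acyclic k (A `|` B) A.
Proof.
move=> H F nF FA dF.
have {}H := H F nF (fun u ABu => FA u (scubeS (@subIsetl _ _ _) ABu))
  (fun u Bu => dF u (scubeS (@subsetUr _ _ _) Bu)).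
case: k nF FA dF H => [|k] nF FA dF.
  move=> H u ABu; have [vu cu] := ABu; move=> /(_ (fun=> i0)) uAB.
  have uE a : u a = u (fun=> i0) by apply: vu.
  by case: uAB => [Au|Bu]; [apply: FA|apply: H]; split=> // a; rewrite uE.
move=> [G0 [nG0 G0AB dG0]].
pose G1 u := if `[< scube B k u >] then G0 u else 0.
have G1B u : scube B k u -> G1 u = G0 u by move=> ?; rewrite /G1 asboolT.
have G1A u : scube A k u -> G1 u = 0.
  rewrite /G1 => Au; case: asboolP => // Bu; apply: G0AB.
  by case: Au Bu => vu cu Au [_ _ Bu]; split=> // a; split.
have nG1 : nrm k G1 by move=> u k0 vu; rewrite /G1; case: ifP => // _; exact: nG0.
have dG1A u : scube A k.+1 u -> cob k G1 u = 0.
  by move=> Au; apply: cob_eq0 => i e ik; apply/G1A/scube_ins.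
have dG1B u : scube B k.+1 u -> cob k G1 u = F u.
  move=> Bu; rewrite -dG0 //; apply: eq_cob => i e ik; apply: G1B.
  exact: scube_ins.
have [||||G2 [nG2 G2A dG2]] := @small_cubes k (F \- cob k G1).
- by apply: nrmB => //; exact: nrm_cob.
- by move=> u Au /=; rewrite FA // dG1A // subr0.
- by move=> u Bu /=; rewrite dG1B // subrr.
- by move=> u ABu; rewrite cobB cob_cob subr0 dF.
exists (G1 \+ G2); split; first exact: nrmD.
  by move=> u Au /=; rewrite G1A // G2A // addr0.
by move=> u ABu; rewrite cobD dG2 //= addrC subrK.
Qed.

End Excision.

Section Pairs.
Variables (E : topologicalType).
Implicit Types A B C : set E.

(** Exactness of the sequence of a triple: a primitive of [F] relative to [C] is a cocycle on [B].
    Subtracting the coboundary of its own primitive, extended by zero, makes it vanish on [B]. *)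
Lemma acyclic_triple k A B C : C `<=` B -> B `<=` A ->
  acyclic k.+1 A C -> acyclic k B C -> acyclic k.+1 A B.
Proof.
move=> CB BA HA HB F nF FB dF.
have [G [nG GC dG]] := HA F nF (fun u Cu => FB u (scubeS CB Cu)) dF.
have GB u : scube B k.+1 u -> cob k G u = 0.
  by move=> Bu; rewrite dG ?FB //; exact: scubeS BA Bu.
have := HB G nG GC GB; case: k HA HB F nF FB dF G nG GC dG GB => [|k] HA HB F nF FB dF G nG GC dG GB.
  by move=> G0; exists G.
move=> [H [nH HC dH]].
pose H1 u := if `[< scube B k u >] then H u else 0.
have dH1 u : scube B k.+1 u -> cob k H1 u = cob k H u.
  by move=> Bu; apply: eq_cob => i e ik; rewrite /H1 asboolT //; exact: scube_ins.
have nH1 : nrm k H1 by move=> u k0 vu; rewrite /H1; case: ifP => // _; exact: nH.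
exists (G \- cob k H1); split.
- by apply: nrmB => //; exact: nrm_cob.
- by move=> u Bu /=; rewrite dH1 // dH // subrr.
- by move=> u Au; rewrite cobB cob_cob subr0 dG.
Qed.

Definition homotopy_cube (H : I -> E -> E) (u : raw E) : raw E :=
  fun a => H (a 0%N) (u (shift a)).

Lemma homotopy_cube_ins H u i e :
  homotopy_cube H u \o ins i.+1 e = homotopy_cube H (u \o ins i e).
Proof.
apply/funext => a; rewrite /homotopy_cube /=; congr (H _ (u _)).
apply/funext => l; rewrite /shift /ins /= ltnS eqSS.
by case: ltngtP => //; case: l.
Qed.

Lemma nrm_homotopy k H (F : raw E -> M) :
  nrm k.+1 F -> nrm k (F \o homotopy_cube H).
Proof.
move=> nF u k0 vu; apply: nF => //= a b ab; rewrite /homotopy_cube ab //.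
by congr H; apply: vu => j jk; rewrite /shift ab //; lia.
Qed.

(** Prism operator of [H]. Its face at time 0 is the constant cube at [c]: degenerate in positive
    degree, and required to lie in [B] in degree 0. *)
Lemma acyclic_contractible k A B (H : I -> E -> E) (c : E) :
  (forall x, A x -> H i1 x = x) -> (forall x, A x -> H i0 x = c) ->
  (forall m u, scube A m u -> scube A m.+1 (homotopy_cube H u)) ->
  (forall m u, scube B m u -> scube B m.+1 (homotopy_cube H u)) ->
  B c \/ (0 < k)%N -> acyclic k A B.
Proof.
move=> H1 H0 HA HB Bc F nF FB dF.
have E1 m u : scube A m u -> homotopy_cube H u \o ins 0 i1 = u.
  by move=> [_ _ Au]; apply/funext => a; rewrite /homotopy_cube /= ins_shift H1.
have E0 m u : scube A m u -> homotopy_cube H u \o ins 0 i0 = (fun=> c).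
  by move=> [_ _ Au]; apply/funext => a; rewrite /homotopy_cube /= ins_shift H0.
case: k nF FB dF Bc => [|k] nF FB dF Bc.
  move=> u Au; have := dF _ (HA _ _ Au); rewrite cob0 (E1 _ _ Au) (E0 _ _ Au).
  by case: Bc => // Bc; rewrite (FB (fun=> c)) ?subr0 //; exact: scube_cst.
exists (F \o homotopy_cube H); split; first exact: nrm_homotopy.
  by move=> u Bu; apply/FB/HB.
move=> u Au; have := dF _ (HA _ _ Au).
rewrite cob_cone; last by move=> i e; exact: homotopy_cube_ins.
rewrite (E1 _ _ Au) (E0 _ _ Au) (nF (fun=> c)) // subr0.
by move/eqP; rewrite subr_eq0 => /eqP.
Qed.

End Pairs.

Lemma acyclic_retract (E E' : topologicalType) k (A B : set E) (A' B' : set E')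
    (f : E -> E') (g : E' -> E) :
  (forall m (u : raw E), scube A m u -> scube A' m (f \o u)) ->
  (forall m (u : raw E), scube B m u -> scube B' m (f \o u)) ->
  (forall m (u : raw E'), scube A' m u -> scube A m (g \o u)) ->
  (forall m (u : raw E'), scube B' m u -> scube B m (g \o u)) ->
  (forall x, A x -> g (f x) = x) ->
  acyclic k A' B' -> acyclic k A B.
Proof.
move=> fA fB gA gB gf H F nF FB dF.
pose F' (u : raw E') := F (g \o u).
have nF' : nrm k F'.
  by move=> u k0 vu; apply: nF => // a b ab /=; rewrite (vu _ _ ab).
have F'B u : scube B' k u -> F' u = 0 by move=> Bu; apply/FB/gB.
have dF' u : scube A' k.+1 u -> cob k F' u = 0.
  by move=> Au; rewrite -[LHS]/(cob k F (g \o u)); apply/dF/gA.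
have {}H := H F' nF' F'B dF'.
have E1 m (u : raw E) : scube A m u -> g \o (f \o u) = u.
  by move=> [_ _ Au]; apply/funext => a /=; rewrite gf.
case: k nF FB dF nF' F'B dF' H => [|k] nF FB dF nF' F'B dF'.
  by move=> H u Au; rewrite -(E1 _ _ Au); apply/H/fA.
move=> [G [nG GB dG]]; exists (fun u => G (f \o u)); split.
- by move=> u k0 vu; apply: nG => // a b ab /=; rewrite (vu _ _ ab).
- by move=> u Bu; apply/GB/fB.
- by move=> u Au; rewrite -[LHS]/(cob k G (f \o u)) dG; [rewrite /F' (E1 _ _ Au)|exact: fA].
Qed.

End RelativeCohomology.

(** * Complements of coordinate subspaces and patching *)

Section SignedCoordinates.
Variables (R : realType) (M : zmodType) (E : topologicalType) (T : eqType).
Local Notation I := (itv01 R).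
Local Notation raw T := ((nat -> I) -> T).
Variables (x : T -> E -> R) (U P0 : seq T).
Hypothesis cx : forall t, continuous (x t).

Definition positive_locus (P : seq T) : set E := [set z | forall t, t \in P -> 0 < x t z].
Definition nonzero_locus (J : seq T) : set E := [set z | exists2 t, t \in J & x t z != 0].

Lemma open_gt0 t : open [set z | 0 < x t z].
Proof.
rewrite (_ : mkset _ = x t @^-1` [set y | 0 < y]) //.
by apply: open_comp; [move=> z _; exact: cx|exact: open_gt].
Qed.

Lemma open_lt0 t : open [set z | x t z < 0].
Proof.
rewrite (_ : mkset _ = x t @^-1` [set y | y < 0]) //.
by apply: open_comp; [move=> z _; exact: cx|exact: open_lt].
Qed.

Lemma open_positive_locus P : open (positive_locus P).
Proof.
elim: P => [|t P IH].
  have -> : positive_locus [::] = setT by apply/seteqP; split.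
  exact: openT.
rewrite (_ : positive_locus _ = [set z | 0 < x t z] `&` positive_locus P).
  exact: openI (@open_gt0 t) IH.
apply/seteqP; split=> [z Pz|z [tz Pz] s] /=.
  by split; [apply: Pz; rewrite mem_head|move=> s sP; apply: Pz; rewrite in_cons sP orbT].
by rewrite in_cons => /predU1P[->|/Pz].
Qed.

Lemma open_nonzero_locus J : open (nonzero_locus J).
Proof.
elim: J => [|t J IH].
  have -> : nonzero_locus [::] = set0 by apply/seteqP; split=> [z []|].
  exact: open0.
rewrite (_ : nonzero_locus _ =
  [set z | 0 < x t z] `|` [set z | x t z < 0] `|` nonzero_locus J).
  by apply: openU IH; exact: openU (@open_gt0 t) (@open_lt0 t).
apply/seteqP; split=> z /=.
  move=> [s]; rewrite in_cons => /predU1P[->|sJ] z0; last by right; exists s.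
  by left; case: (ltgtP (x t z) 0) z0; [right|left|].
move=> [[tz|tz]|[s sJ sz]].
- by exists t; rewrite ?mem_head // gt_eqF.
- by exists t; rewrite ?mem_head // lt_eqF.
- by exists s; rewrite // in_cons sJ orbT.
Qed.

(* The homotopy [H] moves [z] (at time 1) to [c] (at time 0) so that each
   coordinate travels on a segment from [x t z] to a multiple of [eps t]. *)
Definition straight (eps : T -> R) (H : I -> E -> E) (c : E) :=
  forall z, positive_locus P0 z -> forall s t, t \in U ->
    exists a b, [/\ 0 <= a, 0 <= b, x t (H s z) = a * x t z + b * eps t,
      if val s == 0 then a = 0 else 0 < a & val s < 1 -> 0 < b].

Hypothesis contraction : forall eps : T -> R,
  (forall t, t \in P0 -> 0 < eps t) -> (forall t, t \notin U -> eps t = 0) ->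
  exists H c, [/\ forall z, positive_locus P0 z -> H i1 z = z /\ H i0 z = c,
    forall m (u : raw E), scube (positive_locus P0) m u ->
      scube setT m.+1 (homotopy_cube H u) & straight eps H c].

(** This is the pair of a euclidean space and the complement of a subspace of codimension [size J].
    The subspace is cut out one coordinate [j] at a time: each passage to the half-space where [x j]
    is positive lowers the degree and the codimension by one. *)
Lemma acyclic_nonzero_locus J P k :
  uniq J -> {subset J <= U} -> {subset P <= U} -> {subset P0 <= P} ->
  {in J, forall t, t \notin P} -> odd k != odd (size J) ->
  @acyclic R M E k (positive_locus P) (positive_locus P `&` nonzero_locus J).
Proof.
elim: J P k => [|j J IH] P k uJ JU PU P0P JP kJ.
  have [t tP0|t tU|H [c [H10 cH sH]]] := contraction (eps := fun t => (t \in P)%:R).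
  - by rewrite P0P.
  - by case: (boolP (t \in P)) => // /PU; rewrite (negbTE tU).
  have PP0 : positive_locus P `<=` positive_locus P0 by move=> z Pz t /P0P; exact: Pz.
  rewrite (_ : _ `&` _ = set0); last by apply/seteqP; split=> [z [_ []]|].
  apply: (@acyclic_contractible _ _ _ _ _ _ H c).
  - by move=> z /PP0/H10[].
  - by move=> z /PP0/H10[].
  - move=> m u Pu; have [vu cu _] := cH m u (scubeS PP0 Pu); split=> // a t tP.
    have Pz : positive_locus P (u (shift a)) by case: Pu.
    have [b [d [b0 d0 -> bb dd]]] := sH _ (PP0 _ Pz) (a 0%N) _ (PU _ tP).
    rewrite tP mulr1; have := Pz t tP => xz.
    case: eqVneq bb => [s0 _|s0 bb].
      by rewrite ltr_wpDl ?mulr_ge0 ?(ltW xz) //; apply: dd; rewrite s0.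
    by rewrite ltr_wpDr // mulr_gt0.
  - by move=> m u [_ _ /(_ (fun=> i0))].
  - by right; case: k kJ.
move: uJ => /= /andP[jJ uJ].
have jU : j \in U by apply: JU; rewrite mem_head.
have jP : j \notin P by apply: JP; rewrite mem_head.
have JJ : {subset J <= j :: J} by move=> t tJ; rewrite in_cons tJ orbT.
(* The value -1 drives [x j] to the negative side, 1 keeps the coordinates of [P] positive, and 0
   merely rescales those of [J], so that a nonzero one stays nonzero until time 0. *)
have [t tP0|t tU|H [c [H10 cH sH]]] :=
  contraction (eps := fun t => if t == j then -1 else (t \in P)%:R).
- have tP := P0P t tP0; rewrite tP; case: eqVneq => // tj.
  by rewrite -tj tP in jP.
- case: eqVneq => [tj|_]; first by rewrite tj jU in tU.
  by case: (boolP (t \in P)) => // /PU; rewrite (negbTE tU).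
(* The nonzero locus of [j :: J] without the points that belong to it only through a positive [x j];
   the homotopy preserves this set and ends in it. *)
pose C := positive_locus P `&` (nonzero_locus J `|` [set z | x j z < 0]).
have PP0 : positive_locus P `<=` positive_locus P0 by move=> z Pz t /P0P; exact: Pz.
have HP z s : positive_locus P z -> positive_locus P (H s z).
  move=> Pz t tP.
  have [b [d [b0 d0 -> bb dd]]] := sH _ (PP0 _ Pz) s _ (PU _ tP).
  have tj : (t == j) = false by apply: contraNF jP => /eqP <-.
  rewrite tj tP mulr1; have := Pz t tP => xz.
  case: eqVneq bb => [s0 _|s0 bb].
    by rewrite ltr_wpDl ?mulr_ge0 ?(ltW xz) //; apply: dd; rewrite s0.
  by rewrite ltr_wpDr // mulr_gt0.
have HC z s : C z -> C (H s z).
  move=> [Pz Cz]; split; first exact: HP.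
  have [b [d [b0 d0 xjE bb dd]]] := sH _ (PP0 _ Pz) s _ jU.
  rewrite eqxx mulrN1 in xjE.
  case: eqVneq bb => [s0 bb|s0 bb].
    by right; rewrite /= xjE bb mul0r sub0r oppr_lt0; apply: dd; rewrite s0.
  case: Cz => [[t tJ xt]|xj]; last first.
    by right; rewrite /= xjE subr_lt0 (lt_le_trans _ d0) // pmulr_rlt0.
  left; exists t => //.
  have [b' [d' [_ _ -> bb' _]]] := sH _ (PP0 _ Pz) s _ (JU _ (JJ _ tJ)).
  rewrite (negbTE s0) in bb'.
  have -> : (t == j) = false by apply: contraNF jJ => /eqP <-.
  have -> : (t \in P) = false by apply/negbTE/JP/JJ.
  by rewrite mulr0 addr0 mulf_neq0 // gt_eqF.
have AC m : (exists z, positive_locus P z) -> @acyclic R M E m (positive_locus P) C.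
  move=> [z0 Pz0]; apply: (@acyclic_contractible _ _ _ _ _ _ H c).
  - by move=> z /PP0/H10[].
  - by move=> z /PP0/H10[].
  - move=> l u Pu; have [vu cu _] := cH l u (scubeS PP0 Pu); split=> // a.
    by apply: HP; case: Pu.
  - move=> l u Cu; have [vu cu _] := cH l u (scubeS (fun z (Cz : C z) => PP0 _ Cz.1) Cu).
    by split=> // a; apply: HC; case: Cu.
  - left; have [_ <-] := H10 _ (PP0 _ Pz0); split; first exact: HP.
    right; have [b [d [b0 d0 /= -> bb dd]]] := sH _ (PP0 _ Pz0) i0 _ jU.
    rewrite /= eqxx in bb dd; rewrite bb mul0r add0r eqxx mulrN1 oppr_lt0.
    exact: dd.
have [[z0 Pz0]|nP] := pselect (exists z, positive_locus P z); last first.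
  move=> F nF FB dF; have N m (u : raw E) : ~ scube (positive_locus P) m u.
    by move=> [_ _ Pu]; apply: nP; exists (u (fun=> i0)); exact: Pu.
  case: k kJ nF FB dF => [|k] kJ nF FB dF; first by move=> u /N.
  by exists (fun=> 0); split=> // u /N.
have {}AC m := AC m (ex_intro _ z0 Pz0).
have CB : C `<=` positive_locus P `&` nonzero_locus (j :: J).
  move=> z [Pz [[t tJ xt]|xj]]; split=> //; first by exists t => //; exact: JJ.
  by exists j; rewrite ?mem_head // lt_eqF.
case: k kJ => [|k] kJ.
  move=> F nF FB dF; apply: (AC 0%N F nF) => // u Cu.
  exact/FB/scubeS/Cu.
(* There remains the pair of [C] and its union with the open set where [x j] is positive. Excision
   replaces it by the pair for [J] inside that open set, one degree lower. *)
apply: (acyclic_triple CB (@subIsetl _ _ _) (AC _)).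
rewrite (_ : _ `&` nonzero_locus _ = C `|` positive_locus (j :: P)); last first.
  apply/seteqP; split=> z.
    move=> [Pz [t]]; rewrite in_cons => /predU1P[->|tJ] xt; last first.
      by left; split=> //; left; exists t.
    case: (ltgtP (x j z) 0) xt => // xj _; first by left; split=> //; right.
    by right => t'; rewrite in_cons => /predU1P[->//|/Pz].
  move=> [/CB//|Pz]; split.
    by move=> t tP; apply: Pz; rewrite in_cons tP orbT.
  by exists j; rewrite ?mem_head // gt_eqF // Pz // mem_head.
apply: excision.
- apply: openI; first exact: open_positive_locus.
  by apply: openU; [exact: open_nonzero_locus|exact: open_lt0].
- exact: open_positive_locus.
rewrite (_ : C `&` _ = positive_locus (j :: P) `&` nonzero_locus J); last first.
  apply/seteqP; split=> z.
    move=> [[Pz [Jz|/= xj]] jPz]; first by split.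
    by have := jPz j; rewrite mem_head ltNge (ltW xj) => /(_ isT).
  move=> [jPz Jz]; split=> //; split; last by left.
  by move=> t tP; apply: jPz; rewrite in_cons tP orbT.
apply: IH => //.
- by move=> t /JJ/JU.
- by move=> t; rewrite in_cons => /predU1P[->//|/PU].
- by move=> t /P0P tP; rewrite in_cons tP orbT.
- move=> t tJ; rewrite in_cons negb_or JP ?JJ // andbT.
  by apply: contraNneq jJ => <-.
- by move: kJ => /=; case: (odd k); case: (odd _).
Qed.

End SignedCoordinates.

(** * Patching primitives along an increasing union *)

Section Patching.
Variables (R : realType) (M : zmodType) (E : topologicalType) (O : nat -> set E).
Local Notation raw T := ((nat -> itv01 R) -> T).
Hypothesis oO : forall j, open (O j).

Definition stage (n : nat) : set E := [set z | exists2 i, (i < n)%N & O i z].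

Lemma stageS n : stage n.+1 = stage n `|` O n.
Proof.
apply/seteqP; split=> z.
  move=> [i + Oi]; rewrite ltnS leq_eqVlt => /predU1P[<-|iN]; first by right.
  by left; exists i.
by move=> [[i iN Oi]|On]; [exists i => //; exact: ltnW|exists n].
Qed.

Lemma open_stage n : open (stage n).
Proof.
elim: n => [|n IH]; last by rewrite stageS; exact: openU.
have -> : stage 0 = set0 by apply/seteqP; split=> [z []|].
exact: open0.
Qed.

Lemma stage_le m n : (m <= n)%N -> stage m `<=` stage n.
Proof. by move=> mn z [i im Oi]; exists i => //; exact: leq_trans mn. Qed.

Lemma scube_stage k (u : raw E) : scube (\bigcup_i O i) k u -> exists n, scube (stage n) k u.
Proof.
move=> [vu cu Ou].
have [N _ HN] : \forall n \near \oo, forall t : cube R k, stage n (u (seq_of t)).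
  apply: cube_near_cover => t; have [i _ Oi] := Ou (seq_of t).
  exists ((fun t => u (seq_of t)) @^-1` O i, [set n | (i < n)%N]).
    split; first exact: (cu t _ (open_nbhs_nbhs (conj (oO i) Oi))).
    by exists i.+1.
  by move=> [t' n] [/= Oi' iN]; exists i.
exists N; split=> // a; rewrite (_ : u a = u (seq_of (cube_of k a))).
  by apply: HN => /=.
by apply: vu => j jk; rewrite cube_ofK.
Qed.

(** A primitive on stage [n] is extended to the next stage by a correction that vanishes on all
    cubes of stage [n], which excision provides. The sequence of primitives is thus eventually
    constant on each cube, so no lim^1 term arises; by compactness every cube lies in some stage. *)
Lemma acyclic_bigcup k :
  (forall j, @acyclic R M E k.+1 (O j) (stage j `&` O j)) ->
  @acyclic R M E k.+1 (\bigcup_i O i) set0.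
Proof.
move=> H F nF _ dF.
have sO n : stage n `<=` \bigcup_i O i by move=> z [i _ Oi]; exists i.
pose ok n (G : raw E -> M) := nrm k G /\
  forall u, scube (stage n) k.+1 u -> cob k G u = F u.
have step n (G : {G | ok n G}) :
    {G' : {G' | ok n.+1 G'} | forall u, scube (stage n) k u -> sval G' u = sval G u}.
  apply: cid; case: G => G [nG dG] /=.
  pose G1 u := if `[< scube (stage n) k u >] then G u else 0.
  have dG1 u : scube (stage n) k.+1 u -> cob k G1 u = F u.
    move=> Bu; rewrite -dG //; apply: eq_cob => i e ik; rewrite /G1 asboolT //.
    exact: scube_ins.
  have nG1 : nrm k G1 by move=> u k0 vu; rewrite /G1; case: ifP => // _; exact: nG.
  have := @excision R M E _ _ (open_stage n) (oO n) k.+1 (H n); rewrite -stageS => Hn.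
  have [|||L [nL LB dL]] := Hn (F \- cob k G1).
  - by apply: nrmB => //; exact: nrm_cob.
  - by move=> u Bu /=; rewrite dG1 // subrr.
  - by move=> u Au; rewrite cobB cob_cob subr0 dF //; exact: scubeS Au.
  have okL : ok n.+1 (G1 \+ L).
    split; first exact: nrmD.
    by move=> u Au; rewrite cobD dL //= addrC subrK.
  exists (exist _ _ okL) => u su /=.
  by rewrite LB // addr0 /G1 asboolT.
have ok0 : ok 0%N (fun=> 0).
  by split=> // u [_ _ /(_ (fun=> i0))] [].
pose Gs := fix Gs n : {G | ok n G} :=
  if n is n'.+1 then sval (step n' (Gs n')) else exist _ _ ok0.
have GsS n u : scube (stage n) k u -> sval (Gs n.+1) u = sval (Gs n) u.
  by move=> su /=; case: (step n _) => G' /= ->.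
have Gs_le m n u : (m <= n)%N -> scube (stage m) k u -> sval (Gs n) u = sval (Gs m) u.
  move=> mn su; rewrite -(subnK mn); elim: (n - m)%N => [//|p IH].
  by rewrite addSn GsS //; apply: scubeS su; apply: stage_le; exact: leq_addl.
pose G u := if pselect (exists n, scube (stage n) k u) is left e
            then sval (Gs (sval (cid e))) u else 0.
have GE n u : scube (stage n) k u -> G u = sval (Gs n) u.
  move=> su; rewrite /G; case: pselect => [e|[]]; last by exists n.
  case: cid => m /= sm; case/orP: (leq_total m n) => mn.
    by rewrite (Gs_le _ _ _ mn).
  by rewrite (Gs_le _ _ _ mn).
exists G; split.
- move=> u k0 vu; rewrite /G; case: pselect => // e; case: cid => m /= _.
  by case: (Gs m) => G' [nG' _] /=; exact: nG'.
- by move=> u [_ _ /(_ (fun=> i0))].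
- move=> u /scube_stage[n su].
  case E1 : (Gs n) => [Gn [nGn dGn]]; rewrite -dGn //; apply: eq_cob => i e ik.
  by rewrite (GE n) ?E1 //; exact: scube_ins.
Qed.

End Patching.

(** * Complex phases, the torus and orbit spaces *)

Local Open Scope complex_scope.
Local Open Scope quotient_scope.

Section ComplexContinuity.
Variable R : realType.
Local Notation C := (cplx R).

Definition nsq (x : C) : R := complex.Re x ^+ 2 + complex.Im x ^+ 2.

Lemma nsqE (x : C) : (nsq x)%:C = `|x| ^+ 2 :> C.
Proof. exact: add_Re2_Im2. Qed.

Lemma nsq_ge0 x : 0 <= nsq x.
Proof. by rewrite addr_ge0 // sqr_ge0. Qed.

Lemma nsq_eq0 x : (nsq x == 0) = (x == 0).
Proof.
by rewrite -(inj_eq (@complexI R)) nsqE expf_eq0 /= normr_eq0.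
Qed.

Lemma normE (x : C) : `|x| = (Num.sqrt (nsq x))%:C.
Proof. exact: normc_def. Qed.

Section Compositions.
Variable X : topologicalType.

Lemma contRe (f : X -> C) : continuous f -> continuous (fun x => complex.Re (f x) : R).
Proof.
move=> fc x; apply/cvgrPdist_lt => e e0.
have e0' : 0 < e%:C :> C by rewrite ltcR.
have /cvgrPdist_lt/(_ _ e0') := fc x.
apply: filterS => y xy; rewrite -ltcR; apply: le_lt_trans xy.
have -> : complex.Re (f x) - complex.Re (f y) = complex.Re (f x - f y).
  by case: (f x) => ? ?; case: (f y).
exact: normc_ge_Re.
Qed.

Lemma contIm (f : X -> C) : continuous f -> continuous (fun x => complex.Im (f x) : R).
Proof.
move=> fc x; apply/cvgrPdist_lt => e e0.
have e0' : 0 < e%:C :> C by rewrite ltcR.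
have /cvgrPdist_lt/(_ _ e0') := fc x.
apply: filterS => y xy; rewrite -ltcR; apply: le_lt_trans xy.
have -> : complex.Im (f x) - complex.Im (f y) = - complex.Re ((f x - f y) * 'i%C).
  by case: (f x) => a b; case: (f y) => c d; simpc.
rewrite normrN (le_trans (normc_ge_Re _)) // normrM.
by rewrite (_ : `|'i%C| = 1) ?mulr1 // normc_def /= expr0n expr1n add0r sqrtr1.
Qed.

Lemma contC (f : X -> R) : continuous f -> continuous (fun x => (f x)%:C : C).
Proof.
move=> fc x; apply/cvgrPdist_lt => -[e e'] e0.
have /andP[/eqP/= e'0 {}e0] : (e' == 0) && (0 < e) by move: e0; rewrite ltcE.
have /cvgrPdist_lt/(_ _ e0) := fc x.
apply: filterS => y xy; rewrite -rmorphB normc_def /= expr0n addr0 sqrtr_sqr e'0.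
by rewrite -[e +i* 0]/(e%:C) ltcR.
Qed.

Lemma contJ (f : X -> C) : continuous f -> continuous (fun x => (f x)^* : C)%R.
Proof.
move=> fc x; apply/cvgrPdist_lt => e e0.
have /cvgrPdist_lt/(_ _ e0) := fc x.
by apply: filterS => y xy; rewrite -rmorphB norm_conjC.
Qed.

Lemma contsqrt (f : X -> R) : continuous f -> continuous (fun x => Num.sqrt (f x) : R).
Proof. by move=> fc x; exact: (continuous_comp (fc x) (@sqrt_continuous _ _)). Qed.

End Compositions.
End ComplexContinuity.

Section UnitPhase.
Variable C : numClosedFieldType.

(** The value 1 at 0 makes [tor d] an element of the torus for every [d]. *)
Definition phase (x : C) : C := if x == 0 then 1 else x / `|x|.

Lemma norm_phase x : `|phase x| = 1.
Proof.
rewrite /phase; case: eqVneq => [_|x0]; first by rewrite normr1.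
by rewrite normrM normfV normr_id divff // normr_eq0.
Qed.

Lemma phase_eq0 x : phase x == 0 = false.
Proof. by rewrite -normr_eq0 norm_phase oner_eq0. Qed.

Lemma phaseM x y : x != 0 -> y != 0 -> phase (x * y) = phase x * phase y.
Proof.
move=> x0 y0; rewrite /phase mulf_eq0 (negbTE x0) (negbTE y0) /=.
by rewrite normrM invfM mulrACA.
Qed.

Lemma phase_id x : `|x| = 1 -> phase x = x.
Proof.
rewrite /phase; case: eqVneq => [->|_ ->]; last by rewrite divr1.
by rewrite normr0 => /eqP; rewrite eq_sym oner_eq0.
Qed.

Lemma phase_conjM x : x != 0 -> phase x^*%R * x = `|x|.
Proof.
move=> x0; rewrite /phase conjC_eq0 (negbTE x0) norm_conjC mulrAC [_^*%R * _]mulrC.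
by rewrite -normCK expr2 mulfK // normr_eq0.
Qed.

Lemma conj_norm1 (x : C) : `|x| = 1 -> x^*%R * x = 1.
Proof. by move=> x1; rewrite mulrC -normCK x1 expr1n. Qed.

End UnitPhase.

Section Phases.
Variables (R : realType) (n : nat).
Local Notation C := (cplx R).

Lemma tor_subproof (d : 'I_n -> C) : diag_mx (\row_i phase (d i)) \in torus R n.
Proof.
apply/mem_set; split; first exact: diag_mx_is_diag.
apply/unitarymxP; rewrite tr_diag_mx map_diag_mx mulmx_diag.
apply/matrixP => i j; rewrite !mxE; case: eqVneq => // _.
by rewrite !mulr1n -normCK norm_phase expr1n.
Qed.

Definition tor (d : 'I_n -> C) : torus R n :=
  exist _ (diag_mx (\row_i phase (d i))) (tor_subproof d).

Definition tent (D : torus R n) i : C := \val D i i.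

Lemma tent_tor d i : tent (tor d) i = phase (d i).
Proof. by rewrite /tent /= !mxE eqxx mulr1n. Qed.

Lemma tent_diag (D : torus R n) : \val D = diag_mx (\row_i tent D i).
Proof.
case: D => D /= HD; have [/diag_mxP[d Dd] _] := set_mem HD.
by apply/matrixP => i j; rewrite /tent /= Dd !mxE eqxx mulr1n.
Qed.

Lemma norm_tent D i : `|tent D i| = 1.
Proof.
have [dD uD] := set_valP D; have [d [Dd d1]] := diag_unitary_entry dD uD.
by rewrite /tent Dd !mxE eqxx mulr1n d1.
Qed.

Lemma tent_neq0 D i : tent D i != 0.
Proof. by rewrite -normr_eq0 norm_tent oner_eq0. Qed.

Lemma torP (D D' : torus R n) : (forall i, tent D i = tent D' i) -> D = D'.
Proof.
move=> DD; apply/val_inj; rewrite /= [LHS]tent_diag [RHS]tent_diag; congr diag_mx.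
by apply/rowP => i; rewrite !mxE DD.
Qed.

Lemma tentM D D' i : tent (torusM D D') i = tent D i * tent D' i.
Proof.
rewrite {1}/tent /= (tent_diag D) (tent_diag D') mulmx_diag !mxE eqxx mulr1n.
by [].
Qed.

Lemma tent1 i : tent (torus1 R n) i = 1.
Proof. by rewrite /tent /= !mxE eqxx. Qed.

Lemma torusVM (D : torus R n) : torusM (torusV D) D = torus1 R n.
Proof. by apply: val_inj => /=; rewrite mulVmx // unitarymx_unit // torus_unitary. Qed.

Definition ent (z : ET R n) (l : nat) (i : 'I_n) : C := (\val z) l i ord0.

Lemma ent_act D z l i : ent (ET_act D z) l i = tent D i * ent z l i.
Proof. by rewrite /ent /= tent_diag mul_diag_mx !mxE. Qed.

Lemma entP (z z' : ET R n) : (forall l i, ent z l i = ent z' l i) -> z = z'.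
Proof.
move=> zz; apply/val_inj/funext => l; apply/matrixP => i j.
by rewrite (ord1 j); exact: zz.
Qed.

Lemma continuous_ent l i : continuous (fun z : ET R n => ent z l i).
Proof.
move=> z; rewrite /ent.
exact: (continuous_comp (continuous_comp (@continuous_val _ (ET R n) z)
  (@proj_continuous _ (fun=> 'cV[C]_n : topologicalType) l (\val z)))
  (@continuous_mx_entry _ _ _ i ord0 ((\val z) l))).
Qed.

Lemma continuous_ETP (X : topologicalType) (f : X -> ET R n) :
  (forall l i, continuous (fun x => ent (f x) l i)) -> continuous f.
Proof.
move=> fc; apply: continuous_comp_initial; rewrite set_valE.
apply: continuous_ptwsP => l; apply: continuous_mxP => i j.
by rewrite (ord1 j); exact: fc.
Qed.

Lemma continuous_torusP (X : topologicalType) (f : X -> torus R n) :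
  (forall i, continuous (fun x => tent (f x) i)) -> continuous f.
Proof.
move=> fc; apply: continuous_comp_initial; apply: continuous_mxP => i j.
rewrite (_ : (fun x => _) = (fun x => if i == j then tent (f x) i else 0)).
  by case: eqVneq => _; [exact: fc|exact: cst_continuous].
apply/funext => x; transitivity (diag_mx (\row_i tent (f x) i) i j).
  by rewrite -tent_diag.
by rewrite !mxE; case: eqVneq.
Qed.

Lemma ent_sum1 z i : exists N, forall m, (N <= m)%N ->
  (forall l, (m <= l)%N -> ent z l i = 0) /\ \sum_(0 <= l < m) nsq (ent z l i) = 1.
Proof.
have [N [z0 z1]] := set_valP z; exists N => m Nm.
have zl l : (N <= l)%N -> ent z l i = 0 by move=> Nl; rewrite /ent z0 // mxE.
split=> [l ml|]; first by apply: zl; apply: leq_trans ml.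
rewrite (big_cat_nat (leq0n N) Nm) /=.
have -> : \sum_(N <= l < m) nsq (ent z l i) = 0.
  by rewrite big_nat big1 // => l /andP[Nl _]; apply/eqP; rewrite nsq_eq0 zl.
rewrite addr0.
apply: complexI; rewrite rmorph_sum -[RHS]/(1 : C) -(z1 i) big_mkord.
by apply: eq_bigr => l _; exact: nsqE.
Qed.

Lemma ent_neq0 z i : exists l, ent z l i != 0.
Proof.
have [N /(_ N (leqnn _)) [_ zN]] := ent_sum1 z i.
apply: contrapT => /forallNP H; have : (0 : R) = 1; last first.
  by move/eqP; rewrite eq_sym oner_eq0.
rewrite -zN big1 // => l _; apply/eqP; rewrite nsq_eq0.
by apply: contrapT => /negP /H.
Qed.

End Phases.

Section Orbits.
Variables (R : realType) (n : nat) (X : topologicalType) (a : torus_action R n X).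

Lemma orbitP x y : orbit a x = orbit a y <-> exists D, a D x = y.
Proof. by split=> [/eqmodP/asboolP|H] //; apply/eqmodP/asboolP. Qed.

Definition rep (y : orbit_space a) : X := repr (y : {eq_quot orbit_equiv a}).

Lemma orbitK y : orbit a (rep y) = y.
Proof. exact: reprK. Qed.

Lemma rep_orbit x : exists D, a D x = rep (orbit a x).
Proof. by apply/orbitP; rewrite orbitK. Qed.

Lemma open_orbit_space (U : set (orbit_space a)) : open (orbit a @^-1` U) -> open U.
Proof. by []. Qed.

Lemma continuous_orbit : continuous (orbit a).
Proof. exact: pi_continuous. Qed.

(** Maps out of an orbit space are defined through [repr], which is not continuous. On an invariant
    open set the quotient topology reduces their continuity to that of the composite with the
    projection. *)
Lemma continuous_orbit_at (Y : topologicalType) (f : orbit_space a -> Y) (U : set X) x :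
  open U -> (forall D x, U x -> U (a D x)) -> U x ->
  (forall x, U x -> {for x, continuous (f \o orbit a)}) ->
  {for orbit a x, continuous f}.
Proof.
move=> oU aU Ux fc A; rewrite nbhsE => -[W [oW Wx] WA].
pose V := [set y | U (rep y) /\ W (f y)].
have repU x' : U (rep (orbit a x')) <-> U x'.
  have [D DE] := rep_orbit x'; split=> [|Ux']; last by rewrite -DE; exact: aU.
  move=> Ur; have := aU (torusV D) _ Ur; rewrite -DE -actM.
  by rewrite torusVM act1.
have VE : orbit a @^-1` V = [set x' | U x' /\ W (f (orbit a x'))].
  by apply/seteqP; split=> x' [/repU].
apply: (@filterS _ _ _ V); first by move=> y [_ /WA].
apply: open_nbhs_nbhs; split; last by split; [exact/repU|].
apply: open_orbit_space; rewrite VE openE => x' [Ux' Wx'].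
have n1 : nbhs x' U by exact: (open_nbhs_nbhs (conj oU Ux')).
have n2 : nbhs x' ((f \o orbit a) @^-1` W).
  exact: (fc x' Ux' _ (open_nbhs_nbhs (conj oW Wx'))).
exact: filterI n1 n2.
Qed.

End Orbits.

(** * The classifying space of the torus *)

Local Open Scope complex_scope.
Local Open Scope quotient_scope.

Section LocalContinuity.
Variables (R : realType).
Local Notation C := (cplx R).
Local Notation raw T := ((nat -> itv01 R) -> T).

Lemma continuous_open_val (X Y : topologicalType) (U : set X) (g : X -> Y) :
  open U -> continuous (fun x : U => g (\val x)) ->
  forall x, U x -> {for x, continuous g}.
Proof.
move=> oU gc x Ux A gA.
have := gc (exist _ x (mem_set Ux)) A gA.
rewrite nbhsE => -[V [[W oW <-] Wx] VA].
apply: (@filterS _ _ _ (W `&` U)); last exact: open_nbhs_nbhs (conj (openI oW oU) (conj Wx Ux)).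
by move=> y [Wy Uy]; exact: VA (exist _ y (mem_set Uy)) Wy.
Qed.

Lemma cont_sum (K : numFieldType) (X : topologicalType) J (r : seq J) (f : J -> X -> K) :
  (forall j, continuous (f j)) -> continuous (fun x => \sum_(j <- r) f j x).
Proof.
move=> fc; elim: r => [|j r IH].
  rewrite (_ : (fun x => _) = (fun=> 0)); first exact: cont_cst.
  by apply/funext => x; rewrite big_nil.
rewrite (_ : (fun x => _) = (fun x => f j x + \sum_(j <- r) f j x)).
  by apply: contD; [exact: fc|exact: IH].
by apply/funext => x; rewrite big_cons.
Qed.

Lemma contV (K : numFieldType) (X : topologicalType) (f : X -> K) :
  (forall x, f x != 0) -> continuous f -> continuous (fun x => (f x)^-1).
Proof. by move=> f0 fc x; apply: cvgV; [exact: f0|exact: fc]. Qed.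

Lemma continuous_phase (X : topologicalType) (f : X -> C) :
  (forall x, f x != 0) -> continuous f -> continuous (fun x => phase (f x)).
Proof.
move=> f0 fc.
rewrite (_ : (fun x => _) = (fun x => f x * (`|f x|)^-1)).
  apply: contM; [exact: fc|apply: contV; first by move=> x; rewrite normr_eq0].
  by move=> x; apply: cvg_norm; exact: fc.
by apply/funext => x; rewrite /phase (negbTE (f0 x)).
Qed.

Lemma cont_nsq (X : topologicalType) (f : X -> C) :
  continuous f -> continuous (fun x => nsq (f x)).
Proof.
by move=> fc; apply: contD; (apply: contM; [|]); [exact: contRe|exact: contRe|exact: contIm|exact: contIm].
Qed.

Lemma scube_shift (E : topologicalType) (A : set E) m (u : raw E) :
  scube A m u -> scube A m.+1 (fun a => u (shift a)).
Proof.
move=> Au; have := scube_comp Au (@std_shift R m).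
rewrite (_ : u \o _ = fun a => u (shift a)) //; apply/funext => a /=.
by case: Au => vu _ _; apply: vu => j jm; rewrite /shift /trunc ltnS jm.
Qed.

Lemma homotopy_cube_scube (E : topologicalType) (A B : set E) m (u : raw E) H :
  scube A m u ->
  continuous (fun t : cube R m.+1 => H (seq_of t 0%N) (u (shift (seq_of t)))) ->
  (forall s x, A x -> B (H s x)) -> scube B m.+1 (homotopy_cube H u).
Proof.
move=> Au cH AB; have [vu _ Aux] := Au; split=> //; last by move=> a; apply: AB.
move=> a b ab; rewrite /homotopy_cube ab //; congr H.
by apply: vu => j jm; rewrite /shift ab.
Qed.

Lemma scube_map (E E' : topologicalType) (A : set E) (B : set E') (f : E -> E') m (u : raw E) :
  (forall x, A x -> {for x, continuous f}) -> (forall x, A x -> B (f x)) ->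
  scube A m u -> scube B m (f \o u).
Proof.
move=> fc AB [vu cu Au]; split; first by move=> a b ab /=; rewrite (vu _ _ ab).
  by move=> t; exact: (continuous_comp (cu t) (fc _ (Au _))).
by move=> a; exact: AB.
Qed.

End LocalContinuity.

(** * Affine charts of the product of infinite projective spaces *)

Section Charts.
Variables (R : realType) (n : nat) (k : 'I_n -> nat).
Local Notation C := (cplx R).
Local Notation raw T := ((nat -> itv01 R) -> T).

Definition chart : set (ET R n) := [set z | forall i, ent z (k i) i != 0].

Lemma open_chart : open chart.
Proof.
rewrite openE => z cz; rewrite /interior.
suff : \forall z' \near z, forall i, ent z' (k i) i != 0 by [].
apply: (@filter_forall _ _ (fun i z' => ent z' (k i) i != 0) _ (nbhs_filter z)) => i.
have o1 : open [set z' : ET R n | 0 < nsq (ent z' (k i) i)].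
  apply: (@open_comp _ _ (fun z' : ET R n => nsq (ent z' (k i) i)) [set y | 0 < y]).
    by move=> z' _; apply: cont_nsq; exact: continuous_ent.
  exact: open_gt.
have z1 : 0 < nsq (ent z (k i) i) by rewrite lt0r nsq_eq0 cz nsq_ge0.
apply: filterS (open_nbhs_nbhs (conj o1 z1)) => z' /=.
by rewrite lt0r nsq_eq0 => /andP[].
Qed.

Lemma chart_act D z : chart z -> chart (ET_act D z).
Proof. by move=> cz i; rewrite ent_act mulf_neq0 ?tent_neq0. Qed.

(** On the chart this picks the unique point of the orbit whose pivot entries are positive; being
    invariant, it induces a continuous section [sec] of the projection to [BT]. *)
Definition normalize (z : ET R n) : ET R n :=
  ET_act (tor (fun i => (ent z (k i) i)^*%R)) z.

Definition sec (y : BT R n) : ET R n := normalize (rep y).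

Lemma normalize_act D z : chart z -> normalize (ET_act D z) = normalize z.
Proof.
move=> cz; apply: entP => l i; rewrite !ent_act !tent_tor !ent_act rmorphM.
rewrite phaseM ?conjC_eq0 ?tent_neq0 //.
rewrite (@phase_id _ (tent D i)^*%R) ?norm_conjC ?norm_tent //.
by rewrite mulrACA conj_norm1 ?mul1r // norm_tent.
Qed.

Lemma sec_orbit z : chart z -> sec (orbit (ET_action R n) z) = normalize z.
Proof.
by move=> cz; rewrite /sec; have [D <-] := rep_orbit (ET_action R n) z; exact: normalize_act.
Qed.

Lemma orbit_ET_act D z : orbit (ET_action R n) (ET_act D z) = orbit (ET_action R n) z.
Proof.
by apply/esym; apply: (iffRL (orbitP (ET_action R n) z (ET_act D z))); exists D.
Qed.

Lemma orbit_normalize z : orbit (ET_action R n) (normalize z) = orbit (ET_action R n) z.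
Proof. exact: orbit_ET_act. Qed.

Lemma orbit_sec y : orbit (ET_action R n) (sec y) = y.
Proof. by rewrite orbit_normalize orbitK. Qed.

Lemma ent_normalize z i : chart z -> ent (normalize z) (k i) i = `|ent z (k i) i|.
Proof. by move=> cz; rewrite ent_act tent_tor phase_conjM. Qed.

Definition bchart : set (BT R n) := [set y | chart (rep y)].

Lemma bchart_orbit z : bchart (orbit (ET_action R n) z) <-> chart z.
Proof.
rewrite /bchart /=; have [D <-] := rep_orbit (ET_action R n) z.
split; last exact: chart_act.
by move=> /(@chart_act (torusV D)); rewrite -ET_actM torusVM ET_act1.
Qed.

Lemma open_bchart : open bchart.
Proof.
apply: open_orbit_space; rewrite (_ : _ @^-1` _ = chart); first exact: open_chart.
by apply/seteqP; split=> z /bchart_orbit.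
Qed.

Lemma continuous_normalize z : chart z -> {for z, continuous normalize}.
Proof.
move: z; apply: (continuous_open_val open_chart); apply: continuous_ETP => l i.
under [X in continuous X]eq_fun do rewrite ent_act tent_tor.
have ce l' i' : continuous (fun x : chart => ent (\val x) l' i').
  by move=> x; exact: (continuous_comp (@continuous_val _ chart x) (@continuous_ent _ _ l' i' _)).
apply: contM; last exact: ce.
apply: continuous_phase; last exact/contJ/ce.
by move=> x; rewrite conjC_eq0; exact: (set_valP x i).
Qed.

Lemma continuous_sec y : bchart y -> {for y, continuous sec}.
Proof.
move=> cy; have := @continuous_orbit_at R n _ (ET_action R n) _ sec chart (rep y)
  open_chart chart_act cy; rewrite orbitK; apply=> z cz A /= HA.
have n1 : nbhs z chart by exact: open_nbhs_nbhs (conj open_chart cz).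
have n2 : nbhs z (normalize @^-1` A).
  by apply: continuous_normalize => //; rewrite -sec_orbit.
apply: (@filterS _ _ (nbhs_filter z) _ _ _ (filterI n1 n2)) => z' [cz' Az'] /=.
by rewrite /= sec_orbit.
Qed.

Definition coordT : eqType := (nat * 'I_n * bool)%type.

Definition coord (t : coordT) (z : ET R n) : R :=
  if t.2 then complex.Re (ent z t.1.1 t.1.2) else complex.Im (ent z t.1.1 t.1.2).

Lemma continuous_coordT t : continuous (coord t).
Proof.
by rewrite /coord; case: t.2; [apply: contRe|apply: contIm]; exact: continuous_ent.
Qed.

Let K := (\max_i k i).+1.

(** Only the real part of a pivot entry will be required to be positive. Its imaginary part stays
    unconstrained, which enlarges the image of [sec] but still leaves a retraction. *)
Definition pivots : seq coordT := [seq (k i, i, true) | i <- enum 'I_n].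
Definition earlier : seq (nat * 'I_n) :=
  [seq q <- [seq (nat_of_ord p.1, p.2) | p <- enum {: 'I_K * 'I_n}] | (q.1 < k q.2)%N].
Definition earlier_coords : seq coordT :=
  [seq (q, true) | q <- earlier] ++ [seq (q, false) | q <- earlier].

Lemma k_lt i : (k i < K)%N.
Proof. by rewrite ltnS; exact: leq_bigmax. Qed.

Lemma mem_pivots l i b : ((l, i, b) \in pivots) = (l == k i) && b.
Proof.
apply/mapP/andP => [[j _ [-> -> ->]]|[/eqP-> ->]]; first by rewrite eqxx.
by exists i => //; rewrite mem_enum.
Qed.

Lemma mem_earlier l i : ((l, i) \in earlier) = (l < k i)%N.
Proof.
rewrite mem_filter; apply: andb_idr => /= lk; apply/mapP.
by exists (Ordinal (ltn_trans lk (k_lt i)), i); rewrite ?mem_enum.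
Qed.

Lemma mem_earlier_coords l i b : ((l, i, b) \in earlier_coords) = (l < k i)%N.
Proof.
rewrite -mem_earlier mem_cat; apply/orP/idP => [[]/mapP[q qe [-> _]]|] //.
by case: b => qe; [left|right]; apply/mapP; exists (l, i).
Qed.

Lemma uniq_earlier_coords : uniq earlier_coords.
Proof.
have inj (c : bool) : injective (fun q : nat * 'I_n => (q, c)) by move=> ? ? [].
have ue : uniq earlier.
  apply: filter_uniq; rewrite map_inj_uniq ?enum_uniq // => -[l i] [l' i'] /= [/ord_inj -> ->].
  by [].
rewrite cat_uniq (map_inj_uniq (inj true)) (map_inj_uniq (inj false)) ue andbT /=; apply/hasPn => q /mapP[q' _ ->].
by apply/mapP => -[].
Qed.

Section Contraction.
Variable eps : coordT -> R.
Hypothesis eps_pos : forall t, t \in pivots -> 0 < eps t.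
Hypothesis eps0 : forall t, t \notin pivots ++ earlier_coords -> eps t = 0.

Let c l i : C := eps (l, i, true) +i* eps (l, i, false).

Lemma c_ge l i : (K <= l)%N -> c l i = 0.
Proof.
move=> Kl; have kK := k_lt i.
have lk : (l == k i) = false by apply/eqP; lia.
have lk' : (l < k i)%N = false by apply/negP; lia.
by rewrite /c !eps0 // mem_cat mem_pivots mem_earlier_coords lk lk'.
Qed.

Let dot z i : R := \sum_(0 <= l < K) (complex.Re (ent z l i) * complex.Re (c l i) +
  complex.Im (ent z l i) * complex.Im (c l i)).
Let c2 i : R := \sum_(0 <= l < K) nsq (c l i).
(** The squared norm of [w] in factor [i], expanded using that [z] has norm 1. In this form only the
    entries of [z] below [K] occur, so continuity for the coordinatewise topology is evident. *)
Let nu2 (s : R) z i : R := s ^+ 2 + (1 - s) ^+ 2 * c2 i + 2 * s * (1 - s) * dot z i.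
Let w (s : R) z l i : C := s%:C * ent z l i + (1 - s)%:C * c l i.

Lemma w_Re s z l i : complex.Re (w s z l i) =
  s * complex.Re (ent z l i) + (1 - s) * complex.Re (c l i).
Proof. by rewrite /w; case: (ent z l i) => a b; case: (c l i) => e f /=; rewrite !mul0r !subr0. Qed.

Lemma w_Im s z l i : complex.Im (w s z l i) =
  s * complex.Im (ent z l i) + (1 - s) * complex.Im (c l i).
Proof. by rewrite /w; case: (ent z l i) => a b; case: (c l i) => e f /=; rewrite !mul0r !addr0. Qed.

Lemma w_sum s z i : exists N, forall m, (N <= m)%N ->
  (forall l, (m <= l)%N -> w s z l i = 0) /\ \sum_(0 <= l < m) nsq (w s z l i) = nu2 s z i.
Proof.
have [N zN] := ent_sum1 z i; exists (maxn N K) => m; rewrite geq_max => /andP[Nm Km].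
have [z0 z1] := zN m Nm; split.
  by move=> l ml; rewrite /w z0 // c_ge ?mulr0 ?addr0 //; exact: leq_trans ml.
have cut (f : nat -> R) : (forall l, (K <= l)%N -> f l = 0) ->
    \sum_(0 <= l < m) f l = \sum_(0 <= l < K) f l.
  move=> f0; rewrite (big_cat_nat (leq0n K) Km) /= -[RHS]addr0; congr (_ + _).
  by rewrite big_nat big1 // => l /andP[/f0].
have -> : nu2 s z i = s ^+ 2 * (\sum_(0 <= l < m) nsq (ent z l i)) +
    (1 - s) ^+ 2 * c2 i + 2 * s * (1 - s) * dot z i by rewrite z1 mulr1.
rewrite /c2 /dot -!cut; last 2 first.
- by move=> l Kl; rewrite c_ge //= !mulr0 addr0.
- by move=> l Kl; apply/eqP; rewrite nsq_eq0 c_ge.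
rewrite !mulr_sumr -!big_split /=; apply: eq_bigr => l _.
by rewrite /nsq w_Re w_Im /=; ring.
Qed.

Let Q := positive_locus coord pivots.

(** The pivot entries of [z] and of [c] both have positive real part, hence so has every point of
    the segment between them. *)
Lemma nu2_gt0 s z i : 0 <= s <= 1 -> Q z -> 0 < nu2 s z i.
Proof.
move=> /andP[s0 s1] Qz; have [N /(_ (maxn N K))] := w_sum s z i.
move=> /(_ (leq_maxl _ _)) [_ <-].
have kN : (k i < maxn N K)%N by rewrite (leq_trans (k_lt i)) // leq_maxr.
rewrite big_mkord (bigD1 (Ordinal kN)) //= ltr_wpDr //.
  by apply: sumr_ge0 => l _; exact: nsq_ge0.
rewrite lt0r nsq_ge0 nsq_eq0 andbT; apply/eqP => /(congr1 (@complex.Re R)).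
rewrite w_Re /= => /eqP; apply/negP; rewrite gt_eqF //.
have p : (k i, i, true) \in pivots by rewrite mem_pivots eqxx.
have := Qz _ p; rewrite /coord /= => zp; have := eps_pos p => ep.
case: (eqVneq s 0) => [->|s00]; first by rewrite mul0r add0r subr0 mul1r.
by rewrite ltr_wpDr ?mulr_gt0 ?mulr_ge0 ?subr_ge0 ?(ltW ep) // lt0r s00.
Qed.

Lemma contract_subproof (s : R) z : (forall i, 0 < nu2 s z i) ->
  (fun l => \col_i (w s z l i * ((Num.sqrt (nu2 s z i))^-1)%:C)) \in ET R n.
Proof.
move=> nu0; apply/mem_set.
have [N HN] : exists N, forall i, forall m, (N <= m)%N ->
  (forall l, (m <= l)%N -> w s z l i = 0) /\ \sum_(0 <= l < m) nsq (w s z l i) = nu2 s z i.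
  have /choice[N HN] := w_sum s z; exists (\max_i N i) => i m Nm; apply: HN.
  exact: leq_trans (leq_bigmax i) Nm.
exists N; split=> [l Nl|i].
  by apply/matrixP => i j; rewrite !mxE; have [-> //] := HN i N (leqnn _); rewrite mul0r.
have [_ HS] := HN i N (leqnn _).
under eq_bigr do rewrite mxE normrM exprMn -nsqE.
rewrite -mulr_suml -[X in X * _]rmorph_sum -(big_mkord xpredT (fun l => nsq (w s z l i))) HS.
rewrite -nsqE /nsq /= expr0n addr0 exprVn sqr_sqrtr ?(ltW (nu0 i)) //.
by rewrite -rmorphM divff ?gt_eqF.
Qed.

Definition contract (s : itv01 R) (z : ET R n) : ET R n :=
  if pselect (forall i, 0 < nu2 (val s) z i) is left e
  then exist _ (fun l => \col_i (w (val s) z l i *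
    ((Num.sqrt (nu2 (val s) z i))^-1)%:C)) (contract_subproof e) else z.

Lemma ent_contract s z l i : Q z -> ent (contract s z) l i =
  w (val s) z l i * ((Num.sqrt (nu2 (val s) z i))^-1)%:C.
Proof.
move=> Qz; rewrite /contract; case: pselect => [e|[]].
  by rewrite /ent /= mxE.
by move=> i'; apply: nu2_gt0 => //; exact: (valP s).
Qed.

Lemma pivot_point_subproof : (fun l => \col_(i < n) (l == k i)%:R) \in ET R n.
Proof.
apply/mem_set; exists K; split=> [l Kl|i].
  by apply/matrixP => i j; rewrite !mxE; have := k_lt i; case: eqVneq => //; lia.
rewrite (bigD1 (Ordinal (k_lt i))) //= mxE eqxx normr1 expr1n big1 ?addr0 // => l.
by rewrite -val_eqE /= mxE => /negbTE ->; rewrite normr0 expr0n.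
Qed.

Definition pivot_point : ET R n := 
  exist _ (fun l => \col_(i < n) (l == k i)%:R) pivot_point_subproof.

Lemma Q_pivot_point : Q pivot_point.
Proof.
move=> [[l i] b]; rewrite mem_pivots => /andP[/eqP-> ->].
by rewrite /coord /ent /= mxE eqxx ltr01.
Qed.

Lemma contraction : exists H p, [/\
  forall z, Q z -> H i1 z = z /\ H i0 z = p,
  forall m (u : raw (ET R n)), scube Q m u -> scube setT m.+1 (homotopy_cube H u) &
  straight coord (pivots ++ earlier_coords) pivots eps H p].
Proof.
(* The homotopy follows the segment to [c], projected back to the unit spheres. At time 0 the
   starting point no longer matters, so any point of the locus, here [pivot_point], serves to name
   the end point. *)
exists contract, (contract i0 pivot_point); split.
- move=> z Qz; split; apply: entP => l i; rewrite !ent_contract //=.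
  + rewrite /nu2 /w subrr expr0n !mulr0 !mul0r expr1n !addr0 mul1r.
    by rewrite sqrtr1 invr1 mulr1.
  + by rewrite /nu2 /w /= mulr0 !mul0r.
  + exact: Q_pivot_point.
- move=> m u Qu; apply: (homotopy_cube_scube Qu) => //.
  have [_ cz Qz] := scube_shift Qu.
  apply: continuous_ETP => l i.
  under [X in continuous X]eq_fun do rewrite ent_contract //.
  have ce l' : continuous (fun t : cube R m.+1 => ent (u (shift (seq_of t))) l' i).
    move=> t; exact: (continuous_comp (cz t) (@continuous_ent _ _ l' i _)).
  have cs : continuous (fun t : cube R m.+1 => val (seq_of t 0%N) : R) by exact: continuous_coord.
  have cs1 : continuous (fun t : cube R m.+1 => 1 - val (seq_of t 0%N) : R).
    by apply: contB => //; exact: cont_cst.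
  apply: contM.
    apply: contD; apply: contM; [exact: contC|exact: ce|exact: contC|exact: cont_cst].
  apply/contC/contV.
    by move=> t; rewrite gt_eqF // sqrtr_gt0 nu2_gt0 //; exact: (valP (seq_of t 0%N)).
  apply: contsqrt; rewrite /nu2; apply: contD.
    apply: contD; first exact: contM.
    by apply: contM; [exact: contM|exact: cont_cst].
  apply: contM; first by apply: contM => //; apply: contM => //; exact: cont_cst.
  rewrite /dot; apply: cont_sum => l'.
  apply: (contD (contM (contRe (ce l')) (@cont_cst _ _ _)) (contM (contIm (ce l')) (@cont_cst _ _ _))).
- move=> z Qz s [[l i] b] tU.
  have s01 := valP s; have nu0 := nu2_gt0 i s01 Qz; move: s01 => /andP[s0 s1].
  have v0 : 0 < (Num.sqrt (nu2 (val s) z i))^-1 by rewrite invr_gt0 sqrtr_gt0.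
  exists (val s * (Num.sqrt (nu2 (val s) z i))^-1), ((1 - val s) * (Num.sqrt (nu2 (val s) z i))^-1).
  split.
  + by rewrite mulr_ge0 // ltW.
  + by rewrite mulr_ge0 ?subr_ge0 // ltW.
  + rewrite /coord /= ent_contract //; have HRe (x : C) (r : R) : complex.Re (x * r%:C) = complex.Re x * r.
      by case: x => ? ? /=; rewrite mulr0 subr0.
    have HIm (x : C) (r : R) : complex.Im (x * r%:C) = complex.Im x * r.
      by case: x => ? ? /=; rewrite mulr0 add0r.
    by case: b {tU}; rewrite ?HRe ?HIm ?w_Re ?w_Im /=; ring.
  + case: eqVneq => [->|s00]; first by rewrite mul0r.
    by rewrite mulr_gt0 // lt0r s00.
  + by move=> s1'; rewrite mulr_gt0 // subr_gt0.
Qed.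

End Contraction.

Definition before_bchart : set (BT R n) :=
  bchart `&` [set y | exists i l, (l < k i)%N /\ ent (rep y) l i != 0].

(** Through [sec] and the orbit map the pair is a retract of a pair in [ET] described by signs and
    zeros of real coordinates. Those before the pivots come as real and imaginary parts, hence in
    even number. *)
Lemma acyclic_bchart (M : zmodType) d : odd d -> @acyclic R M _ d bchart before_bchart.
Proof.
move=> od.
pose A' := positive_locus coord pivots.
have A'chart : A' `<=` chart.
  move=> z Az i; have := Az (k i, i, true); rewrite mem_pivots eqxx => /(_ isT).
  by rewrite /coord /=; case: eqVneq => // ->; rewrite ltxx.
have fA y : bchart y -> A' (sec y).
  move=> cy [[l i] b]; rewrite mem_pivots => /andP[/eqP-> ->].
  rewrite /coord /= ent_normalize // normE /= sqrtr_gt0 lt0r nsq_ge0 nsq_eq0 andbT.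
  exact: cy.
have gA z : A' z -> bchart (orbit (ET_action R n) z) by move=> /A'chart/bchart_orbit.
have fB y : before_bchart y -> (A' `&` nonzero_locus coord earlier_coords) (sec y).
  move=> [cy [i [l [lk e0]]]]; split; first exact: fA.
  have [|re0] := eqVneq (complex.Re (ent (sec y) l i)) 0; last first.
    by exists (l, i, true); rewrite ?mem_earlier_coords.
  have [im0|im0] := eqVneq (complex.Im (ent (sec y) l i)) 0; last first.
    by exists (l, i, false); rewrite ?mem_earlier_coords.
  move=> re0; have : ent (sec y) l i = 0.
    by move: re0 im0; case: (ent _ _ _) => a b /= -> ->.
  by move/eqP; rewrite ent_act tent_tor mulf_eq0 phase_eq0 (negbTE e0).
have gB z : (A' `&` nonzero_locus coord earlier_coords) z ->
    before_bchart (orbit (ET_action R n) z).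
  move=> [Az [[[l i] b] ]]; rewrite mem_earlier_coords => lk xz; split; first exact: gA.
  exists i, l; split=> //; have [D <-] := rep_orbit (ET_action R n) z.
  rewrite ent_act mulf_neq0 ?tent_neq0 //; apply: contraNneq xz => e0.
  by rewrite /coord /= e0; case: b.
have cg z : {for z, continuous (orbit (ET_action R n))} by exact: continuous_orbit.
apply: (@acyclic_retract R M _ _ d _ _ A' (A' `&` nonzero_locus coord earlier_coords)
   sec (orbit (ET_action R n))).
- by move=> m u; apply: scube_map fA => y; exact: continuous_sec.
- by move=> m u; apply: scube_map fB => y [cy _]; exact: continuous_sec.
- by move=> m u; apply: scube_map gA.
- by move=> m u; apply: scube_map gB.
- by move=> y _; exact: orbit_sec.
apply: (@acyclic_nonzero_locus R M _ _ coord (pivots ++ earlier_coords) pivots).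
- exact: continuous_coordT.
- by move=> eps; exact: contraction.
- exact: uniq_earlier_coords.
- by move=> t tJ; rewrite mem_cat tJ orbT.
- by move=> t tP; rewrite mem_cat tP.
- by [].
- move=> [[l i] b]; rewrite mem_earlier_coords mem_pivots => lk.
  by have -> : (l == k i) = false by apply/eqP; lia.
- by rewrite od size_cat !size_map addnn odd_double.
Qed.

End Charts.

(** * Numbering the charts compatibly with the componentwise order *)

Section PrimeCodes.

Fixpoint nth_prime (i : nat) : nat :=
  if i is i'.+1 then s2val (prime_above (nth_prime i')) else 2.

Lemma prime_nth_prime i : prime (nth_prime i).
Proof. by case: i => [//|i] /=; case: prime_above. Qed.

Lemma nth_prime_lt i : (nth_prime i < nth_prime i.+1)%N.
Proof. by rewrite /=; case: prime_above. Qed.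

Lemma nth_prime_inj : injective nth_prime.
Proof.
have H : {homo nth_prime : i j / (i < j)%N} by apply: homo_ltn nth_prime_lt; exact: ltn_trans.
by move=> i j e; case: (ltngtP i j) => // /H; rewrite e ltnn.
Qed.

(** Prime factorization turns componentwise comparison of pivot positions into divisibility, so a
    chart gets a larger number than all charts with smaller pivots, and the infinitely many charts
    can be added one after the other. *)
Definition code n (k : 'I_n -> nat) : nat := \prod_(i < n) nth_prime i ^ k i.

Lemma code_gt0 n (k : 'I_n -> nat) : (0 < code k)%N.
Proof. by apply: prodn_gt0 => i; rewrite expn_gt0 prime_gt0 // prime_nth_prime. Qed.

Lemma logn_code n (k : 'I_n -> nat) (j : 'I_n) : logn (nth_prime j) (code k) = k j.
Proof.
have H (r : seq 'I_n) : (0 < \prod_(i <- r) nth_prime i ^ k i)%N /\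
    logn (nth_prime j) (\prod_(i <- r) nth_prime i ^ k i) = \sum_(i <- r | i == j) k i.
  elim: r => [|i r [r0 IH]]; first by rewrite !big_nil logn1.
  have p0 : (0 < nth_prime i ^ k i)%N by rewrite expn_gt0 prime_gt0 // prime_nth_prime.
  rewrite !big_cons muln_gt0 p0 r0 lognM // IH lognX logn_prime ?prime_nth_prime //.
  have -> : (nth_prime j == nth_prime i) = (i == j).
    by rewrite (inj_eq nth_prime_inj) eq_sym.
  by case: eqVneq => _; rewrite ?muln1 ?muln0.
by rewrite /code; have [_ ->] := H (index_enum 'I_n); rewrite big_pred1_eq.
Qed.

Lemma code_dvd n (k k' : 'I_n -> nat) : (forall i, k i <= k' i)%N -> (code k %| code k')%N.
Proof.
move=> kk; rewrite /code; apply: (big_ind2 (fun a b => a %| b)%N) => //.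
  by move=> a b c d; exact: dvdn_mul.
by move=> i _; exact: dvdn_exp2l.
Qed.

End PrimeCodes.

Section ClassifyingSpace.
Variables (R : realType) (n : nat) (M : zmodType).

Let dec (j : nat) : 'I_n -> nat := fun i => logn (nth_prime i) j.
(** Numbers that are not codes contribute an empty set, so the patching lemma can run over all
    naturals. *)
Let O (j : nat) : set (BT R n) := if j == code (dec j) then bchart (dec j) else set0.

Lemma dec_code k : dec (code k) = k.
Proof. by apply/funext => i; exact: logn_code. Qed.

Lemma acyclic_BT d : odd d -> @acyclic R M (BT R n) d setT set0.
Proof.
case: d => // d od.
have OU : \bigcup_j O j = setT.
  apply/seteqP; split=> // y _; have /choice[k ky] := ent_neq0 (rep y).
  by exists (code k) => //; rewrite /O dec_code eqxx => i; exact: ky.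
rewrite -OU; apply: acyclic_bigcup => j.
  by rewrite /O; case: eqVneq => _; [exact: open_bchart|exact: open0].
rewrite {1 3}/O; case: eqVneq => [jE|_]; last first.
  move=> F nF FB dF; exists (fun=> 0); split=> // u.
  by move=> [_ _ /(_ (fun=> i0))].
rewrite (_ : _ `&` _ = before_bchart (dec j)); first exact: acyclic_bchart.
apply/seteqP; split=> y.
  move=> [[i ij]]; rewrite /O; case: eqVneq => // iE cyi cyj; split=> //.
  (* If all entries before the pivots of [dec j] vanished, the pivots of [dec i] would be at least
     as large, so [j] would divide [i]. *)
  apply: contrapT => /forallNP H; move: ij; rewrite ltnNge => /negP; apply.
  rewrite jE iE; apply: dvdn_leq; first exact: code_gt0.
  apply: code_dvd => l; rewrite leqNgt; apply/negP => kl.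
  by apply: (H l); exists (dec i l); split=> //; exact: cyi.
move=> [cy [i [l [li e0]]]]; split=> //.
(* Lowering the single pivot [i] to [l] gives a chart that contains [y] and whose code is a proper
   divisor of [j]. *)
pose k' i' := if i' == i then l else dec j i'.
have kk i' : (k' i' <= dec j i')%N by rewrite /k'; case: eqVneq => // ->; exact: ltnW.
exists (code k').
  rewrite [X in (_ < X)%N]jE ltn_neqAle dvdn_leq ?code_gt0 ?code_dvd // andbT.
  apply/eqP => /(congr1 (logn (nth_prime i))); rewrite !logn_code /k' eqxx => E.
  by move: li; rewrite E ltnn.
rewrite /O dec_code eqxx => i'; rewrite /k'; case: (eqVneq i' i) => [->//|_]; exact: cy.
Qed.

End ClassifyingSpace.

(** * Triangular decompositions and the Bruhat order *)

Section Triangular.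
Variables (F : fieldType) (n : nat).
Implicit Types (f : 'I_n -> nat) (M u v b : 'M[F]_n).

(** One notion covers lower and upper triangular matrices and also the orders induced by
    permutations, which express the support condition of a Bruhat cell. *)
Definition tri f M := forall i j, (f i < f j)%N -> M i j = 0.

Lemma tri_mul f M M' : tri f M -> tri f M' -> tri f (M *m M').
Proof.
move=> tM tM' i j ij; rewrite mxE big1 // => k _.
by case: (ltnP (f i) (f k)) => ik; [rewrite tM // mul0r|rewrite tM' ?mulr0 //; exact: leq_ltn_trans ij].
Qed.

Lemma tri_diag f (d : 'rV[F]_n) : tri f (diag_mx d).
Proof. by move=> i j ij; rewrite !mxE; case: eqVneq ij => // ->; rewrite ltnn. Qed.

Lemma tri_mul_diag f M M' i : injective f -> tri f M -> tri f M' ->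
  (M *m M') i i = M i i * M' i i.
Proof.
move=> fi tM tM'; rewrite mxE (bigD1 i) //= big1 ?addr0 // => k ki.
have : f k != f i by rewrite (inj_eq fi).
by rewrite neq_ltn => /orP[ki'|ki']; [rewrite tM' ?mulr0|rewrite tM ?mul0r].
Qed.

Lemma det_neq0_perm M : M \in unitmx -> exists s : 'S_n, forall i, M i (s i) != 0.
Proof.
rewrite unitmxE unitfE => dM; apply: contrapT => /forallNP H.
move/eqP: dM; apply; rewrite /determinant big1 // => s _.
have /existsNP[i /negP] := H s; rewrite negbK => /eqP Mi.
by rewrite (bigD1 i) //= Mi mul0r mulr0.
Qed.

(** The sum of the values of [f] is unchanged by [s], so none of the inequalities is strict.
    Consequently the determinant of a triangular matrix has a single nonzero term, for any order. *)
Lemma perm_le_id f (s : 'S_n) : injective f -> (forall i, f (s i) <= f i)%N -> s = 1%g.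
Proof.
move=> fi fs; apply/permP => i; rewrite perm1; apply: fi.
have E : (\sum_j f (s j) = \sum_j f j)%N.
  by rewrite [RHS](reindex_inj (@perm_inj _ s)).
apply/eqP; rewrite eqn_leq fs /= leqNgt; apply/negP => fi'.
have : (\sum_j f (s j) < \sum_j f j)%N.
  rewrite (bigD1 i) //= [X in (_ < X)%N](bigD1 i) //= -addSn leq_add //.
  by apply: leq_sum => j _.
by rewrite E ltnn.
Qed.

Lemma tri_unit_diag f M i : injective f -> tri f M -> M \in unitmx -> M i i != 0.
Proof.
move=> fi tM /det_neq0_perm[s Ms].
suff s1 : s = 1%g by have := Ms i; rewrite s1 perm1.
apply: (perm_le_id fi) => j; rewrite leqNgt; apply/negP => /tM Mj.
by have := Ms j; rewrite Mj eqxx.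
Qed.

Lemma tri_unit f M : injective f -> tri f M -> (forall i, M i i != 0) -> M \in unitmx.
Proof.
move=> fi tM Mi; rewrite unitmxE unitfE /determinant (bigD1 1%g) //=.
have -> : \sum_(s : {perm 'I_n} | s != 1%g) (-1) ^+ s * \prod_(i < n) M i (s i) = 0.
  apply: big1 => s /eqP s1; have [->|/prodf_neq0 H] := eqVneq (\prod_i M i (s i)) 0.
    by rewrite mulr0.
  case: s1; apply: (perm_le_id fi) => j.
  by rewrite leqNgt; apply/negP => /tM Mj; have := H j isT; rewrite Mj eqxx.
rewrite addr0 odd_perm1 expr0 mul1r.
by apply/prodf_neq0 => i _; rewrite perm1; exact: Mi.
Qed.

Lemma tri_inv f M : injective f -> tri f M -> M \in unitmx -> tri f (invmx M).
Proof.
move=> fi tM uM i; have [m] := ubnP (f i); elim: m i => // m IH i im j ij.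
have : (M *m invmx M) i j = 0.
  by rewrite mulmxV // mxE; case: eqVneq ij => // ->; rewrite ltnn.
rewrite mxE (bigD1 i) //= big1 ?addr0 => [/eqP|k ki].
  by rewrite mulf_eq0 (negbTE (tri_unit_diag i fi tM uM)) => /eqP.
have : f k != f i by rewrite (inj_eq fi).
rewrite neq_ltn => /orP[fki|fki]; last by rewrite tM ?mul0r.
rewrite IH ?mulr0 //; first exact: leq_trans fki _.
exact: ltn_trans fki ij.
Qed.

Definition lower M := tri (fun i => i) M.
Definition upper M := tri (fun i => n - i)%N M.
Definition unipotent M := lower M /\ forall i, M i i = 1.

Lemma low_inj : injective (fun i : 'I_n => nat_of_ord i).
Proof. exact: ord_inj. Qed.

Lemma up_inj : injective (fun i : 'I_n => n - i)%N.
Proof. by move=> i j e; apply: ord_inj; have := ltn_ord i; have := ltn_ord j; lia. Qed.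

Lemma upperP M : upper M <-> forall i j : 'I_n, (j < i)%N -> M i j = 0.
Proof.
split=> H i j ij; apply: H; first by have := ltn_ord i; lia.
by move: ij; have := ltn_ord i; have := ltn_ord j; lia.
Qed.

Lemma unipotent_unit M : unipotent M -> M \in unitmx.
Proof. by move=> [lM M1]; apply: (tri_unit low_inj lM) => i; rewrite M1 oner_eq0. Qed.

Lemma unipotent_inv M : unipotent M -> unipotent (invmx M).
Proof.
move=> uM; have UM := unipotent_unit uM; have [lM M1] := uM.
have lV := tri_inv low_inj lM UM; split=> // i.
have := tri_mul_diag i low_inj lM lV; rewrite mulmxV // mxE eqxx M1 mul1r.
by move=> <-.
Qed.

Lemma lower_upper_diag M : lower M -> upper M -> M = diag_mx (\row_i M i i).
Proof.
move=> lM /upperP uM; apply/matrixP => i j; rewrite !mxE; case: eqVneq => [->//|ij].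
have : val i != val j by [].
by rewrite neq_ltn => /orP[?|?]; [rewrite lM|rewrite uM].
Qed.

Lemma unipotent_upper_uniq M v v' : M \in unitmx -> unipotent v -> unipotent v' ->
  upper (v *m M) -> upper (v' *m M) -> v = v'.
Proof.
move=> uM [lv v1] [lv' v'1] ub ub'.
have Uv := unipotent_unit (conj lv v1); have Uv' := unipotent_unit (conj lv' v'1).
have Ub : v *m M \in unitmx by rewrite unitmx_mul Uv.
have W : v' *m invmx v = v' *m M *m invmx (v *m M).
  by rewrite -[LHS]mulmx1 -(mulmxV Ub) !mulmxA mulmxKV.
have lW : lower (v' *m invmx v) by apply: tri_mul => //; exact: tri_inv low_inj lv Uv.
have uW : upper (v' *m invmx v) by rewrite W; apply: tri_mul => //; exact: tri_inv up_inj ub Ub.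
have W1 : v' *m invmx v = 1%:M.
  rewrite (lower_upper_diag lW uW) -diag_const_mx; congr diag_mx; apply/rowP => i.
  rewrite mxE [RHS]mxE (tri_mul_diag i low_inj lv') ?v'1 ?mul1r.
    by case: (unipotent_inv (conj lv v1)).
  exact: tri_inv low_inj lv Uv.
by rewrite -[RHS](mulmxKV Uv) W1 mul1mx.
Qed.

(** Padding with the identity keeps the size [n]; the determinant is the leading minor of size
    [k]. *)
Definition minor_mx (k : nat) M : 'M[F]_n :=
  \matrix_(i, l) if (i < k)%N && (l < k)%N then M i l else (i == l)%:R.

Lemma minor_mx_mul k M b : upper b -> minor_mx k (M *m b) = minor_mx k M *m minor_mx k b.
Proof.
move=> /upperP ub; apply/matrixP => i j; rewrite !mxE.
have ne (x y : 'I_n) : (x < k)%N -> (k <= y)%N -> (x == y) = false.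
  by move=> xk ky; apply/negP => /eqP xy; move: xk; rewrite xy ltnNge ky.
case: (ltnP i k) => ik /=; last first.
  rewrite (bigD1 i) //= !mxE ltnNge ik /= eqxx mul1r big1 ?addr0 // => l.
  by rewrite eq_sym !mxE ltnNge ik /= => /negbTE ->; rewrite mul0r.
case: (ltnP j k) => jk.
  apply: eq_bigr => l _; rewrite !mxE ik jk !andbT.
  case: (ltnP l k) => //= lk; rewrite (ub _ _ (leq_trans jk lk)).
  by rewrite (eq_sym l) (ne j l) // !mulr0.
rewrite big1 => [|l _]; first by rewrite (ne i j).
rewrite !mxE ik (ltnNge j) jk andbF /=; case: (ltnP l k) => lk /=.
  by rewrite (ne l j) // mulr0.
by rewrite (ne i l) // mul0r.
Qed.

Lemma tri_minor f k M : tri f M -> tri f (minor_mx k M).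
Proof.
move=> tM i j ij; rewrite mxE; case: ifP => _; first exact: tM.
by case: eqVneq ij => // ->; rewrite ltnn.
Qed.

Lemma tri_minor_unit f k M : injective f -> tri f M -> M \in unitmx -> minor_mx k M \in unitmx.
Proof.
move=> fi tM uM; apply: (tri_unit fi (@tri_minor f k M tM)) => i; rewrite mxE eqxx.
by case: ifP => _; [exact: (tri_unit_diag i fi tM uM)|exact: oner_neq0].
Qed.

Definition regular M := forall k : 'I_n, minor_mx k M \in unitmx.

(** Coefficients that express the first [i] entries of row [i] through the rows above it. This
    closed formula for the triangular factor is what makes it continuous in [M]. *)
Definition vrow M (i : 'I_n) : 'rV[F]_n :=
  (\row_l if (l < i)%N then M i l else 0) *m invmx (minor_mx i M).

Definition vmat M : 'M[F]_n :=
  \matrix_(i, l) if (l < i)%N then - vrow M i ord0 l else (i == l)%:R.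

Lemma vmat_unipotent M : unipotent (vmat M).
Proof.
split=> [i j ij|i]; rewrite mxE ?ltnn ?eqxx // ltnNge ltnW //=.
by case: eqVneq ij => // ->; rewrite ltnn.
Qed.

Lemma vmat_upper M : regular M -> upper (vmat M *m M).
Proof.
move=> rM; apply/upperP => i j ji.
have E : vrow M i *m minor_mx i M = \row_l (if (l < i)%N then M i l else 0).
  by rewrite /vrow mulmxKV.
have := congr1 (fun r : 'rV[F]_n => r ord0 j) E; rewrite /= !mxE ji => Ej.
transitivity (\sum_l ((if l == i then M i j else 0) - vrow M i ord0 l * minor_mx i M l j)).
  have ne (x y : 'I_n) : (x < y)%N -> (x == y) = false.
    by move=> xy; apply/negP => /eqP e; move: xy; rewrite e ltnn.
  apply: eq_bigr => l _; rewrite !mxE ji andbT.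
  case: (ltngtP l i) => [li|il|/ord_inj ->].
  - by rewrite (ne l i) // mulNr sub0r.
  - rewrite (eq_sym l) (ne i l) // (eq_sym l) (ne j l) ?(ltn_trans ji) //.
    by rewrite mul0r mulr0 subrr.
  - by rewrite (eq_sym i j) (ne j i) // eqxx mul1r mulr0 subr0.
rewrite sumrB -Ej -big_mkcond big_pred1_eq.
by apply/eqP; rewrite subr_eq0; apply/eqP; rewrite Ej.
Qed.

(** Leading blocks multiply when the right factor is upper triangular, so those of [M] are products
    of leading blocks of [invmx v] and of [v *m M], both invertible. *)
Lemma regular_vmat M v : M \in unitmx -> unipotent v -> upper (v *m M) ->
  regular M /\ vmat M = v.
Proof.
move=> uM uv ub; have rM : regular M.
  move=> k; rewrite -(mulKmx (unipotent_unit uv) M) minor_mx_mul // unitmx_mul.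
  have [lv _] := unipotent_inv uv.
  rewrite (tri_minor_unit k low_inj lv) /=; last by rewrite unitmx_inv unipotent_unit.
  by apply: (tri_minor_unit k up_inj ub); rewrite unitmx_mul unipotent_unit.
split=> //; apply: (unipotent_upper_uniq uM) => //; first exact: vmat_unipotent.
exact: vmat_upper.
Qed.

Lemma regular_scale M (d : 'rV[F]_n) : M \in unitmx -> (forall i, d ord0 i != 0) -> regular M ->
  regular (diag_mx d *m M) /\
  vmat (diag_mx d *m M) = diag_mx d *m vmat M *m invmx (diag_mx d).
Proof.
move=> uM d0 rM; have tD := @tri_diag _ d; set D := diag_mx d in tD *.
have Dii i : D i i = d ord0 i by rewrite !mxE eqxx.
have uD : D \in unitmx by apply: (tri_unit low_inj (tD _)) => i; rewrite Dii.
have lD := tD (fun i => i); have [lv v1] := vmat_unipotent M.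
have tV f : injective f -> tri f (invmx D) by move=> fi; exact: tri_inv.
apply: regular_vmat; first by rewrite unitmx_mul uD.
  split=> [|i]; first by apply: tri_mul (tV _ low_inj); exact: tri_mul.
  rewrite (tri_mul_diag i low_inj) //; last 2 first.
  - exact: tri_mul.
  - exact: (tV _ low_inj).
  rewrite (tri_mul_diag i low_inj) // v1 mulr1 -(tri_mul_diag i low_inj lD (tV _ low_inj)).
  by rewrite mulmxV // mxE eqxx.
rewrite !mulmxA mulmxKV // -mulmxA.
by apply: tri_mul (vmat_upper rM); exact: tD.
Qed.

End Triangular.

Section Bruhat.
Variable F : fieldType.

(** Gaussian elimination in which the pivot of a column is its lowest nonzero entry. The pivot row
    is then only ever added to rows above it, which is the support condition on [v]. *)
Lemma bruhat n (M : 'M[F]_n) : M \in unitmx -> exists (w : {perm 'I_n}) (v : 'M[F]_n),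
  [/\ unipotent v, (forall i j, (w j < w i)%N -> v i j = 0) & upper (v *m row_perm w M)].
Proof.
elim: n M => [|n IH] M uM.
  by exists 1%g, 1%:M; split; [split; case|case|case].
have [r0 Mr0] : exists r, M r ord0 != 0.
  apply: contrapT => /forallNP H; have := mulVmx uM.
  move=> /(congr1 (fun A : 'M[F]_(n.+1) => A ord0 ord0)); rewrite !mxE eqxx big1 => [/eqP|i _].
    by rewrite eq_sym oner_eq0.
  by have /negP := H i; rewrite negbK => /eqP ->; rewrite mulr0.
have [r Mr rmax] := @arg_maxnP _ r0 (fun r => M r ord0 != 0) (fun r => nat_of_ord r) Mr0.
have {}rmax (i : 'I_n.+1) : (r < i)%N -> M i ord0 = 0.
  by move=> ri; apply/eqP; apply: contraTT ri => /rmax; rewrite -leqNgt.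
pose c (i : 'I_n) := M (lift r i) ord0 / M r ord0.
(* The Schur complement of the pivot. *)
pose M' : 'M[F]_n := \matrix_(i, j) (M (lift r i) (lift ord0 j) - c i * M r (lift ord0 j)).
have uM' : M' \in unitmx.
  rewrite -row_free_unit; apply: inj_row_free => x xM'.
  pose y : 'rV[F]_n.+1 := \row_k (if unlift r k is Some i then x ord0 i
    else - \sum_i x ord0 i * c i).
  have yl i : y ord0 (lift r i) = x ord0 i by rewrite mxE liftK.
  have yr : y ord0 r = - \sum_i x ord0 i * c i by rewrite mxE unlift_none.
  have yM j : (y *m M) ord0 j = \sum_i x ord0 i * (M (lift r i) j - c i * M r j).
    rewrite mxE (bigD1_ord r) //= yr mulNr mulr_suml -sumrN -big_split /=.
    by apply: eq_bigr => i _; rewrite yl; ring.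
  have y0 : y = 0.
    rewrite -(mulmxK uM y) (_ : y *m M = 0) ?mul0mx //; apply/rowP => j; rewrite [RHS]mxE yM.
    have [j'|] := unliftP ord0 j => ->; last first.
      by rewrite big1 // => i _; rewrite /c mulfVK // subrr mulr0.
    transitivity ((x *m M') ord0 j'); last by rewrite xM' mxE.
    by rewrite [RHS]mxE; apply: eq_bigr => i _; rewrite [M' i j']mxE.
  by apply/rowP => i; rewrite -yl y0 !mxE.
have [w' [v' [[lv' v'1] pv' ub']]] := IH M' uM'.
pose w := lift_perm ord0 r w'.
(* Column 0 collects the multiples of the pivot row that were subtracted in forming [M']. *)
pose v : 'M[F]_n.+1 := \matrix_(i, j) (match unlift ord0 i, unlift ord0 j with
  | Some i', Some j' => v' i' j' | Some i', None => - \sum_l v' i' l * c (w' l)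
  | None, Some _ => 0 | None, None => 1 end).
have v00 : v ord0 ord0 = 1 by rewrite mxE unlift_none.
have v0l j : v ord0 (lift ord0 j) = 0 by rewrite mxE unlift_none liftK.
have vl0 i : v (lift ord0 i) ord0 = - \sum_l v' i l * c (w' l).
  by rewrite mxE unlift_none liftK.
have vll i j : v (lift ord0 i) (lift ord0 j) = v' i j by rewrite mxE !liftK.
have w0 : w ord0 = r by exact: lift_perm_id.
have wl i : w (lift ord0 i) = lift r (w' i) by exact: lift_perm_lift.
have lt_lift (a : 'I_n.+1) (i j : 'I_n) : (lift a i < lift a j)%N = (i < j)%N.
  by rewrite !ltnNge leq_bump2.
exists w, v; split.
- split=> [i j|i].
    case: (unliftP ord0 i) => [i'|] ->; case: (unliftP ord0 j) => [j'|] -> //.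
    by rewrite lt_lift vll => /lv'.
  by case: (unliftP ord0 i) => [i'|] ->; rewrite ?vll.
- move=> i j; case: (unliftP ord0 i) => [i'|] ->; case: (unliftP ord0 j) => [j'|] ->.
  + by rewrite !wl lt_lift vll => /pv'.
  + rewrite w0 wl vl0 => ri; rewrite big1 ?oppr0 // => l _.
    case: (ltnP (w' l) (w' i')) => li; first by rewrite pv' ?mul0r.
    rewrite /c rmax ?mul0r ?mulr0 //; apply: leq_trans ri _.
    by rewrite leq_bump2.
  + by rewrite v0l.
  + by rewrite ltnn.
- apply/upperP => i j; case: (unliftP ord0 i) => [i'|] -> // ij.
  have -> : (v *m row_perm w M) (lift ord0 i') j =
      \sum_l v' i' l * (M (lift r (w' l)) j - c (w' l) * M r j).
    rewrite mxE (bigD1_ord ord0) //= vl0 !mxE w0 mulNr mulr_suml -sumrN -big_split /=.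
    by apply: eq_bigr => l _; rewrite vll !mxE wl; ring.
  move: ij; case: (unliftP ord0 j) => [j'|] -> ij; last first.
    by rewrite big1 // => l _; rewrite /c mulfVK // subrr mulr0.
  rewrite lt_lift in ij; transitivity ((v' *m row_perm w' M') i' j').
    by rewrite [RHS]mxE; apply: eq_bigr => l _; rewrite 2!mxE.
  by have /upperP := ub'; apply.
Qed.

(** The sum of all partial sums of [w]. The comparison below is an inequality for each partial sum,
    so this single number decreases strictly unless the permutations agree. *)
Definition rank_sum n (w : {perm 'I_n}) : nat :=
  (\sum_(k < n.+1) \sum_(i < n | (i < k)%N) w i)%N.

(* A Bruhat cell only meets the big cells of smaller permutations: a nonzero
   leading minor of [row_perm v M] has a nonzero term in its expansion. *)
Lemma bruhat_order n (M : 'M[F]_n) (w w' : {perm 'I_n}) (v : 'M[F]_n) :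
  M \in unitmx -> unipotent v -> (forall i j, (w j < w i)%N -> v i j = 0) ->
  upper (v *m row_perm w M) -> regular (row_perm w' M) ->
  w = w' \/ (rank_sum w' < rank_sum w)%N.
Proof.
move=> uM uv pv ub rM'.
pose f (i : 'I_n) := (n - w i)%N.
have fi : injective f.
  move=> i j e; apply: (@perm_inj _ w); apply: ord_inj; move: e; rewrite /f.
  by have := ltn_ord (w i); have := ltn_ord (w j); lia.
have ff i j : (f i < f j)%N = (w j < w i)%N.
  by rewrite /f; have := ltn_ord (w i); have := ltn_ord (w j); lia.
have Uv := unipotent_unit uv.
pose u := invmx v; have tu : tri f u by apply: tri_inv => // i j; rewrite ff => /pv.
have urow (s : {perm 'I_n}) : row_perm s M \in unitmx by rewrite row_permE unitmx_mul unitmx_perm.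
have MW : row_perm w M = u *m (v *m row_perm w M) by rewrite mulKmx.
pose s := (w' * w^-1)%g.
have sw i : w (s i) = w' i by rewrite permM permKV.
have M'E : row_perm w' M = row_perm s u *m (v *m row_perm w M).
  transitivity (row_perm s (row_perm w M)).
    by apply/matrixP => i j; rewrite !mxE sw.
  rewrite {1}MW; apply/matrixP => i j; rewrite !mxE; apply: eq_bigr => l _.
  by rewrite !mxE.
pose S (x : {perm 'I_n}) (k : nat) := (\sum_(i < n | (i < k)%N) nat_of_ord (x i))%N.
have Sn x : (S x n = \sum_(i < n) nat_of_ord i)%N.
  rewrite [RHS](reindex_inj (@perm_inj _ x)).
  by apply: eq_bigl => i; rewrite ltn_ord.
have Sk (k : 'I_n) : (S w' k <= S w k)%N.
  have := rM' k; rewrite M'E minor_mx_mul // unitmx_mul => /andP[/det_neq0_perm[t tk] _].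
  (* A nonzero entry in the first [k] rows of the padded block lies in its first [k] columns, and
     triangularity of [u] turns its being nonzero into the inequality. *)
  have ti (i : 'I_n) : (i < k)%N -> (t i < k)%N /\ (w' i <= w (t i))%N.
    move=> ik; have := tk i; rewrite mxE ik /=; case: (ltnP (t i) k) => tik.
      split=> //; rewrite -sw leqNgt -ff; apply/negP => /tu uE.
      by move: (tk i); rewrite mxE ik tik /= mxE uE eqxx.
    case: (eqVneq i (t i)) => [it|_]; last by rewrite eqxx.
    by move: ik; rewrite it ltnNge tik.
  have ti' (i : 'I_n) : (t i < k)%N = (i < k)%N.
    case: (ltnP i k) => ik; first by case: (ti i ik).
    have := tk i; rewrite mxE ltnNge ik /=.
    by case: (eqVneq i (t i)) => [<- _|_]; [rewrite ltnNge ik|rewrite eqxx].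
  have -> : (S w k = \sum_(i < n | (i < k)%N) nat_of_ord (w (t i)))%N.
    by rewrite /S (reindex_inj (@perm_inj _ t)); apply: eq_bigl => i; exact: ti'.
  by apply: leq_sum => i /ti[].
have Sle (k : 'I_n.+1) : (S w' k <= S w k)%N.
  have [kn|] := ltnP k n; first exact: (Sk (Ordinal kn)).
  move=> nk; have -> : nat_of_ord k = n by apply/eqP; rewrite eqn_leq nk -ltnS ltn_ord.
  by rewrite !Sn.
have : (rank_sum w' <= rank_sum w)%N by apply: leq_sum => k _; exact: Sle.
rewrite leq_eqVlt.
case/orP => [/eqP E|]; last by right.
(* Equal totals force all partial sums to agree, and their consecutive differences are the values of
   the permutations. *)
left; have SE (k : 'I_n.+1) : S w' k = S w k.
  apply/eqP; rewrite eqn_leq Sle /= leqNgt; apply/negP => kl; move/eqP: E; apply/negP.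
  rewrite ltn_eqF // /rank_sum (bigD1 k) //= [X in (_ < X)%N](bigD1 k) //= -addSn leq_add //.
  by apply: leq_sum => j _; exact: Sle.
have SS x (i : 'I_n) : S x i.+1 = (x i + S x i)%N.
  rewrite /S (bigD1 i) ?ltnSn //=; congr addn; apply: eq_bigl => j.
  by rewrite ltnS ltn_neqAle andbC; congr andb; rewrite -val_eqE.
apply/permP => i; apply/ord_inj.
have := SE (lift ord0 i); rewrite lift0 !SS (SE (widen_ord (leqnSn n) i)) => /addIn.
by [].
Qed.

End Bruhat.

(** * Normal forms of hermitian matrices *)

Local Open Scope complex_scope.
Local Open Scope sesquilinear_scope.

Section EigenRows.
Variables (F : fieldType) (n : nat) (mu : 'I_n -> F).
Hypothesis mu_inj : injective mu.
Implicit Types (L u : 'M[F]_n).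

Definition diagmu : 'M[F]_n := diag_mx (\row_i mu i).

(* Row [i] of the inverse of [nmat L i] is the left eigenvector of [L] for
   [mu i] whose [i]-th entry is 1. *)
Definition nmat L (i : 'I_n) : 'M[F]_n :=
  \matrix_(k, l) if l == i then (k == i)%:R else L k l - (if k == l then mu i else 0).

Definition umat L : 'M[F]_n := \matrix_(i, j) invmx (nmat L i) i j.

Section Tri.
Variables (f : 'I_n -> nat) (L : 'M[F]_n).
Hypotheses (fi : injective f) (tL : tri f L) (Ld : forall i, L i i = mu i).

Lemma tri_nmat i : tri f (nmat L i).
Proof.
move=> k l kl; have ne : (k == l) = false by apply/negP => /eqP e; move: kl; rewrite e ltnn.
rewrite mxE; case: eqVneq => [<-|_]; first by rewrite ne.
by rewrite ne subr0 tL.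
Qed.

Lemma nmat_diag i k : nmat L i k k != 0.
Proof.
rewrite mxE; case: (eqVneq k i) => [_|ki]; first by rewrite oner_neq0.
by rewrite eqxx Ld subr_eq0 (inj_eq mu_inj).
Qed.

Lemma nmat_unit i : nmat L i \in unitmx.
Proof. by apply: (tri_unit fi (@tri_nmat i)) => k; exact: nmat_diag. Qed.

Lemma tri_umat : tri f (umat L).
Proof.
by move=> i j ij; rewrite mxE (tri_inv fi (@tri_nmat i) (nmat_unit i) ij).
Qed.

Lemma umat_diag i : umat L i i = 1.
Proof.
rewrite mxE; have tN := @tri_nmat i; have := tri_mul_diag i fi tN (tri_inv fi tN (nmat_unit i)).
by rewrite mulmxV ?nmat_unit // [LHS]mxE eqxx [nmat _ _ _ _]mxE !eqxx mul1r => <-.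
Qed.

End Tri.

Lemma nmat_mul L (x : 'rV[F]_n) i l : l != i ->
  (x *m nmat L i) ord0 l = (x *m L) ord0 l - mu i * x ord0 l.
Proof.
move=> li; rewrite !mxE (bigD1 l) //= [X in _ = X - _](bigD1 l) //=.
rewrite mxE (negbTE li) eqxx mulrBr [mu i * _]mulrC addrAC; congr (_ + _ - _).
by apply: eq_bigr => k kl; rewrite mxE (negbTE li) (negbTE kl) subr0.
Qed.

Lemma nmat_mul_eq L (x : 'rV[F]_n) i : (x *m nmat L i) ord0 i = x ord0 i.
Proof.
rewrite mxE (bigD1 i) //= mxE !eqxx mulr1 big1 ?addr0 // => k ki.
by rewrite mxE eqxx (negbTE ki) mulr0.
Qed.

Lemma umat_unipotent L : lower L -> (forall i, L i i = mu i) -> unipotent (umat L).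
Proof.
move=> lL Ld; split; first exact: (tri_umat (@low_inj n) lL Ld).
by move=> i; exact: (umat_diag (@low_inj n) lL Ld).
Qed.

Lemma umat_eigen L : lower L -> (forall i, L i i = mu i) ->
  umat L *m L = diagmu *m umat L.
Proof.
move=> lL Ld; have uN i := nmat_unit (@low_inj n) lL Ld i.
apply/matrixP => i j; rewrite mul_diag_mx [RHS]mxE [X in X * _]mxE.
pose x := row i (invmx (nmat L i)).
have xN : x *m nmat L i = delta_mx ord0 i by rewrite /x -row_mul mulVmx // row1.
have xE k : umat L i k = x ord0 k by rewrite mxE [RHS]mxE.
have -> : (umat L *m L) i j = (x *m L) ord0 j.
  by rewrite mxE [RHS]mxE; apply: eq_bigr => k _; rewrite xE.
rewrite xE; have [->|ji] := eqVneq j i; last first.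
  have := nmat_mul L x ji; rewrite xN [LHS]mxE (negbTE ji) andbF => /esym/eqP.
  by rewrite subr_eq0 => /eqP.
rewrite mxE (bigD1 i) //= Ld mulrC big1 ?addr0 // => k ki.
have : val k != val i by [].
rewrite neq_ltn => /orP[lt|lt]; first by rewrite lL ?mulr0.
by rewrite mxE (tri_inv (@low_inj n) (tri_nmat lL i) (uN i)) ?mul0r.
Qed.

Lemma umat_uniq L u : lower L -> (forall i, L i i = mu i) -> unipotent u ->
  u *m L = diagmu *m u -> u = umat L.
Proof.
move=> lL Ld [_ u1] uL; have uN i := nmat_unit (@low_inj n) lL Ld i.
apply/row_matrixP => i; pose x := row i u.
have xN : x *m nmat L i = delta_mx ord0 i.
  apply/rowP => l; rewrite [RHS]mxE eqxx /=.
  have [->|li] := eqVneq l i; first by rewrite nmat_mul_eq mxE u1.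
  rewrite nmat_mul // /x -row_mul uL mxE mul_diag_mx !mxE.
  by rewrite subrr.
rewrite -/x -(mulmxK (uN i) x) xN -rowE; apply/rowP => j.
by rewrite !mxE.
Qed.

End EigenRows.

Section ScaledEigen.
Variables (F : fieldType) (n : nat).
Implicit Types (M X : 'M[F]_n) (d lam : 'rV[F]_n).

Lemma invmx_diag d : (forall i, d ord0 i != 0) ->
  diag_mx d \in unitmx /\ invmx (diag_mx d) = diag_mx (\row_i (d ord0 i)^-1).
Proof.
move=> d0; set D := diag_mx d; have uD : D \in unitmx.
  by apply: (tri_unit (@low_inj n) (@tri_diag _ _ _ d)) => i; rewrite mxE eqxx mulr1n.
split=> //; apply: (can_inj (mulKmx uD)); rewrite mulmxV // mulmx_diag -diag_const_mx.
by congr diag_mx; apply/rowP => i; rewrite !mxE mulfV.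
Qed.

Lemma conj_diagE d X i j : (forall i, d ord0 i != 0) ->
  (diag_mx d *m X *m invmx (diag_mx d)) i j = d ord0 i * X i j / d ord0 j.
Proof.
by move=> /invmx_diag[_ ->]; rewrite mul_mx_diag mxE mul_diag_mx !mxE.
Qed.

(** When the rows of [M] are eigenvectors of [A], this is also the conjugate of [A] by the upper
    triangular [vmat M *m M] ([conj_vmat_eq]). The first form shows that it is lower triangular, the
    second that it respects the staircase. *)
Definition conj_vmat lam M := vmat M *m diag_mx lam *m invmx (vmat M).

Lemma conj_vmat_scale lam d M : M \in unitmx -> (forall i, d ord0 i != 0) -> regular M ->
  conj_vmat lam (diag_mx d *m M) = diag_mx d *m conj_vmat lam M *m invmx (diag_mx d).
Proof.
move=> uM d0 rM; have [uD DV] := invmx_diag d0.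
have [_] := regular_scale uM d0 rM; rewrite /conj_vmat => ->.
have uv : vmat M \in unitmx by exact/unipotent_unit/vmat_unipotent.
set D := diag_mx d in uD DV *; set v := vmat M in uv *; set L := diag_mx lam.
have -> : invmx (D *m v *m invmx D) = D *m invmx v *m invmx D.
  have uX : D *m v *m invmx D \in unitmx by rewrite !unitmx_mul unitmx_inv uD uv.
  apply: (can_inj (mulKmx uX)); rewrite mulmxV // !mulmxA.
  by rewrite mulmxKV // mulmxK // mulmxV.
have LD : invmx D *m L *m D = L.
  rewrite -mulmxA; apply: (can_inj (mulKmx uD)); rewrite mulKVmx //.
  by rewrite !mulmx_diag; congr diag_mx; apply/rowP => i; rewrite !mxE mulrC.
by rewrite -[in RHS]LD !mulmxA.
Qed.

Lemma lower_conj_vmat lam M : lower (conj_vmat lam M).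
Proof.
have uv := vmat_unipotent M; have [lv v1] := uv.
apply: tri_mul; last exact: tri_inv (@low_inj n) lv (unipotent_unit uv).
by apply: tri_mul => //; exact: tri_diag.
Qed.

Lemma conj_vmat_diag lam M i : conj_vmat lam M i i = lam ord0 i.
Proof.
have uv := vmat_unipotent M; have [lv v1] := uv; have [lV V1] := unipotent_inv uv.
rewrite (tri_mul_diag i (@low_inj n)) ?V1 ?mulr1 //; last by apply: tri_mul => //; exact: tri_diag.
rewrite (tri_mul_diag i (@low_inj n)) ?v1 ?mul1r //; last exact: tri_diag.
by rewrite mxE eqxx mulr1n.
Qed.

Lemma conj_vmat_eq lam M A : M \in unitmx -> M *m A = diag_mx lam *m M ->
  conj_vmat lam M = (vmat M *m M) *m A *m invmx (vmat M *m M) /\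
  invmx (vmat M) *m conj_vmat lam M = diag_mx lam *m invmx (vmat M).
Proof.
move=> uM MA; have uv : vmat M \in unitmx by exact/unipotent_unit/vmat_unipotent.
rewrite /conj_vmat; set v := vmat M in uv *; split; last by rewrite !mulmxA mulVmx // mul1mx.
have ub : v *m M \in unitmx by rewrite unitmx_mul uv.
apply: (can_inj (mulmxK ub)); rewrite mulmxKV // -[LHS]mulmxA mulKmx //.
by rewrite -!mulmxA MA.
Qed.

End ScaledEigen.

(** * Cholesky factorization of Gram matrices *)

Section Cholesky.
Variables (C : numClosedFieldType) (n : nat).
Implicit Types (H b M u v : 'M[C]_n).

Lemma adjM m p q (A : 'M[C]_(m, p)) (B : 'M[C]_(p, q)) : (A *m B)^t* = B^t* *m A^t*.
Proof. by rewrite trmx_mul map_mxM. Qed.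

Lemma adjE m p (A : 'M[C]_(m, p)) i j : A^t* i j = (A j i)^*%R.
Proof. by rewrite !mxE. Qed.

Lemma adj_unit M : M \in unitmx -> M^t* \in unitmx.
Proof. by rewrite map_unitmx unitmx_tr. Qed.

Lemma upper_adj M : lower M -> upper (M^t*).
Proof. by move=> lM; apply/upperP => i j ji; rewrite adjE lM // conjC0. Qed.

Lemma lower_adj M : upper M -> lower (M^t*).
Proof. by move=> /upperP uM i j ij; rewrite adjE uM // conjC0. Qed.

Lemma adj_self_row m (x : 'rV[C]_m) : x *m x^t* = 0 -> x = 0.
Proof.
move=> xx; apply/rowP => i; rewrite [RHS]mxE.
have : (x *m x^t*) ord0 ord0 = 0 by rewrite xx mxE.
rewrite mxE => /eqP; rewrite psumr_eq0 => [/allP/(_ i)|k _]; last first.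
  by rewrite adjE -normCK exprn_ge0.
rewrite mem_index_enum => /(_ isT); rewrite /= adjE -normCK expf_eq0 /= normr_eq0.
by move=> /eqP.
Qed.

(** A row vector killed by a leading block, extended by zeros, pairs to zero with itself under the
    Gram matrix; hence its product with [u^t*] has norm 0. *)
Lemma gram_regular u : u \in unitmx -> regular (u^t* *m u).
Proof.
move=> uu k; set H := _ *m u.
rewrite -row_free_unit; apply: inj_row_free => x xN.
have xl (l : 'I_n) : (k <= l)%N -> x ord0 l = 0.
  move=> kl; transitivity ((x *m minor_mx k H) ord0 l); last by rewrite xN mxE.
  rewrite mxE (bigD1 l) //= !mxE ltnNge kl /= eqxx mulr1 big1 ?addr0 // => j jl.
  by rewrite mxE (ltnNge l) kl andbF (negbTE jl) mulr0.
have xH (l : 'I_n) : (l < k)%N -> (x *m H) ord0 l = 0.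
  move=> lk; transitivity ((x *m minor_mx k H) ord0 l); last by rewrite xN mxE.
  rewrite !mxE; apply: eq_bigr => j _; case: (ltnP j k) => jk; last by rewrite xl // !mul0r.
  by rewrite [minor_mx _ _ _ _]mxE jk lk.
have : (x *m u^t*) *m (x *m u^t*)^t* = 0.
  rewrite adjM trmxCK mulmxA -[x *m _ *m u]mulmxA -/H; apply/matrixP => i j.
  rewrite !ord1 mxE [RHS]mxE big1 // => l _.
  by case: (ltnP l k) => lk; [rewrite xH // mul0r|rewrite adjE xl // conjC0 mulr0].
move=> /adj_self_row xu; rewrite -(mulmxK (adj_unit uu) x) xu mul0mx.
by [].
Qed.

Definition pivot H i : C := (vmat H *m H *m (vmat H)^t*) i i.

(** Gram-Schmidt: if [H] is the Gram matrix of [u], then [u *m chol H] is unitary. *)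
Definition chol H : 'M[C]_n :=
  (vmat H)^t* *m diag_mx (\row_i (sqrtC (pivot H i))^-1).

Lemma mulmx5 (A B X Y Z : 'M[C]_n) :
  A *m (B *m X *m Y) *m Z = A *m B *m X *m (Y *m Z).
Proof. by rewrite !mulmxA. Qed.

Section Gram.
Variable u : 'M[C]_n.
Hypothesis uu : u \in unitmx.
Let H := u^t* *m u.
Let v := vmat H.

Let Hadj : H^t* = H. Proof. by rewrite adjM trmxCK. Qed.
Let uH : H \in unitmx. Proof. by rewrite unitmx_mul adj_unit. Qed.

(** Both [v *m H] and [v^t*] are upper triangular, and a self-adjoint upper triangular matrix is
    diagonal. Its entries are squared norms of the rows of [v *m u^t*]. *)
Lemma gram_diag : v *m H *m v^t* = diag_mx (\row_i pivot H i) /\ forall i, 0 < pivot H i.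
Proof.
set W := v *m H *m v^t*.
have Wadj : W^t* = W by rewrite /W adjM [(v *m H)^t*]adjM trmxCK Hadj mulmxA.
have uW : upper W.
  apply: tri_mul; first exact: (vmat_upper (gram_regular uu)).
  by apply: upper_adj; case: (vmat_unipotent H).
have lW : lower W by rewrite -Wadj; exact: lower_adj.
have Wi i : W i i = \sum_k `|(v *m u^t*) i k| ^+ 2.
  rewrite (_ : W = (v *m u^t*) *m (v *m u^t*)^t*); last by rewrite adjM trmxCK /W !mulmxA.
  by rewrite mxE; apply: eq_bigr => k _; rewrite adjE -normCK.
have Wi0 i : 0 < W i i.
  rewrite lt0r Wi sumr_ge0 ?andbT => [|k _]; last by rewrite exprn_ge0.
  apply/negP; rewrite psumr_eq0 => [/allP all0|k _]; last by rewrite exprn_ge0.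
  have r0 : row i (v *m u^t*) = 0.
    apply/rowP => k; rewrite !mxE; have := all0 k; rewrite mem_index_enum => /(_ isT).
    by rewrite /= expf_eq0 /= normr_eq0 mxE => /eqP.
  have uvu : v *m u^t* \in unitmx.
    by rewrite unitmx_mul adj_unit // andbT; exact/unipotent_unit/vmat_unipotent.
  have := congr1 (fun r => r *m invmx (v *m u^t*)) r0.
  rewrite /= mul0mx -row_mul mulmxV // => /rowP/(_ i); rewrite !mxE eqxx => /eqP.
  by rewrite oner_eq0.
split; last exact: Wi0.
by rewrite (lower_upper_diag lW uW).
Qed.

Let sq_gt0 i : 0 < sqrtC (pivot H i).
Proof. by rewrite sqrtC_gt0; have [_] := gram_diag. Qed.

Let pv_inv i : (sqrtC (pivot H i))^-1 * pivot H i * (sqrtC (pivot H i))^-1 = 1.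
Proof.
by rewrite -{2}(sqrtCK (pivot H i)) expr2 mulrA mulVf ?mul1r ?divff // gt_eqF // sq_gt0.
Qed.

Lemma diag_adj (d : 'rV[C]_n) : (diag_mx d)^t* = diag_mx (\row_i (d ord0 i)^*%R).
Proof. by rewrite tr_diag_mx map_diag_mx; congr diag_mx; apply/rowP => i; rewrite !mxE. Qed.

Lemma chol_upper : upper (chol H).
Proof.
apply: tri_mul; last exact: tri_diag.
by apply: upper_adj; case: (vmat_unipotent H).
Qed.

Lemma chol_gram : (chol H)^t* *m H *m chol H = 1%:M.
Proof.
rewrite /chol -/v adjM trmxCK diag_adj; set d := diag_mx _; set d' := diag_mx _.
rewrite -mulmx5.
have [-> _] := gram_diag; rewrite !mulmx_diag -diag_const_mx; congr diag_mx.
apply/rowP => i; rewrite !mxE conj_Creal; last by rewrite rpredV gtr0_real // sq_gt0.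
by rewrite pv_inv.
Qed.

(** Divided by its diagonal, [b^t*] becomes a unipotent matrix that takes [H] to an upper triangular
    one, so it is [vmat H]; positivity then decides the sign of the square roots. *)
Lemma chol_uniq b : upper b -> (forall i, 0 < b i i) ->
  b^t* *m H *m b = 1%:M -> b = chol H.
Proof.
move=> ub b0 bHb.
have bn0 i : b i i != 0 by rewrite gt_eqF.
have br i : (b i i)^*%R = b i i by rewrite conj_Creal // gtr0_real.
have bu : b \in unitmx by apply: (tri_unit (@up_inj n) ub).
pose d : 'rV[C]_n := \row_i b i i.
have d0 i : d ord0 i != 0 by rewrite mxE.
have [uD DV] := invmx_diag d0; set D := diag_mx d in uD DV.
have Dadj : D^t* = D by rewrite diag_adj; congr diag_mx; apply/rowP => i; rewrite !mxE br.
have lb := lower_adj ub.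
have uv' : unipotent (invmx D *m b^t*).
  split; first by rewrite DV; apply: tri_mul lb; exact: tri_diag.
  move=> i; rewrite DV (tri_mul_diag i (@low_inj n)) //; last exact: tri_diag.
  by rewrite adjE br !mxE eqxx mulr1n mulVf.
have uv'H : upper (invmx D *m b^t* *m H).
  have -> : invmx D *m b^t* *m H = invmx D *m invmx b.
    by rewrite -mulmxA; congr mulmx; rewrite -[LHS](mulmxK bu) bHb mul1mx.
  by rewrite DV; apply: tri_mul; [exact: tri_diag|exact: tri_inv (@up_inj n) ub bu].
have [_ vE] := regular_vmat uH uv' uv'H.
have bE : b = v^t* *m D.
  apply: (can_inj (@trmxCK _ _ _)).
  by rewrite adjM trmxCK Dadj /v vE mulKVmx.
have [WE p0] := gram_diag.
have : D *m (v *m H *m v^t*) *m D = 1%:M.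
  by rewrite mulmx5 -[in RHS]bHb bE adjM trmxCK Dadj.
rewrite WE !mulmx_diag => E.
have cE i : b i i = (sqrtC (pivot H i))^-1.
  have := congr1 (fun A : 'M[C]_n => A i i) E; rewrite !mxE eqxx !mulr1n.
  move=> ci; have s0 := sq_gt0 i.
  have : (b i i * sqrtC (pivot H i)) ^+ 2 = 1 by rewrite exprMn sqrtCK expr2 mulrAC.
  move/eqP; rewrite sqrf_eq1 => /orP[/eqP cs|/eqP cs].
    by rewrite -[RHS]mul1r -cs mulfK // gt_eqF.
  have : 0 < b i i * sqrtC (pivot H i) by rewrite mulr_gt0.
  by rewrite cs ltr0N1.
by rewrite {1}bE /chol -/v; congr (_ *m diag_mx _); apply/rowP => i; rewrite !mxE cE.
Qed.

End Gram.
End Cholesky.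

Section Normalization.
Variables (C : numClosedFieldType) (n : nat) (lam : 'rV[C]_n).
Implicit Types (M L A : 'M[C]_n).

Definition uphase M i : C := phase ((vmat M *m M) i i).

(** Conjugation by these phases amounts to rescaling the eigenvectors until [vmat M *m M] has
    positive diagonal. This removes the dependence on the phases of the eigenvectors
    ([lnorm_scale]). *)
Definition lnorm M : 'M[C]_n :=
  \matrix_(i, j) ((uphase M i)^*%R * conj_vmat lam M i j * uphase M j).

(* With [u = umat L] lower unipotent and [b] upper triangular with positive
   diagonal and [u b] unitary, this is [b^-1 L b]; it inverts [lnorm], the
   lower triangular normal form of a hermitian matrix in an open Bruhat cell. *)
Definition build L : 'M[C]_n := let u := umat (fun i => lam ord0 i) L in
  let M := u *m chol (u^t* *m u) in M^t* *m diag_mx lam *m M.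

Lemma lnormE M i j : lnorm M i j =
  (uphase M i)^*%R * conj_vmat lam M i j * uphase M j.
Proof. by rewrite mxE. Qed.

Lemma lnorm_eq0 M i j : (lnorm M i j == 0) = (conj_vmat lam M i j == 0).
Proof. by rewrite mxE !mulf_eq0 conjC_eq0 !phase_eq0 orbF. Qed.

Lemma lnorm_lower M : lower (lnorm M).
Proof. by move=> i j ij; apply/eqP; rewrite lnorm_eq0 lower_conj_vmat. Qed.

Lemma lnorm_diag M i : lnorm M i i = lam ord0 i.
Proof.
by rewrite mxE conj_vmat_diag mulrAC conj_norm1 ?mul1r // norm_phase.
Qed.

Lemma uphase_scale M (d : 'rV[C]_n) i : M \in unitmx -> (forall i, d ord0 i != 0) ->
  regular M -> uphase (diag_mx d *m M) i = phase (d ord0 i * (vmat M *m M) i i).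
Proof.
move=> uM d0 rM; have [_ vD] := regular_scale uM d0 rM; have [uD _] := invmx_diag d0.
rewrite /uphase vD; congr phase.
by rewrite !mulmxA mulmxKV // -mulmxA mul_diag_mx mxE.
Qed.

Lemma upper_diag_neq0 M i : M \in unitmx -> regular M -> (vmat M *m M) i i != 0.
Proof.
move=> uM rM; apply: (tri_unit_diag i (@up_inj n) (vmat_upper rM)).
by rewrite unitmx_mul uM andbT; exact/unipotent_unit/vmat_unipotent.
Qed.

Lemma lnorm_scale M (d : 'rV[C]_n) : M \in unitmx -> (forall i, `|d ord0 i| = 1) -> regular M ->
  lnorm (diag_mx d *m M) = lnorm M.
Proof.
move=> uM d1 rM; have d0 i : d ord0 i != 0 by rewrite -normr_eq0 d1 oner_eq0.
have dV i : (d ord0 i)^-1 = (d ord0 i)^*%R.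
  by apply: (mulIf (d0 i)); rewrite mulVf // conj_norm1.
apply/matrixP => i j.
have := (uphase_scale i uM d0 rM, uphase_scale j uM d0 rM, conj_vmat_scale lam uM d0 rM).
move: (diag_mx d *m M) => X [[Ui Uj] CE]; rewrite !lnormE Ui Uj CE (conj_diagE _ i j d0).
rewrite (phaseM (d0 i) (upper_diag_neq0 i uM rM)) (phaseM (d0 j) (upper_diag_neq0 j uM rM)).
rewrite (phase_id (d1 i)) (phase_id (d1 j)) dV rmorphM /=.
rewrite -!/(uphase M _); set di := d ord0 i; set dj := d ord0 j.
have ei : di^*%R * di = 1 := conj_norm1 (d1 i).
have ej : dj^*%R * dj = 1 := conj_norm1 (d1 j).
move: (conj_vmat _ _ _ _) (uphase M i)^*%R (uphase M j) => x a b.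
transitivity ((di^*%R * di) * (dj^*%R * dj) * (a * x * b)); first by ring.
by rewrite ei ej !mul1r.
Qed.

(** After rescaling, [M1] is the product of [invmx (vmat M1)] and an upper triangular matrix with
    positive diagonal. Uniqueness of the unipotent eigenvector matrix and of the Cholesky factor
    recovers both factors from the normal form. *)
Lemma build_lnorm M A : injective (fun i => lam ord0 i) -> M \is unitarymx -> regular M ->
  M *m A = diag_mx lam *m M -> build (lnorm M) = A.
Proof.
move=> lam_inj uM rM MA; have UM := unitarymx_unit uM.
pose d : 'rV[C]_n := \row_i (uphase M i)^*%R.
have d1 i : `|d ord0 i| = 1 by rewrite mxE norm_conjC norm_phase.
have d0 i : d ord0 i != 0 by rewrite -normr_eq0 d1 oner_eq0.
have [uD DV] := invmx_diag d0.
pose M1 := diag_mx d *m M.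
have [rM1 _] := regular_scale UM d0 rM; rewrite -/M1 in rM1.
have UM1 : M1 \in unitmx by rewrite unitmx_mul uD.
have M1A : M1 *m A = diag_mx lam *m M1.
  rewrite /M1 -mulmxA MA !mulmxA; congr (_ *m M); rewrite !mulmx_diag.
  by congr diag_mx; apply/rowP => i; rewrite !mxE mulrC.
have uM1 : M1^t* *m M1 = 1%:M.
  have E : M1 \is unitarymx.
    apply: (mul_unitarymx _ uM); apply/unitarymxP; rewrite diag_adj mulmx_diag -diag_const_mx.
    by congr diag_mx; apply/rowP => i; rewrite !mxE -normCK norm_conjC norm_phase expr1n.
  by rewrite -invmx_unitary // mulVmx.
have L1 : lnorm M = conj_vmat lam M1.
  have dV k : (d ord0 k)^-1 = uphase M k.
    apply: (mulIf (d0 k)); rewrite (mulVf (d0 k)) mxE mulrC conj_norm1 //.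
    exact: norm_phase.
  rewrite (conj_vmat_scale lam UM d0 rM); apply/matrixP => i j.
  by rewrite (conj_diagE _ i j d0) dV lnormE [d ord0 i]mxE.
have [_ uL] := conj_vmat_eq UM1 M1A.
have uv := vmat_unipotent M1.
have uE : umat (fun i => lam ord0 i) (lnorm M) = invmx (vmat M1).
  apply/esym; apply: umat_uniq => //.
  - exact: lnorm_lower.
  - by move=> i; rewrite lnorm_diag.
  - exact: unipotent_inv.
  - rewrite L1 uL /diagmu; congr (diag_mx _ *m _); apply/rowP => i.
    by rewrite !mxE.
rewrite /build uE /=; set u := invmx (vmat M1).
have uu : u \in unitmx by exact/unipotent_unit/unipotent_inv.
have M1E : u *m (vmat M1 *m M1) = M1 by rewrite mulKmx // unipotent_unit.
have bE : vmat M1 *m M1 = chol (u^t* *m u).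
  apply: (chol_uniq uu).
  - exact: vmat_upper.
  - move=> i; have [_ vD] := regular_scale UM d0 rM.
    rewrite vD !mulmxA mulmxKV // -mulmxA mul_diag_mx mxE mxE.
    have b0 := upper_diag_neq0 i UM rM.
    have <- : `|(vmat M *m M) i i| = (uphase M i)^*%R * (vmat M *m M) i i.
      rewrite -phase_conjM //; congr (_ * _); rewrite /uphase /phase conjC_eq0 (negbTE b0).
      by rewrite rmorphM fmorphV /= norm_conjC (conj_Creal (normr_real _)).
    by rewrite normr_gt0.
  - move: (vmat M1 *m M1) M1E => b M1E; rewrite -[RHS]uM1 -M1E.
    by rewrite adjM !mulmxA.
by rewrite -bE M1E -mulmxA -M1A mulmxA uM1 mul1mx.
Qed.

Lemma build_frame L : injective (fun i => lam ord0 i) -> lower L ->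
  (forall i, L i i = lam ord0 i) -> exists M,
  [/\ M \is unitarymx, M *m build L = diag_mx lam *m M, regular M & conj_vmat lam M = L].
Proof.
move=> lam_inj lL Ld; set u := umat (fun i => lam ord0 i) L.
have uu : unipotent u by exact: umat_unipotent.
have Uu := unipotent_unit uu.
have uL : u *m L = diag_mx lam *m u.
  rewrite (umat_eigen lam_inj lL Ld) /diagmu -/u; congr (diag_mx _ *m _).
  by apply/rowP => i; rewrite mxE.
pose b := chol (u^t* *m u); pose M := u *m b.
have MM : M^t* *m M = 1%:M by rewrite -(chol_gram Uu) adjM !mulmxA.
have uM : M \is unitarymx by apply/unitarymxP; exact: mulmx1C.
have vb : upper (invmx u *m M) by rewrite /M mulKmx //; exact: chol_upper.
have [rM vE] := regular_vmat (unitarymx_unit uM) (unipotent_inv uu) vb.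
exists M; split=> //.
  by rewrite /build -/u -/b -/M !mulmxA (mulmx1C MM) mul1mx.
by rewrite /conj_vmat vE invmxK -mulmxA -uL mulKmx.
Qed.

(** The inverse of [vmat M] is the eigenvector matrix [umat] of the conjugate, assembled from
    inverses of [tri f] matrices. Together with [conj_vmat_tri] this makes the Bruhat cell a linear
    condition on the normal form. *)
Lemma vmat_tri f M : injective (fun i => lam ord0 i) -> injective f ->
  tri f (conj_vmat lam M) -> tri f (vmat M).
Proof.
move=> lam_inj fi tL; have uv := vmat_unipotent M; have Uv := unipotent_unit uv.
have E : invmx (vmat M) = umat (fun i => lam ord0 i) (conj_vmat lam M).
  apply: umat_uniq => //.
  - exact: lower_conj_vmat.
  - by move=> i; rewrite conj_vmat_diag.
  - exact: unipotent_inv.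
  - rewrite /conj_vmat -mulmxA mulKmx // /diagmu; congr (diag_mx _ *m _).
    by apply/rowP => i; rewrite mxE.
rewrite -(invmxK (vmat M)) E; apply: tri_inv => //; last by rewrite -E unitmx_inv.
apply: tri_umat => // i; exact: conj_vmat_diag.
Qed.

Lemma conj_vmat_tri f M : injective f -> tri f (vmat M) -> tri f (conj_vmat lam M).
Proof.
move=> fi tv; apply: tri_mul; first by apply: tri_mul => //; exact: tri_diag.
by apply: tri_inv => //; exact/unipotent_unit/vmat_unipotent.
Qed.

End Normalization.

Section HessenbergConjugation.
Variables (F : fieldType) (n : nat) (h : 'I_n -> 'I_n).
Hypothesis h_mono : forall i j : 'I_n, (i <= j)%N -> (h i <= h j)%N.

(** A nonzero term would need [i <= k] and [l <= j], whence [h l <= h j < i <= k], where [A k l]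
    vanishes. *)
Lemma hess_conj (b A c : 'M[F]_n) : upper b -> upper c ->
  (forall i j : 'I_n, (h j < i)%N -> A i j = 0) ->
  forall i j : 'I_n, (h j < i)%N -> (b *m A *m c) i j = 0.
Proof.
move=> /upperP ub /upperP uc Ah i j ji; rewrite mxE big1 // => l _.
case: (ltnP j l) => jl; first by rewrite uc // mulr0.
rewrite mxE big1 ?mul0r // => k _; case: (ltnP k i) => ki; first by rewrite ub // mul0r.
by rewrite Ah ?mulr0 // (leq_ltn_trans (h_mono jl)) // (leq_trans ji).
Qed.

End HessenbergConjugation.

(** * Frames of eigenvectors *)

Local Open Scope sesquilinear_scope.

Section Frames.
Variables (C : numClosedFieldType) (n : nat) (lam : 'rV[C]_n).
Hypotheses (lam_inj : injective (fun i => lam ord0 i)) (lam_real : forall i, (lam ord0 i)^*%R = lam ord0 i).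
Implicit Types (A G : 'M[C]_n).

Definition frame A G := G \is unitarymx /\ G *m A = diag_mx lam *m G.

Lemma adjZ m p a (A : 'M[C]_(m, p)) : (a *: A)^t* = a^*%R *: A^t*.
Proof. by apply/matrixP => i j; rewrite !mxE rmorphM. Qed.

Lemma frame_row A G i : frame A G -> row i G *m A = lam ord0 i *: row i G.
Proof.
move=> [_ GA]; rewrite -row_mul GA; apply/rowP => j.
by rewrite mxE mul_diag_mx !mxE.
Qed.

Lemma frame_exists A : A^t* = A -> (forall i, eigenvalue A (lam ord0 i)) ->
  exists G, frame A G.
Proof.
move=> hA eA.
have /choice[v vP] : forall i, exists v : 'rV[C]_n, v *m A = lam ord0 i *: v /\ v != 0.
  by move=> i; have /eigenvalueP[v vA v0] := eA i; exists v.
have vv i j : i != j -> v i *m (v j)^t* = 0.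
  move=> ij; have : lam ord0 i *: (v i *m (v j)^t*) = lam ord0 j *: (v i *m (v j)^t*).
    have [vi _] := vP i; have [vj _] := vP j.
    rewrite scalemxAl -vi -mulmxA -{1}hA -adjM vj.
    by rewrite adjZ lam_real scalemxAr.
  move=> /eqP; rewrite -subr_eq0 -scalerBl scaler_eq0 subr_eq0 (inj_eq lam_inj) (negbTE ij) /=.
  by move/eqP.
pose q i : C := (v i *m (v i)^t*) ord0 ord0.
have q0 i : 0 < q i.
  have qE : q i = \sum_k `|v i ord0 k| ^+ 2.
    by rewrite /q mxE; apply: eq_bigr => k _; rewrite adjE -normCK.
  rewrite lt0r qE sumr_ge0 ?andbT => [|k _]; last by rewrite exprn_ge0.
  rewrite -qE; apply/eqP => qi0; have [_ /eqP] := vP i; apply; apply: adj_self_row.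
  by apply/matrixP => a b; rewrite !ord1 [RHS]mxE.
have s0 i : 0 < sqrtC (q i) by rewrite sqrtC_gt0.
pose G : 'M[C]_n := \matrix_(i, j) ((sqrtC (q i))^-1 * v i ord0 j).
have rG i : row i G = (sqrtC (q i))^-1 *: v i by apply/rowP => j; rewrite !mxE.
exists G; split.
  apply/unitarymxP/matrixP => i j.
  have -> : (G *m G^t*) i j = (row i G *m (row j G)^t*) ord0 ord0.
    by rewrite !mxE; apply: eq_bigr => k _; rewrite !adjE !mxE.
  rewrite !rG adjZ -scalemxAl -scalemxAr [LHS]mxE [X in _ * X]mxE [RHS]mxE.
  have [<-|ij] := eqVneq i j; last by rewrite vv // mxE !mulr0.
  rewrite -/(q i) conj_Creal; last by rewrite rpredV gtr0_real // s0.
  by rewrite -{3}(sqrtCK (q i)) expr2 mulKf ?mulVf ?gt_eqF.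
apply/row_matrixP => i; rewrite row_mul rG -scalemxAl; have [-> _] := vP i.
rewrite scalerA; apply/rowP => j; rewrite [RHS]mxE mul_diag_mx !mxE mulrA.
by congr (_ * _); rewrite mulrC.
Qed.

Lemma frame_adj A G : frame A G -> A *m G^t* = G^t* *m diag_mx lam.
Proof.
move=> [/unitarymxP GG GA]; have G'G := mulmx1C GG.
by rewrite -[LHS]mul1mx -G'G -!mulmxA (mulmxA G) GA -!mulmxA GG mulmx1.
Qed.

Lemma commute_diag (W : 'M[C]_n) i j : W *m diag_mx lam = diag_mx lam *m W -> i != j -> W i j = 0.
Proof.
move=> /matrixP/(_ i j); rewrite mul_mx_diag mul_diag_mx !mxE mulrC => /eqP.
rewrite -subr_eq0 -mulrBl mulf_eq0 subr_eq0 (inj_eq lam_inj) eq_sym.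
by move=> /orP[/eqP->|/eqP//]; rewrite eqxx.
Qed.

Lemma frame_uniq A G G' : frame A G -> frame A G' ->
  exists d : 'rV[C]_n, (forall i, `|d ord0 i| = 1) /\ G' = diag_mx d *m G.
Proof.
move=> fG fG'; have [uG GA] := fG; have [uG' GA'] := fG'.
pose W := G' *m G^t*.
have WL : W *m diag_mx lam = diag_mx lam *m W.
  by rewrite /W -mulmxA -(frame_adj fG) !mulmxA GA'.
have G'E : G' = W *m G by rewrite /W -mulmxA (mulmx1C (elimT unitarymxP uG)) mulmx1.
have WE : W = diag_mx (\row_i W i i).
  apply/matrixP => i j; rewrite !mxE; case: eqVneq => [->//|ij].
  by rewrite mulr0n -[LHS]/(\sum_k _) -[RHS](commute_diag WL ij) mxE.
have uW : W \is unitarymx.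
  by apply: mul_unitarymx => //; rewrite trmxC_unitary.
exists (\row_i W i i); split; last by rewrite -WE.
move=> i; have := elimT unitarymxP uW; rewrite {1 2}WE => /matrixP/(_ i i).
rewrite diag_adj mulmx_diag !mxE eqxx !mulr1n -normCK => H.
by apply/eqP; rewrite -(@eqrXn2 _ 2) ?normr_ge0 ?ler01 // expr1n; apply/eqP.
Qed.

Lemma frame_scale A G (d : 'rV[C]_n) : (forall i, `|d ord0 i| = 1) -> frame A G ->
  frame A (diag_mx d *m G).
Proof.
move=> d1 [uG GA]; split.
  apply: mul_unitarymx => //; apply/unitarymxP; rewrite diag_adj mulmx_diag -diag_const_mx.
  by congr diag_mx; apply/rowP => i; rewrite !mxE -normCK d1 expr1n.
rewrite -mulmxA GA !mulmxA !mulmx_diag; congr (diag_mx _ *m _).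
by apply/rowP => i; rewrite !mxE mulrC.
Qed.

(** Replacing column [l] of the singular [A - lam i] by the condition that entry [l] equals 1 gives
    an invertible system whose solution [srow] is an eigenvector depending continuously on [A], as
    long as the eigenvector has a nonzero entry [l]. *)
Definition smat A (i l : 'I_n) : 'M[C]_n :=
  \matrix_(k, m) if m == l then (k == l)%:R else A k m - (if k == m then lam ord0 i else 0).

Definition srow A (i l : 'I_n) : 'rV[C]_n := row l (invmx (smat A i l)).

Lemma smat_mul A (x : 'rV[C]_n) i l m : (x *m smat A i l) ord0 m =
  if m == l then x ord0 l else (x *m A) ord0 m - lam ord0 i * x ord0 m.
Proof.
case: eqVneq => [->|ml].
  rewrite mxE (bigD1 l) //= mxE !eqxx mulr1 big1 ?addr0 // => k kl.
  by rewrite mxE eqxx (negbTE kl) mulr0.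
rewrite !mxE (bigD1 m) //= [X in _ = X - _](bigD1 m) //=.
rewrite mxE (negbTE ml) eqxx mulrBr [lam _ _ * _]mulrC addrAC; congr (_ + _ - _).
by apply: eq_bigr => k km; rewrite mxE (negbTE ml) (negbTE km) subr0.
Qed.

Lemma smat_frame A G i l : frame A G -> row i G *m smat A i l = G i l *: delta_mx ord0 l.
Proof.
move=> fG; apply/rowP => m; rewrite smat_mul frame_row // !mxE eqxx.
by case: eqVneq => [_|_]; rewrite ?mulr1 ?mulr0 ?subrr.
Qed.

(** For [x] in the kernel, [x *m A - lam i *: x] is a multiple [c] of the [l]-th unit vector.
    Pairing with eigenvector [i] gives [c = 0], pairing with the others shows that [x] is a multiple
    of eigenvector [i], and its zero entry [l] makes that multiple 0. *)
Lemma smat_unit A G i l : A^t* = A -> frame A G -> G i l != 0 -> smat A i l \in unitmx.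
Proof.
move=> hA fG Gil; have [uG GA] := fG; rewrite -row_free_unit; apply: inj_row_free => x xN.
have xl : x ord0 l = 0.
  by have := smat_mul A x i l l; rewrite xN mxE eqxx => <-.
pose c := (x *m A) ord0 l.
have xA : x *m A - lam ord0 i *: x = c *: delta_mx ord0 l.
  apply/rowP => m; rewrite mxE [X in _ + X]mxE [X in _ - X]mxE [RHS]mxE [X in _ = _ * X]mxE eqxx.
  have := smat_mul A x i l m; rewrite xN mxE; case: eqVneq => [-> _|_ <-].
    by rewrite xl mulr0 subr0 mulr1.
  by rewrite mulr0.
have xG : (x *m A) *m G^t* = (x *m G^t*) *m diag_mx lam.
  by rewrite -!mulmxA (frame_adj fG).
have yE j : (x *m G^t*) ord0 j * (lam ord0 j - lam ord0 i) = c * (G j l)^*%R.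
  have := congr1 (fun y : 'rV[C]_n => (y *m G^t*) ord0 j) xA.
  rewrite /= mulmxBl xG -!scalemxAl mul_mx_diag; move: (x *m G^t*) => y.
  rewrite -rowE [RHS]mxE [row _ _ _ _]mxE adjE => <-.
  by rewrite ![in RHS]mxE mulrBr [lam ord0 i * _]mulrC.
have c0 : c = 0.
  have := yE i; rewrite subrr mulr0 => /esym/eqP.
  by rewrite mulf_eq0 conjC_eq0 (negbTE Gil) orbF => /eqP.
have yj j : j != i -> (x *m G^t*) ord0 j = 0.
  move=> ji; have /eqP := yE j; rewrite c0 mul0r mulf_eq0 subr_eq0 (inj_eq lam_inj) (negbTE ji) orbF.
  by move/eqP.
have xE : x = (x *m G^t*) ord0 i *: row i G.
  rewrite -[LHS]mulmx1 -(mulmx1C (elimT unitarymxP uG)) mulmxA; apply/rowP => m.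
  rewrite mxE (bigD1 i) //= big1 ?addr0 => [|j ji]; last by rewrite yj // mul0r.
  by rewrite !mxE.
have : (x *m G^t*) ord0 i * G i l = 0 by rewrite -xl [in RHS]xE !mxE.
move/eqP; rewrite mulf_eq0 (negbTE Gil) orbF => /eqP y0.
by rewrite xE y0 scale0r.
Qed.

Lemma srow_frame A G i l : frame A G -> smat A i l \in unitmx ->
  G i l != 0 /\ row i G = G i l *: srow A i l.
Proof.
move=> fG uN; have rE : row i G = G i l *: srow A i l.
  by rewrite /srow rowE scalemxAl -(smat_frame _ _ fG) mulmxK.
split=> //; apply/eqP => g0; have [/unitarymxP/matrixP/(_ i i) + _] := fG.
rewrite [in RHS]mxE eqxx => /eqP; apply/negP.
have -> : (G *m G^t*) i i = (row i G *m (row i G)^t*) ord0 ord0.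
  by rewrite !mxE; apply: eq_bigr => k _; rewrite !adjE !mxE.
by rewrite rE g0 scale0r mul0mx mxE eq_sym oner_neq0.
Qed.

Definition sframe A (l : 'I_n -> 'I_n) : 'M[C]_n := \matrix_(i, j)
  (srow A i (l i) ord0 j / sqrtC (\sum_k `|srow A i (l i) ord0 k| ^+ 2)).

Lemma sframe_frame A G l : A^t* = A -> frame A G ->
  (forall i, smat A i (l i) \in unitmx) -> frame A (sframe A l).
Proof.
move=> hA fG us.
have sE i := srow_frame fG (us i).
pose d : 'rV[C]_n := \row_i ((G i (l i))^-1 * `|G i (l i)|).
suff -> : sframe A l = diag_mx d *m G.
  apply: frame_scale fG => i; rewrite mxE normrM normfV normr_id mulVf // normr_eq0.
  by have [] := sE i.
apply/matrixP => i j; rewrite mul_diag_mx [LHS]mxE [RHS]mxE [X in _ = X * _]mxE.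
have [g0 rE] := sE i; have rE' k : srow A i (l i) ord0 k = (G i (l i))^-1 * G i k.
  by have /rowP/(_ k) := rE; rewrite mxE [RHS]mxE => ->; rewrite mulKf.
rewrite rE' -mulrA [RHS]mulrAC -[RHS]mulrA; congr (_ * _).
have -> : \sum_k `|srow A i (l i) ord0 k| ^+ 2 = `|G i (l i)|^-1 ^+ 2.
  under eq_bigr do rewrite rE' normrM exprMn normfV.
  rewrite -mulr_sumr.
  have -> : \sum_k `|G i k| ^+ 2 = 1.
    have [/unitarymxP GG _] := fG; have <- : (G *m G^t*) i i = 1 by rewrite GG mxE eqxx.
    by rewrite mxE; apply: eq_bigr => k _; rewrite adjE -normCK.
  by rewrite mulr1.
by rewrite sqrCK ?invr_ge0 // invrK.
Qed.

End Frames.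

(** * Continuity of matrix constructions *)

Local Open Scope sesquilinear_scope.

Section MatrixFamilies.
Variables (C : numClosedFieldType) (X : topologicalType) (n : nat).

Definition mcont m p (f : X -> 'M[C]_(m, p)) := forall i j, continuous (fun x => f x i j).

Lemma eq_cont (Y : topologicalType) (f g : X -> Y) : (forall x, f x = g x) -> continuous g -> continuous f.
Proof. by move=> /funext ->. Qed.

Lemma mcont_mul m p q (f : X -> 'M[C]_(m, p)) (g : X -> 'M[C]_(p, q)) :
  mcont f -> mcont g -> mcont (fun x => f x *m g x).
Proof.
move=> fc gc i j; apply: (eq_cont (g := fun x => \sum_k f x i k * g x k j)) => [x|]; first by rewrite mxE.
by apply: cont_sum => k; apply: contM; [exact: fc|exact: gc].
Qed.

Lemma cont_conj (f : X -> C) : continuous f -> continuous (fun x => (f x)^*%R).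
Proof.
move=> fc x; apply/cvgrPdist_lt => e e0; have /cvgrPdist_lt/(_ _ e0) := fc x.
by apply: filterS => y; rewrite -rmorphB norm_conjC.
Qed.

Lemma mcont_adj m p (f : X -> 'M[C]_(m, p)) : mcont f -> mcont (fun x => (f x)^t*).
Proof.
move=> fc i j; apply: (eq_cont (g := fun x => (f x j i)^*%R)) => [x|]; first by rewrite adjE.
exact: cont_conj.
Qed.

Lemma mcont_cst m p (A : 'M[C]_(m, p)) : mcont (fun=> A).
Proof. by move=> i j; exact: cont_cst. Qed.

Lemma cont_sqrtC (f : X -> C) : (forall x, 0 <= f x) -> continuous f -> continuous (fun x => sqrtC (f x)).
Proof.
move=> f0 fc x; apply/cvgrPdist_lt => e e0.
have /cvgrPdist_lt/(_ _ (exprn_gt0 2 e0)) := fc x; apply: filterS => y xy.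
have sx0 : 0 <= sqrtC (f x) by rewrite sqrtC_ge0.
have sy0 : 0 <= sqrtC (f y) by rewrite sqrtC_ge0.
rewrite -(@ltr_pXn2r _ 2) ?nnegrE ?normr_ge0 ?ltW //; apply: le_lt_trans xy.
rewrite -{2}(sqrtCK (f x)) -{2}(sqrtCK (f y)) subr_sqr normrM expr2 ler_wpM2l //.
by rewrite (ger0_norm (addr_ge0 sx0 sy0)) (le_trans (ler_normB _ _)) // !ger0_norm.
Qed.

Lemma cont_phase (f : X -> C) : (forall x, f x != 0) -> continuous f -> continuous (fun x => phase (f x)).
Proof.
move=> f0 fc; apply: (eq_cont (g := fun x => f x * (`|f x|)^-1)) => [x|].
  by rewrite /phase (negbTE (f0 x)).
apply: contM; [exact: fc|apply: contV; first by move=> x; rewrite normr_eq0].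
by move=> x; apply: cvg_norm; exact: fc.
Qed.

Lemma cont_prod J (r : seq J) (f : J -> X -> C) :
  (forall j, continuous (f j)) -> continuous (fun x => \prod_(j <- r) f j x).
Proof.
move=> fc; elim: r => [|j r IH].
  rewrite (_ : (fun x => _) = (fun=> 1)); first exact: cont_cst.
  by apply/funext => x; rewrite big_nil.
apply: (eq_cont (g := fun x => f j x * \prod_(j <- r) f j x)) => [x|]; first by rewrite big_cons.
by apply: contM; [exact: fc|exact: IH].
Qed.

Lemma cont_det m (f : X -> 'M[C]_m) : mcont f -> continuous (fun x => \det (f x)).
Proof.
move=> fc; apply: cont_sum => s; apply: contM; first exact: cont_cst.
by apply: cont_prod => i; exact: fc.
Qed.

Lemma mcont_inv m (f : X -> 'M[C]_m) : (forall x, f x \in unitmx) -> mcont f -> mcont (fun x => invmx (f x)).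
Proof.
move=> uf fc i j; apply: (eq_cont (g := fun x => (\det (f x))^-1 * ((-1) ^+ (j + i) * \det (row' j (col' i (f x)))))) => [x|].
  by rewrite /invmx uf !mxE.
apply: contM; first by apply: contV => [x|]; [have := uf x; rewrite unitmxE unitfE|exact: cont_det].
apply: contM; first exact: cont_cst.
apply: cont_det => a b; apply: (eq_cont (g := fun x => f x (lift j a) (lift i b))) => [x|]; first by rewrite !mxE.
exact: fc.
Qed.

Lemma cont_if (b : bool) (f g : X -> C) : continuous f -> continuous g -> continuous (fun x => if b then f x else g x).
Proof. by case: b. Qed.

Lemma mcont_matrix m p (f : X -> 'I_m -> 'I_p -> C) : (forall i j, continuous (fun x => f x i j)) ->
  mcont (fun x => \matrix_(i, j) f x i j).
Proof.
by move=> fc i j; apply: (eq_cont (g := fun x => f x i j)) => [x|]; rewrite ?mxE //; exact: fc.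
Qed.

Lemma mcont_minor k (f : X -> 'M[C]_n) : mcont f -> mcont (fun x => minor_mx k (f x)).
Proof. by move=> fc; apply: mcont_matrix => i j; apply: cont_if => //; exact: cont_cst. Qed.

Lemma mcont_vmat (f : X -> 'M[C]_n) : (forall x, regular (f x)) -> mcont f -> mcont (fun x => vmat (f x)).
Proof.
move=> rf fc; apply: mcont_matrix => i j; apply: cont_if; last exact: cont_cst.
apply: (eq_cont (g := fun x => -1 * vrow (f x) i ord0 j)) => [x|]; first by rewrite mulN1r.
apply: contM; first exact: cont_cst.
apply: mcont_mul; first by apply: mcont_matrix => a b; apply: cont_if => //; exact: cont_cst.
by apply: mcont_inv; [move=> x; exact: rf|exact: mcont_minor].
Qed.

Lemma mcont_umat (mu : 'I_n -> C) (f : X -> 'M[C]_n) : injective mu ->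
  (forall x, lower (f x)) -> (forall x i, f x i i = mu i) -> mcont f -> mcont (fun x => umat mu (f x)).
Proof.
move=> mi lf df fc; apply: mcont_matrix => i j; apply: mcont_inv.
  by move=> x; exact: (nmat_unit mi (@low_inj n) (lf x) (df x)).
apply: mcont_matrix => a b; apply: cont_if; first exact: cont_cst.
by apply: contB; [exact: fc|exact: cont_cst].
Qed.

Lemma mcont_diag (f : X -> 'rV[C]_n) : mcont f -> mcont (fun x => diag_mx (f x)).
Proof.
move=> fc i j; apply: (eq_cont (g := fun x => f x ord0 i * (i == j)%:R)) => [x|].
  by rewrite mxE mulr_natr.
by apply: contM; [exact: fc|exact: cont_cst].
Qed.

Lemma mcont_chol (f : X -> 'M[C]_n) : (forall x, exists2 u, u \in unitmx & f x = u^t* *m u) ->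
  mcont f -> mcont (fun x => chol (f x)).
Proof.
move=> uf fc.
have rf x : regular (f x) by have [u uu ->] := uf x; exact: gram_regular.
have cv := mcont_vmat rf fc.
apply: mcont_mul; first exact: mcont_adj.
apply: mcont_diag => a i; apply: (eq_cont (g := fun x => (sqrtC (pivot (f x) i))^-1)) => [x|].
  by rewrite mxE.
have p0 x : 0 < pivot (f x) i.
  by have [u uu ->] := uf x; have [_] := gram_diag uu.
apply: contV; first by move=> x; rewrite sqrtC_eq0 gt_eqF.
apply: cont_sqrtC; first by move=> x; exact: ltW.
by apply: mcont_mul; [apply: mcont_mul|apply: mcont_adj].
Qed.

Variable lam : 'rV[C]_n.
Hypothesis lam_inj : injective (fun i => lam ord0 i).

Lemma mcont_build (f : X -> 'M[C]_n) : (forall x, lower (f x)) ->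
  (forall x i, f x i i = lam ord0 i) -> mcont f -> mcont (fun x => build lam (f x)).
Proof.
move=> lf df fc; have cu := mcont_umat lam_inj lf df fc.
have cM : mcont (fun x => umat (fun i => lam ord0 i) (f x) *m
    chol ((umat (fun i => lam ord0 i) (f x))^t* *m umat (fun i => lam ord0 i) (f x))).
  apply: mcont_mul => //; apply: mcont_chol.
    by move=> x; exists (umat (fun i => lam ord0 i) (f x)) => //; exact/unipotent_unit/umat_unipotent.
  by apply: mcont_mul => //; exact: mcont_adj.
by apply: mcont_mul => //; apply: mcont_mul; [exact: mcont_adj|exact: mcont_cst].
Qed.

Lemma mcont_lnorm (f : X -> 'M[C]_n) : (forall x, f x \in unitmx) -> (forall x, regular (f x)) ->
  mcont f -> mcont (fun x => lnorm lam (f x)).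
Proof.
move=> uf rf fc; have cv := mcont_vmat rf fc.
have cp i : continuous (fun x => uphase (f x) i).
  by apply: cont_phase => [x|]; [exact: upper_diag_neq0|exact: mcont_mul].
apply: mcont_matrix => i j; apply: contM; last exact: cp.
apply: contM; first by apply: cont_conj; exact: cp.
apply: mcont_mul; first by apply: mcont_mul => //; exact: mcont_cst.
by apply: mcont_inv => // x; exact/unipotent_unit/vmat_unipotent.
Qed.

Lemma mcont_smat (f : X -> 'M[C]_n) i l : mcont f -> mcont (fun x => smat lam (f x) i l).
Proof.
move=> fc; apply: mcont_matrix => a b; apply: cont_if; first exact: cont_cst.
by apply: contB; [exact: fc|exact: cont_cst].
Qed.

Lemma mcont_sframe (f : X -> 'M[C]_n) l : (forall x i, smat lam (f x) i (l i) \in unitmx) ->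
  mcont f -> mcont (fun x => sframe lam (f x) l).
Proof.
move=> uf fc.
have cs i j : continuous (fun x => srow lam (f x) i (l i) ord0 j).
  apply: (eq_cont (g := fun x => invmx (smat lam (f x) i (l i)) (l i) j)) => [x|]; first by rewrite mxE.
  by apply: mcont_inv; [move=> x; exact: uf|exact: mcont_smat].
apply: mcont_matrix => i j; apply: contM; first exact: cs.
have ge0 x k : 0 <= `|srow lam (f x) i (l i) ord0 k| ^+ 2 by rewrite exprn_ge0.
apply: contV.
  move=> x; rewrite sqrtC_eq0; apply/eqP => /psumr_eq0P s0.
  have r0 : srow lam (f x) i (l i) = 0.
    apply/rowP => k; rewrite [RHS]mxE; apply/eqP; rewrite -normr_eq0 -sqrf_eq0; apply/eqP.
    by apply: s0.
  have : srow lam (f x) i (l i) *m smat lam (f x) i (l i) = delta_mx ord0 (l i).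
    by rewrite /srow -row_mul mulVmx // row1.
  rewrite r0 mul0mx => /rowP/(_ (l i)); rewrite !mxE !eqxx => /esym/eqP.
  by rewrite oner_eq0.
apply: cont_sqrtC; first by move=> x; exact: sumr_ge0.
apply: cont_sum => k; apply: (eq_cont (g := fun x => `|srow lam (f x) i (l i) ord0 k| * `|srow lam (f x) i (l i) ord0 k|)) => [x|].
  by rewrite expr2.
by apply: contM => x; apply: cvg_norm; exact: cs.
Qed.

End MatrixFamilies.

(** * Bruhat cells *)

Local Open Scope sesquilinear_scope.

Section Cells.
Variables (C : numClosedFieldType) (n : nat) (mu : 'I_n -> C).
Hypotheses (mu_inj : injective mu) (mu_real : forall i, (mu i)^*%R = mu i).
Implicit Types (A G M : 'M[C]_n) (w : {perm 'I_n}).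

Definition eigenrow w : 'rV[C]_n := \row_i mu (w i).

Lemma eigenrow_inj w : injective (fun i => eigenrow w ord0 i).
Proof. by move=> i j; rewrite !mxE => /mu_inj/perm_inj. Qed.

Lemma eigenrow_real w i : (eigenrow w ord0 i)^*%R = eigenrow w ord0 i.
Proof. by rewrite mxE mu_real. Qed.

Lemma frame_unit lam A G : frame lam A G -> G \in unitmx.
Proof. by move=> [/unitarymx_unit]. Qed.

Lemma frame_hermitian w A G : frame (eigenrow w) A G -> A^t* = A.
Proof.
move=> [/unitarymxP GG GA].
have -> : A = G^t* *m diag_mx (eigenrow w) *m G by rewrite -mulmxA -GA mulmxA (mulmx1C GG) mul1mx.
rewrite !adjM trmxCK diag_adj mulmxA; congr (_ *m diag_mx _ *m _).
by apply/rowP => i; rewrite mxE eigenrow_real.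
Qed.

Lemma frame_eigenvalue w A G c : frame (eigenrow w) A G ->
  eigenvalue A c <-> exists i, mu i = c.
Proof.
move=> fG; have [/unitarymxP GG GA] := fG; have uG := frame_unit fG; split.
  move=> /eigenvalueP[v vA v0]; pose y := v *m G^t*.
  have vE : v = y *m G by rewrite /y -mulmxA (mulmx1C GG) mulmx1.
  have /rowP yE : y *m diag_mx (eigenrow w) = c *: y.
    by rewrite /y -mulmxA -(frame_adj fG) mulmxA vA -scalemxAl.
  have /rV0Pn[j yj] : y != 0 by apply: contraNneq v0 => y0; rewrite vE y0 mul0mx.
  exists (w j); have := yE j; rewrite mul_mx_diag mxE [RHS]mxE mulrC mxE => /eqP.
  by rewrite -subr_eq0 -mulrBl mulf_eq0 (negbTE yj) orbF subr_eq0 => /eqP.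
move=> [i <-]; apply/eigenvalueP; exists (row ((w^-1)%g i) G).
  by rewrite (frame_row _ fG) mxE permKV.
apply/eqP => r0; have : row ((w^-1)%g i) G *m invmx G = 0 by rewrite r0 mul0mx.
rewrite -row_mul mulmxV // => /rowP/(_ ((w^-1)%g i)); rewrite !mxE eqxx => /eqP.
by rewrite oner_eq0.
Qed.

Lemma frame_perm w s G A : frame (eigenrow w) A G ->
  frame (eigenrow (s * w)) A (row_perm s G).
Proof.
move=> [/unitarymxP GG GA]; split.
  apply/unitarymxP/matrixP => i j.
  have -> : (row_perm s G *m (row_perm s G)^t*) i j = (G *m G^t*) (s i) (s j).
    by rewrite !mxE; apply: eq_bigr => k _; rewrite !adjE !mxE.
  by rewrite GG !mxE (inj_eq perm_inj).
have -> : row_perm s G *m A = row_perm s (G *m A) by rewrite !row_permE mulmxA.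
by rewrite GA; apply/matrixP => i j; rewrite !mul_diag_mx !mxE permM.
Qed.

Lemma regular_frame w A M M' : frame (eigenrow w) A M -> frame (eigenrow w) A M' ->
  regular M -> regular M'.
Proof.
move=> fM fM' rM; have [d [d1 ->]] := frame_uniq (@eigenrow_inj w) fM fM'.
have d0 i : d ord0 i != 0 by rewrite -normr_eq0 d1 oner_neq0.
by have [] := regular_scale (frame_unit fM) d0 rM.
Qed.

(** Stated on the conjugated matrix, where the chart coordinates live; [in_cellP] translates it to
    the support condition of the Bruhat decomposition. *)
Definition in_cell w M := forall i j, (w j < w i)%N -> conj_vmat (eigenrow w) M i j = 0.

Definition chart_order w (i : 'I_n) : nat := n - w i.

Lemma chart_orderE w i j : (chart_order w i < chart_order w j)%N = (w j < w i)%N.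
Proof. by rewrite /chart_order; have := ltn_ord (w i); have := ltn_ord (w j); lia. Qed.

Lemma chart_order_inj w : injective (chart_order w).
Proof.
move=> i j E; apply: (@perm_inj _ w); apply/val_inj => /=.
by move: E; rewrite /chart_order; have := ltn_ord (w i); have := ltn_ord (w j); lia.
Qed.

Lemma in_cellP w M : in_cell w M <-> forall i j, (w j < w i)%N -> vmat M i j = 0.
Proof.
split=> H.
  have t : tri (chart_order w) (conj_vmat (eigenrow w) M).
    by move=> i j; rewrite chart_orderE; exact: H.
  move=> i j ij; apply: (vmat_tri (@eigenrow_inj w) (@chart_order_inj w) t).
  by rewrite chart_orderE.
have t : tri (chart_order w) (vmat M) by move=> i j; rewrite chart_orderE; exact: H.
move=> i j ij; apply: (conj_vmat_tri _ (@chart_order_inj w) t).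
by rewrite chart_orderE.
Qed.

Lemma row_permK w G : row_perm w (row_perm w^-1 G) = G.
Proof. by apply/matrixP => i j; rewrite !mxE permK. Qed.

Lemma cell_order w w' A M M' : frame (eigenrow w) A M -> regular M -> in_cell w M ->
  frame (eigenrow w') A M' -> regular M' -> w = w' \/ (rank_sum w' < rank_sum w)%N.
Proof.
move=> fM rM /in_cellP cM fM' rM'; set G := row_perm w^-1 M.
have fG : frame (eigenrow 1) A G by rewrite -(mulVg w); exact: frame_perm.
apply: (bruhat_order (frame_unit fG) (vmat_unipotent M) cM).
  by rewrite row_permK; exact: vmat_upper.
by apply: regular_frame fM' _ rM'; rewrite -[w' in eigenrow w']mulg1; exact: frame_perm.
Qed.

(** The frame lies in the cell of some [w']. By the Bruhat order [w'] has larger rank sum than [w],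
    unless [w' = w], which is excluded. *)
Lemma outside_cell w A M : frame (eigenrow w) A M -> regular M -> ~ in_cell w M ->
  exists w' M', [/\ frame (eigenrow w') A M', regular M' & (rank_sum w < rank_sum w')%N].
Proof.
move=> fM rM cM; set G := row_perm w^-1 M.
have fG : frame (eigenrow 1) A G by rewrite -(mulVg w); exact: frame_perm.
have [w' [v [uv v0 vG]]] := bruhat (frame_unit fG).
have fM' : frame (eigenrow w') A (row_perm w' G).
  by rewrite -[w' in eigenrow w']mulg1; exact: frame_perm.
have [rM' vE] := regular_vmat (frame_unit fM') uv vG.
exists w', (row_perm w' G); split=> //.
have : regular (row_perm w G) by rewrite row_permK.
case/(bruhat_order (frame_unit fG) uv v0 vG) => // ww'; case: cM; apply/in_cellP => i j.
by rewrite -(row_permK w M) -/G -ww' vE; exact: v0.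
Qed.

Variable h : 'I_n -> 'I_n.
Hypothesis h_mono : forall i j : 'I_n, (i <= j)%N -> (h i <= h j)%N.

Definition below_stair A := forall i j : 'I_n, (h j < i)%N -> A i j = 0.

Lemma lnorm_below_stair w A M : frame (eigenrow w) A M -> regular M -> below_stair A ->
  below_stair (lnorm (eigenrow w) M).
Proof.
move=> fM rM sA i j hij; apply/eqP; rewrite lnorm_eq0; have [_ MA] := fM.
have uM := frame_unit fM; have [-> _] := conj_vmat_eq uM MA.
have ub := vmat_upper rM.
have Ub : vmat M *m M \in unitmx by rewrite unitmx_mul uM (unipotent_unit (vmat_unipotent M)).
apply/eqP; apply: (hess_conj h_mono ub _ sA hij).
exact: (tri_inv (@up_inj n)).
Qed.

Lemma build_below_stair w A M : frame (eigenrow w) A M -> regular M ->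
  below_stair (conj_vmat (eigenrow w) M) -> below_stair A.
Proof.
move=> fM rM sL; have uM := frame_unit fM; have [_ MA] := fM.
have [LE _] := conj_vmat_eq uM MA; have ub := vmat_upper rM.
set b := vmat M *m M in LE ub.
have Ub : b \in unitmx by rewrite unitmx_mul uM (unipotent_unit (vmat_unipotent M)).
have -> : A = invmx b *m conj_vmat (eigenrow w) M *m b.
  by rewrite LE [X in X *m b]mulmxA [X in X *m _ *m b]mulmxA mulVmx // mul1mx mulmxKV.
move=> i j hij; apply: (hess_conj h_mono _ ub sL hij).
exact: (tri_inv (@up_inj n)).
Qed.

End Cells.

(** * Odd cohomology of the space of staircase matrices *)

Local Open Scope complex_scope.
Local Open Scope sesquilinear_scope.

Section Coordinates.
Variables (R : realType) (T : eqType) (M : zmodType).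
Local Notation E := ({ptws T -> R}).

Definition pcoord (t : T) (Y : E) : R := Y t.

Lemma continuous_pcoord t : continuous (pcoord t).
Proof. by move=> Y; exact: (@proj_continuous _ (fun=> R : topologicalType) t Y). Qed.

Lemma acyclic_coordinates (J : seq T) k : uniq J -> odd k != odd (size J) ->
  @acyclic R M E k setT (nonzero_locus pcoord J).
Proof.
move=> uJ oJ; have PT : positive_locus pcoord [::] = setT by apply/seteqP; split.
have := @acyclic_nonzero_locus R M E _ pcoord J [::] continuous_pcoord _ J [::] k uJ.
rewrite PT setTI; apply=> // eps _ eps0.
pose H (s : itv01 R) (Y : E) : E := fun t => val s * Y t + (1 - val s) * eps t.
exists H, (H i0 (fun=> 0)); split.
- move=> z _; split; apply/funext => t; rewrite /H /=.
    by rewrite mul1r subrr mul0r addr0.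
  by rewrite !mul0r.
- move=> m u uT; apply: (homotopy_cube_scube uT) => //.
  have [_ cu _] := scube_shift uT.
  apply: continuous_ptwsP => t.
  have cs : continuous (fun s : cube R m.+1 => val (seq_of s 0%N) : R) by exact: continuous_coord.
  apply: contD; apply: contM => //; last exact: cont_cst.
    by move=> s; exact: (continuous_comp (cu s) (@continuous_pcoord t _)).
  by apply: contB => //; exact: cont_cst.
- move=> z _ s t tJ; have /andP[s0 s1] := valP s.
  exists (val s), (1 - val s); split=> //; rewrite ?subr_ge0 //.
    by case: eqVneq => // sN0; rewrite lt_neqAle eq_sym sN0.
  by rewrite subr_gt0.
Qed.

End Coordinates.

Lemma near_neq0 (K : numFieldType) (X : topologicalType) (f : X -> K) x :
  {for x, continuous f} -> f x != 0 -> \forall y \near x, f y != 0.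
Proof.
move=> fc; rewrite -normr_gt0 => fx0; have /cvgrPdist_lt/(_ _ fx0) := fc.
by apply: filterS => y; apply: contraTneq => ->; rewrite subr0 ltxx.
Qed.

Section StaircaseSpace.
Variables (R : realType) (n : nat) (h : 'I_n -> 'I_n) (lambda : 'I_n -> R).
Hypothesis h_mono : forall i j : 'I_n, (i <= j)%N -> (h i <= h j)%N.
Hypothesis h_ge : forall i : 'I_n, (i <= h i)%N.
Hypothesis lambda_inj : injective lambda.
Local Notation C := (complex R : numClosedFieldType).
Local Notation Xh := (staircase_isospectral h lambda).
Local Notation raw T := ((nat -> itv01 R) -> T).
Implicit Types (A : Xh) (w : {perm 'I_n}).

Definition mu (i : 'I_n) : C := (lambda i)%:C.

Lemma mu_inj : injective mu.
Proof. by move=> i j /complexI/lambda_inj. Qed.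

Lemma mu_real i : (mu i)^*%R = mu i.
Proof. by rewrite conj_Creal //; apply/complex_realP; exists (lambda i). Qed.

Definition mat A : 'M[C]_n := \val A.

Lemma continuous_mat : mcont mat.
Proof.
move=> i j A; exact: (continuous_comp (@continuous_val _ Xh A) (@continuous_mx_entry _ _ _ i j (\val A))).
Qed.

Lemma mem_Xh (A : 'M[C]_n) : Xh A <->
  [/\ A^t* = A, below_stair h A & forall c, eigenvalue A c <-> exists i, mu i = c].
Proof.
have herm : (A : 'M[cplx R]_n) \is hermsymmx <-> A^t* = A.
  split; first by move=> /is_hermitianmxP; rewrite expr0 scale1r => AE; rewrite [RHS]AE.
  by move=> AE; apply/is_hermitianmxP; rewrite expr0 scale1r; symmetry.
split=> [[[/herm AE sA] [_ eA]]|[AE sA eA]].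
  split=> // [i j hij|c]; first by apply: sA; right.
  have -> : (exists i, mu i = c) = (range (fun i => (lambda i)%:C : cplx R) c).
    by apply/propext; split=> [[i ic]|[i _ ic]]; exists i.
  by rewrite -eA.
split; split; [exact/herm| |exact/herm|].
  move=> i j [hij|hij]; last exact: sA.
  by rewrite -AE adjE sA // conjC0.
apply/seteqP; split=> c; first by move=> /eA[i ic]; exists i.
by move=> [i _ ic]; apply/eA; exists i.
Qed.

Lemma matP A : [/\ (mat A)^t* = mat A, below_stair h (mat A) &
  forall c, eigenvalue (mat A) c <-> exists i, mu i = c].
Proof. by apply/mem_Xh; exact: set_valP A. Qed.

Lemma mat_frame w A : exists G, frame (eigenrow mu w) (mat A) G.
Proof.
have [AE _ eA] := matP A.
apply: frame_exists => //; [exact: (eigenrow_inj mu_inj)|by move=> i; rewrite eigenrow_real //; exact: mu_real|].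
by move=> i; apply/eA; exists (w i); rewrite mxE.
Qed.

Definition fr w A := projT1 (cid (mat_frame w A)).

Lemma frP w A : frame (eigenrow mu w) (mat A) (fr w A).
Proof. exact: projT2 (cid (mat_frame w A)). Qed.

Definition dense_chart w : set Xh := [set A | regular (fr w A)].

Lemma dense_regular w A M : frame (eigenrow mu w) (mat A) M -> dense_chart w A -> regular M.
Proof. by move=> fM; exact: (regular_frame mu_inj (frP w A) fM). Qed.

Lemma regular_dense w A M : frame (eigenrow mu w) (mat A) M -> regular M -> dense_chart w A.
Proof. by move=> fM; exact: (regular_frame mu_inj fM (frP w A)). Qed.

(** The frames [fr] are chosen matrix by matrix, without continuity. Fixing at [A0] a nonzero entry
    of each eigenvector gives a frame with a continuous formula nearby. *)
Lemma local_frame w (A0 : Xh) : exists (U : set Xh) (s : Xh -> 'M[C]_n), [/\ open U, U A0,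
  forall A, U A -> frame (eigenrow mu w) (mat A) (s A) & mcont (fun A : U => s (\val A))].
Proof.
have [A0h _ _] := matP A0; have fA0 := frP w A0.
have /choice[l lP] : forall i, exists l, fr w A0 i l != 0.
  move=> i; apply: contrapT => /forallNP H; have := frame_unit fA0.
  rewrite -row_free_unit => /row_freeP[B /matrixP/(_ i i)]; rewrite !mxE eqxx big1 => [/eqP|k _].
    by rewrite eq_sym oner_eq0.
  by have /negP := H k; rewrite negbK => /eqP ->; rewrite mul0r.
pose U : set Xh := [set A | forall i, smat (eigenrow mu w) (mat A) i (l i) \in unitmx].
exists U, (fun A => sframe (eigenrow mu w) (mat A) l); split.
- rewrite openE => A UA; rewrite /interior.
  suff : \forall B \near A, forall i, smat (eigenrow mu w) (mat B) i (l i) \in unitmx by [].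
  apply: (@filter_forall _ _ (fun i B => smat (eigenrow mu w) (mat B) i (l i) \in unitmx) _ (nbhs_filter A)) => i.
  have cN : mcont (fun B : Xh => smat (eigenrow mu w) (mat B) i (l i)) by apply: mcont_smat; exact: continuous_mat.
  have := UA i; rewrite unitmxE unitfE => /(near_neq0 (@cont_det _ _ _ _ cN A)).
  by apply: filterS => B; rewrite unitmxE unitfE.
- by move=> i; apply: (smat_unit (eigenrow_inj mu_inj (w := w)) A0h fA0).
- by move=> A UA; have [Ah _ _] := matP A; exact: (sframe_frame Ah (frP w A)).
- apply: mcont_sframe => [A i|i j]; first by have := set_valP A.
  by move=> A; exact: (continuous_comp (@continuous_val _ U A) (@continuous_mat i j _)).
Qed.

Lemma open_dense_chart w : open (dense_chart w).
Proof.
rewrite openE => A0 dA0; rewrite /interior.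
have [U [s [oU UA0 fU cU]]] := local_frame w A0.
have r0 : regular (s A0) by exact: dense_regular (fU _ UA0) dA0.
have : \forall A \near A0, forall k : 'I_n, minor_mx k (s A) \in unitmx.
  apply: (@filter_forall _ _ (fun (k : 'I_n) A => minor_mx k (s A) \in unitmx) _ (nbhs_filter A0)) => k.
  have cg : continuous (fun A : U => \det (minor_mx k (s (\val A)))) by apply: cont_det; exact: mcont_minor.
  have c0 : {for A0, continuous (fun A => \det (minor_mx k (s A)))} := continuous_open_val oU cg UA0.
  have := r0 k; rewrite unitmxE unitfE => /(near_neq0 c0).
  by apply: filterS => A; rewrite unitmxE unitfE.
apply: filterS2 (open_nbhs_nbhs (conj oU UA0)) => A UA rA.
by exact: regular_dense (fU _ UA) rA.
Qed.

Local Notation T := (('I_n * 'I_n * bool)%type : eqType).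
Local Notation E := ({ptws T -> R}).

(** All entries are recorded, including those that [lowmat] ignores; it is enough that [phi] undoes
    [psi] on the chart. *)
Definition psi w A : E := fun t => if t.2 then complex.Re (lnorm (eigenrow mu w) (fr w A) t.1.1 t.1.2)
  else complex.Im (lnorm (eigenrow mu w) (fr w A) t.1.1 t.1.2).

Lemma lnorm_frame w A M : frame (eigenrow mu w) (mat A) M -> regular M ->
  lnorm (eigenrow mu w) (fr w A) = lnorm (eigenrow mu w) M.
Proof.
move=> fM rM; have [d [d1 ->]] := frame_uniq (eigenrow_inj mu_inj (w := w)) fM (frP w A).
by apply: lnorm_scale => //; exact: frame_unit fM.
Qed.

Lemma continuous_psi w A : dense_chart w A -> {for A, continuous (psi w)}.
Proof.
move=> dA; have [U [s [oU UA fU cU]]] := local_frame w A.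
pose V := U `&` dense_chart w.
have oV : open V by exact: openI oU (open_dense_chart w).
apply: (continuous_open_val oV _ (conj UA dA)); apply: continuous_ptwsP => t.
have cV : mcont (fun B : V => s (\val B)).
  move=> i j; move: (cU i j) => c B; have [UB _] := set_valP B.
  have cB : {for (\val B), continuous (fun A => s A i j)} := continuous_open_val oU c UB.
  exact: (continuous_comp (@continuous_val _ V B) cB).
have rV (B : V) : regular (s (\val B)).
  by have [UB dB] := set_valP B; exact: dense_regular (fU _ UB) dB.
have uV (B : V) : s (\val B) \in unitmx.
  by have [UB _] := set_valP B; exact: frame_unit (fU _ UB).
have cL : mcont (fun B : V => lnorm (eigenrow mu w) (s (\val B))) by exact: mcont_lnorm uV rV cV.
rewrite (_ : (fun B : V => _) = fun B : V => if t.2 then complex.Re (lnorm (eigenrow mu w) (s (\val B)) t.1.1 t.1.2)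
  else complex.Im (lnorm (eigenrow mu w) (s (\val B)) t.1.1 t.1.2)).
  by case: t.2; [apply: contRe|apply: contIm]; exact: cL.
apply/funext => B; have [UB _] := set_valP B.
by rewrite /psi (lnorm_frame (fU _ UB) (rV B)).
Qed.

Definition lowmat w (Y : E) : 'M[C]_n := \matrix_(i, j)
  if i == j then eigenrow mu w ord0 i
  else if (j < i)%N && (i <= h j)%N then ((Y (i, j, true))%:C + 'i%C * (Y (i, j, false))%:C) else 0.

Lemma lowmat_lower w Y : lower (lowmat w Y).
Proof.
move=> i j ij; rewrite mxE; case: eqVneq ij => [->|_ ij]; first by rewrite ltnn.
by rewrite ltnNge ltnW.
Qed.

Lemma lowmat_diag w Y i : lowmat w Y i i = eigenrow mu w ord0 i.
Proof. by rewrite mxE eqxx. Qed.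

Lemma lowmat_below_stair w Y : below_stair h (lowmat w Y).
Proof.
move=> i j hij; rewrite mxE [(i <= _)%N]leqNgt hij andbF.
by case: eqVneq hij => // ->; rewrite ltnNge h_ge.
Qed.

Lemma mcont_lowmat w : mcont (lowmat w).
Proof.
apply: mcont_matrix => i j; apply: cont_if; first exact: cont_cst.
apply: cont_if; last exact: cont_cst.
apply: contD; first by apply: contC; exact: continuous_pcoord.
by apply: contM; [exact: cont_cst|apply: contC; exact: continuous_pcoord].
Qed.

Lemma build_Xh w Y : Xh (build (eigenrow mu w) (lowmat w Y)).
Proof.
have [M [uM MA rM ME]] := build_frame (eigenrow_inj mu_inj (w := w)) (@lowmat_lower w Y) (lowmat_diag w Y).
apply/mem_Xh; split.
- exact: (frame_hermitian mu_real (conj uM MA)).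
- apply: (build_below_stair h_mono (conj uM MA) rM).
  by rewrite ME; exact: lowmat_below_stair.
- by move=> c; exact: (frame_eigenvalue c (conj uM MA)).
Qed.

Definition phi w Y : Xh := exist _ (build (eigenrow mu w) (lowmat w Y)) (mem_set (build_Xh w Y)).

Lemma continuous_phi w : continuous (phi w).
Proof.
apply: continuous_comp_initial; rewrite set_valE; apply: continuous_mxP => i j.
by apply: (mcont_build (eigenrow_inj mu_inj (w := w))) => [Y|Y k|]; [exact: lowmat_lower|exact: lowmat_diag|exact: mcont_lowmat].
Qed.

Lemma phi_frame w Y : exists M, [/\ frame (eigenrow mu w) (mat (phi w Y)) M, regular M &
  conj_vmat (eigenrow mu w) M = lowmat w Y].
Proof.
have [M [uM MA rM ME]] := build_frame (eigenrow_inj mu_inj (w := w)) (@lowmat_lower w Y) (lowmat_diag w Y).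
by exists M.
Qed.

Lemma phi_dense w Y : dense_chart w (phi w Y).
Proof. by have [M [fM rM _]] := phi_frame w Y; exact: regular_dense fM rM. Qed.

Lemma psiK w A : dense_chart w A -> phi w (psi w A) = A.
Proof.
move=> dA; apply/val_inj => /=; have fA := frP w A; have [uM MA] := fA; have [_ sA _] := matP A.
rewrite -[RHS](build_lnorm (eigenrow_inj mu_inj (w := w)) uM dA MA); congr (build _ _).
apply/matrixP => i j; rewrite mxE; case: eqVneq => [->|ij]; first by rewrite lnorm_diag.
case: ifPn => [_|]; first by rewrite /psi /= -complexE.
rewrite negb_and -leqNgt -ltnNge leq_eqVlt => /orP[/orP[/eqP/val_inj e|lt]|gt].
- by move: ij; rewrite e eqxx.
- by rewrite lnorm_lower.
- by rewrite (lnorm_below_stair h_mono fA dA sA gt).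
Qed.

(* The real coordinates that vanish on the Bruhat cell of [w]; there are evenly
   many of them, which is why odd cohomology vanishes. *)
Definition cell_coords w : seq T :=
  [seq (p, b) | p <- [seq p : 'I_n * 'I_n <- enum {: 'I_n * 'I_n} |
    [&& (p.2 < p.1)%N, (p.1 <= h p.2)%N & (w p.2 < w p.1)%N]], b <- [:: true; false]].

Lemma mem_cell_coords w i j b : ((i, j, b) \in cell_coords w) =
  [&& (j < i)%N, (i <= h j)%N & (w j < w i)%N].
Proof.
apply/allpairsP/idP => [[[p b'] /= [+ _ [pE _]]]|ijw].
  by rewrite mem_filter -pE => /andP[].
exists ((i, j), b); rewrite mem_filter mem_enum ijw; split=> //.
by case: b.
Qed.

(** The two conditions on [B] leave the order among equal rank sums open. By [cell_order], a point
    of the cell of [w] lies in no other chart of rank sum at least that of [w]; by [outside_cell],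
    any other point of the chart lies in one of larger rank sum. So [B] is the complement of the
    cell. *)
Lemma acyclic_dense_chart (M : zmodType) k w (B : set Xh) : odd k ->
  (forall A, B A -> dense_chart w A /\
     exists w', [/\ w' != w, (rank_sum w <= rank_sum w')%N & dense_chart w' A]) ->
  (forall A w', dense_chart w A -> dense_chart w' A -> (rank_sum w < rank_sum w')%N -> B A) ->
  @acyclic R M Xh k (dense_chart w) B.
Proof.
move=> ok B1 B2.
have fB A : B A -> nonzero_locus (@pcoord R T) (cell_coords w) (psi w A).
  move=> /B1[dA [w' [w'w ww' dA']]]; apply: contrapT => nJ.
  have [_ sA _] := matP A.
  have : in_cell mu w (fr w A).
    move=> i j wji; apply/eqP; rewrite -lnorm_eq0; apply/eqP.
    case: (ltngtP i j) => [ij|ji|/val_inj e]; first by rewrite lnorm_lower.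
      case: (leqP i (h j)) => hij; last exact: (lnorm_below_stair h_mono (frP w A) dA sA hij).
      apply: contrapT => /eqP; rewrite (complexE (lnorm _ _ _ _)) => L0; apply: nJ.
      have [re0|re0] := eqVneq (complex.Re (lnorm (eigenrow mu w) (fr w A) i j)) 0; last first.
        by exists (i, j, true) => //; rewrite mem_cell_coords ji hij.
      exists (i, j, false); first by rewrite mem_cell_coords ji hij.
      by apply: contraNneq L0 => im0; rewrite re0; move: im0; rewrite /pcoord /psi /= => ->; rewrite mulr0 addr0.
    by move: wji; rewrite e ltnn.
  move=> cA; case: (cell_order mu_inj (frP w A) dA cA (frP w' A) dA') => [e|lt].
    by move: w'w; rewrite e eqxx.
  by move: lt; rewrite ltnNge ww'.
have gB Y : nonzero_locus (@pcoord R T) (cell_coords w) Y -> B (phi w Y).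
  move=> [[[i j] b]]; rewrite mem_cell_coords => /and3P[ji hij wij] Y0.
  have [M' [fM rM ME]] := phi_frame w Y.
  have ncell : ~ in_cell mu w M'.
    move=> /(_ i j wij); rewrite ME mxE gt_eqF // ji hij /= => /eqP.
    rewrite eq_complex /= !(mul0r, mul1r, mulr0, addr0, subr0, add0r, oppr0) => /andP[/eqP e1 /eqP e2].
    by move: Y0; rewrite /pcoord; case: b; rewrite ?e1 ?e2 eqxx.
  have [w' [M'' [fM'' rM'' ww']]] := outside_cell mu_inj fM rM ncell.
  by apply: B2 ww'; [exact: phi_dense|exact: regular_dense fM'' rM''].
apply: (@acyclic_retract R M _ _ k _ _ setT (nonzero_locus (@pcoord R T) (cell_coords w)) (psi w) (phi w)).
- by move=> m u; apply: scube_map => // A; exact: continuous_psi.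
- by move=> m u; apply: scube_map fB => A /B1[dA _]; exact: continuous_psi.
- by move=> m u; apply: scube_map => [Y _|Y _]; [exact: continuous_phi|exact: phi_dense].
- by move=> m u; apply: scube_map gB => Y _; exact: continuous_phi.
- by move=> A; exact: psiK.
apply: acyclic_coordinates.
  apply: allpairs_uniq => //; first by rewrite filter_uniq // enum_uniq.
  by move=> [p b] [p' b'].
by rewrite ok size_allpairs /= oddM andbF.
Qed.

Lemma acyclic_Xh (M : zmodType) k : odd k -> @acyclic R M Xh k setT set0.
Proof.
case: k => // k ok.
(* Decreasing rank sums: a Bruhat cell then avoids all charts that precede its own. *)
pose s := sort (fun w w' : {perm 'I_n} => rank_sum w' <= rank_sum w)%N (enum {perm 'I_n}).
have us : uniq s by rewrite sort_uniq enum_uniq.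
have ms w : w \in s by rewrite mem_sort mem_enum.
have ss : sorted (fun w w' : {perm 'I_n} => rank_sum w' <= rank_sum w)%N s.
  by apply: sort_sorted => w w'; exact: leq_total.
pose O j : set Xh := if (j < size s)%N then dense_chart (nth 1%g s j) else set0.
have OU : \bigcup_j O j = setT.
  apply/seteqP; split=> // A _.
  have [w [v [uv _ vG]]] := bruhat (frame_unit (frP 1%g A)).
  exists (index w s) => //; rewrite /O index_mem ms nth_index //.
  have fw : frame (eigenrow mu w) (mat A) (row_perm w (fr 1%g A)).
    by rewrite -[w in eigenrow mu w]mulg1; apply: frame_perm; exact: frP.
  by apply: (regular_dense fw); have [] := regular_vmat (frame_unit fw) uv vG.
rewrite -OU; apply: acyclic_bigcup => j.
  by rewrite /O; case: ifP => _; [exact: open_dense_chart|exact: open0].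
rewrite {1 3}/O; case: ifP => js; last first.
  move=> F nF FB dF; exists (fun=> 0); split=> // u.
  by move=> [_ _ /(_ (fun=> i0))].
apply: acyclic_dense_chart => // A.
  move=> [[i ij]]; rewrite /O (ltn_trans ij js) => Ai Aj; split=> //.
  exists (nth 1%g s i); split=> //; first by rewrite nth_uniq ?(ltn_trans ij js) // neq_ltn ij.
  apply: (sorted_leq_nth _ _ 1%g ss); rewrite ?inE ?(ltn_trans ij js) //; last exact: ltnW.
  by move=> x y z yx zy; exact: leq_trans zy yx.
move=> w' dA dA' lt; split=> //; exists (index w' s); last by rewrite /O index_mem ms nth_index.
rewrite ltnNge; apply/negP => ji; move: lt; rewrite ltnNge => /negP; apply.
rewrite -{1}(nth_index 1%g (ms w')).
apply: (sorted_leq_nth _ _ 1%g ss) => //; rewrite ?inE ?index_mem ?ms //.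
by move=> x y z yx zy; exact: leq_trans zy yx.
Qed.

End StaircaseSpace.

(** * Lifting cubes to the universal bundle *)

Local Open Scope complex_scope.
Local Open Scope quotient_scope.

Section CubeLifting.
Variables (R : realType) (n : nat).
Local Notation C := (cplx R).
Local Notation raw T := ((nat -> itv01 R) -> T).
Local Notation orb := (orbit (ET_action R n)).

Section Pairing.
Variable K : nat.

(** Truncated at [K] so as to be a fixed finite sum of entries, continuous for the coordinatewise
    topology. *)
Definition pairing (z z' : ET R n) (i : 'I_n) : C :=
  \sum_(0 <= l < K) ent z l i * (ent z' l i)^*%R.

Lemma pairing_actr D z z' i : pairing z (ET_act D z') i = (tent D i)^*%R * pairing z z' i.
Proof.
rewrite /pairing mulr_sumr; apply: eq_bigr => l _.
by rewrite ent_act rmorphM mulrCA.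
Qed.

Lemma pairing_actl D z z' i : pairing (ET_act D z) z' i = tent D i * pairing z z' i.
Proof. by rewrite /pairing mulr_sumr; apply: eq_bigr => l _; rewrite ent_act mulrA. Qed.

Definition close (y y' : BT R n) := forall i, pairing (rep y) (rep y') i != 0.

Lemma pairing_orbit z z' : (forall i, pairing z z' i != 0) <-> close (orb z) (orb z').
Proof.
have [D DE] := rep_orbit (ET_action R n) z; have [D' D'E] := rep_orbit (ET_action R n) z'.
have E i : (pairing (rep (orb z)) (rep (orb z')) i != 0) = (pairing z z' i != 0).
  rewrite -DE -D'E pairing_actl pairing_actr !mulf_eq0 conjC_eq0.
  by rewrite !(negbTE (tent_neq0 _ _)).
by split=> H i; have := H i; rewrite E.
Qed.

(** The point over [y] whose pairings with [z] are positive, when they do not vanish; it does not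
    depend on the representative of [y]. *)
Definition transport (z : ET R n) (y : BT R n) : ET R n :=
  ET_act (tor (pairing z (rep y))) (rep y).

Lemma orbit_transport z y : orb (transport z y) = y.
Proof. by rewrite orbit_ET_act orbitK. Qed.

Lemma transport_orbit z z' : (forall i, pairing z z' i != 0) ->
  transport z (orb z') = ET_act (tor (pairing z z')) z'.
Proof.
move=> zz'; rewrite /transport; have [D <-] := rep_orbit (ET_action R n) z'.
apply: entP => l i; rewrite !ent_act !tent_tor pairing_actr phaseM ?conjC_eq0 ?tent_neq0 //.
rewrite (@phase_id _ (tent D i)^*%R) ?norm_conjC ?norm_tent //.
by rewrite mulrACA conj_norm1 ?mul1r // norm_tent.
Qed.

Lemma cont_pairing (W : topologicalType) (f g : W -> ET R n) i :
  (forall l, continuous (fun w => ent (f w) l i)) ->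
  (forall l, continuous (fun w => ent (g w) l i)) ->
  continuous (fun w => pairing (f w) (g w) i).
Proof. by move=> fc gc; apply: cont_sum => l; apply: contM; [exact: fc|exact/contJ/gc]. Qed.

Lemma cont_ent (W : topologicalType) (f : W -> ET R n) l i :
  continuous f -> continuous (fun w => ent (f w) l i).
Proof. by move=> fc w; exact: (continuous_comp (fc w) (@continuous_ent _ _ l i _)). Qed.

Lemma continuous_transport (W : topologicalType) (f : W -> ET R n) (g : W -> BT R n) :
  continuous f -> continuous g -> (forall w i, pairing (f w) (rep (g w)) i != 0) ->
  continuous (fun w => transport (f w) (g w)).
Proof.
move=> fc gc fg w; have /choice[k kw] := ent_neq0 (rep (g w)).
have oU : open (g @^-1` bchart k) by apply: open_comp => [w' _|]; [exact: gc|exact: open_bchart].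
apply: (continuous_open_val oU _ (kw : (g @^-1` bchart k) w)).
have cs : continuous (fun x : g @^-1` bchart k => sec k (g (\val x))).
  move=> x; have gx : bchart k (g (\val x)) := set_valP x.
  exact: (continuous_comp (continuous_comp (@continuous_val _ _ x) (gc _)) (continuous_sec gx)).
have cf : continuous (fun x : g @^-1` bchart k => f (\val x)).
  by move=> x; exact: (continuous_comp (@continuous_val _ _ x) (fc _)).
have p0 (x : g @^-1` bchart k) i : pairing (f (\val x)) (sec k (g (\val x))) i != 0.
  by rewrite pairing_actr mulf_neq0 ?conjC_eq0 ?tent_neq0 //; exact: fg.
rewrite (_ : (fun x => _) = fun x : g @^-1` bchart k =>
  ET_act (tor (pairing (f (\val x)) (sec k (g (\val x))))) (sec k (g (\val x)))); last first.
  by apply/funext => x; rewrite -{1}(orbit_sec k (g (\val x))) transport_orbit.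
apply: continuous_ETP => l i; under [X in continuous X]eq_fun do rewrite ent_act tent_tor.
apply: contM; last exact: cont_ent.
apply: continuous_phase; first by move=> x; exact: p0.
by apply: cont_pairing => l'; exact: cont_ent.
Qed.

Lemma near_close k y : bchart k y -> (forall i, (k i < K)%N) ->
  \forall p \near (y, y), close p.1 p.2.
Proof.
move=> ky kK; pose U : set (BT R n * BT R n) := [set p | bchart k p.1 /\ bchart k p.2].
have oU : open U.
  apply: openI; (apply: open_comp => [p _|]; last exact: open_bchart).
    exact: cvg_fst.
  exact: cvg_snd.
pose g i (p : BT R n * BT R n) : C := pairing (sec k p.1) (sec k p.2) i.
have gc i : {for (y, y), continuous (g i)}.
  apply: (@continuous_open_val _ _ U (g i) oU) => //; apply: cont_pairing => l; apply: cont_ent.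
    move=> x; have [x1 _] := set_valP x.
    exact: (continuous_comp (continuous_comp (@continuous_val _ U x) (@cvg_fst _ _ _ _ _)) (continuous_sec x1)).
  move=> x; have [_ x2] := set_valP x.
  exact: (continuous_comp (continuous_comp (@continuous_val _ U x) (@cvg_snd _ _ _ _ _)) (continuous_sec x2)).
have g0 i : g i (y, y) != 0.
  rewrite /g /=; set z := sec k y.
  have -> : pairing z z i = \sum_(0 <= l < K) `|ent z l i| ^+ 2.
    by apply: eq_bigr => l _; rewrite -normCK.
  apply/eqP; rewrite big_mkord => /psumr_eq0P H.
  have /(_ _ (Ordinal (kK i)) isT) := H _; rewrite /= => H0.
  have : `|ent z (k i) i| ^+ 2 = 0 by apply: H0 => l _; exact: exprn_ge0.
  move/eqP; rewrite sqrf_eq0 normr_eq0 ent_act mulf_eq0 (negbTE (tent_neq0 _ _)) /=.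
  by apply/negP; exact: ky.
have : \forall p \near (y, y), forall i, g i p != 0.
  apply: (@filter_forall _ _ (fun i p => g i p != 0) _ (nbhs_filter (y, y))) => i.
  exact: near_neq0 (gc i) (g0 i).
apply: filterS => -[y1 y2] /= H.
by rewrite -(orbit_sec k y1) -(orbit_sec k y2); apply: (iffLR (pairing_orbit _ _)) => i; exact: H.
Qed.

End Pairing.

Lemma clip_subproof (x : R) : 0 <= Num.min 1 (Num.max 0 x) <= 1.
Proof. by rewrite le_min ler01 le_max lexx ge_min lexx. Qed.

Definition clip (x : R) : itv01 R := exist _ (Num.min 1 (Num.max 0 x)) (clip_subproof x).

(** The cubes sending [a] to [v (r a)] are lifted for growing [r], starting from a constant lift at
    [r = 0]. A step of length 2^-N transports the previous lift, and compactness supplies uniform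
    [K] and [N] for which the pairings do not vanish. *)
Lemma cube_lift p (v : raw (BT R n)) : scube setT p v ->
  exists w : raw (ET R n), scube setT p w /\ forall a, orb (w a) = v a.
Proof.
move=> vT; have [vv cv _] := vT.
have [K K1] : exists K, forall t : cube R p, exists2 k, bchart k (v (seq_of t)) & forall i, (k i < K)%N.
  pose P K (t : cube R p) := exists2 k, bchart k (v (seq_of t)) & forall i, (k i < K)%N.
  have [K _ HK] : \forall K \near \oo, forall t, P K t.
    apply: cube_near_cover => t; have /choice[k kt] := ent_neq0 (rep (v (seq_of t))).
    have nk : \forall t' \near t, bchart k (v (seq_of t')).
      have nb : nbhs (v (seq_of t)) (bchart k) by apply: open_nbhs_nbhs; split; [exact: open_bchart|exact: kt].
      exact: (cv t (bchart k) nb).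
    exists ([set t' | bchart k (v (seq_of t'))], [set K | (\max_i k i < K)%N]) => /=.
      by split; [exact: nk|exists (\max_i k i).+1].
    move=> [t' K] /= [kt' kK]; exists k => // i.
    by apply: leq_ltn_trans kK; exact: leq_bigmax.
  by exists K; exact: HK K (leqnn _).
(* All scalings of [v] form a single cube, with the radius as first coordinate, so one Lebesgue
   number serves for every radius. *)
pose c (t : cube R p.+1) := v (fun j => imul (seq_of t 0%N) (seq_of t j.+1)).
have c_cont : continuous c.
  apply: (@comp_std_cont R _ p p.+1 v (fun a j => imul (a 0%N) (a j.+1)) vv cv) => j jp.
  by apply: contM; exact: continuous_coord.
have cE a : forall r, c (cube_of p.+1 (ins 0 r a)) = v (fun j => imul r (a j)).
  by move=> r; apply: vv => j jp; rewrite !cube_ofK.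
have [N HN] : exists N, forall t t' : cube R p.+1,
    (forall j, `|val (seq_of t j) - val (seq_of t' j)| <= (2 : R) ^- N) -> close K (c t) (c t').
  pose P N (t : cube R p.+1) := forall t' : cube R p.+1,
    (forall j, `|val (seq_of t j) - val (seq_of t' j)| <= (2 : R) ^- N) -> close K (c t) (c t').
  suff [N _ H] : \forall N \near \oo, forall t, P N t by exists N; exact: (H N (leqnn _)).
  apply: cube_near_cover => t.
  have [k kt kK] : exists2 k, bchart k (c t) & forall i, (k i < K)%N.
    have [k kt kK] := K1 (cube_of p (fun j => imul (seq_of t 0%N) (seq_of t j.+1))).
    by exists k => //; rewrite /c (vv _ (seq_of (cube_of p (fun j => imul (seq_of t 0%N) (seq_of t j.+1))))) // => j jp; rewrite cube_ofK.
  have [[A1 A2] /= [nA1 nA2] A12] := near_close kt kK.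
  have nA : nbhs t [set t' | A1 (c t') /\ A2 (c t')].
    by apply: filterI; exact: c_cont.
  have nA' : \forall t' \near t & N \near \oo, [set t' | A1 (c t') /\ A2 (c t')] t'.
    by exists ([set t' | A1 (c t') /\ A2 (c t')], setT) => /=; [split=> //; exact: filterT|move=> [t' N] []].
  apply: filterS2 nA' (small_std_near nA) => -[t' N] /= [A1t' _] H t'' tt''.
  have [_ A2t''] := H t'' tt''.
  exact: (A12 (c t', c t'')).
suff H j : forall r : itv01 R, val r <= j%:R * (2 : R) ^- N ->
    exists w : raw (ET R n), scube setT p w /\ forall a, orb (w a) = v (fun j => imul r (a j)).
  have [|w [wT wE]] := H (2 ^ N)%N i1; first by rewrite natrX mulfV // expf_neq0 // pnatr_eq0.
  exists w; split=> // a; rewrite wE; congr v.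
  by apply/funext => j; rewrite imul1.
elim: j => [|j IH] r rj.
  exists (fun=> rep (v (fun=> i0))); split; first exact: scube_cst.
  move=> a; rewrite orbitK; congr v; apply/funext => j.
  have -> : r = i0 by apply: val_inj; apply: le_anti => /=; case/andP: (valP r) => r0 _; move: rj; rewrite mul0r r0 andbT.
  by rewrite imul0.
have /andP[r0 r1] := valP r; have e0 : 0 <= (2 : R) ^- N by rewrite invr_ge0 exprn_ge0.
pose r' := clip (val r - 2 ^- N).
have r'E : val r' = Num.max 0 (val r - 2 ^- N).
  by rewrite /r' /=; apply: min_r; rewrite ge_max ler01 lerBlDr (le_trans r1) // lerDl.
have r'j : val r' <= j%:R * 2 ^- N.
  by rewrite r'E ge_max mulr_ge0 //= lerBlDr; move: rj; rewrite -[in X in X -> _]natr1 mulrDl mul1r.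
have rr' : `|val r' - val r| <= 2 ^- N.
  rewrite r'E; move: r0 e0; move: (val r) (2 ^- N) => x e x0 e0.
  by case: (leP 0 (x - e)) => H; rewrite ler_norml; apply/andP; split; lra.
have [w [[vw cw _] wE]] := IH r' r'j.
have vr : valid p (fun a => v (fun j => imul r (a j))).
  by move=> a b ab; apply: vv => l lp; rewrite ab.
exists (fun a => transport K (w a) (v (fun j => imul r (a j)))); split; last first.
  by move=> a; rewrite orbit_transport.
have cl a i : pairing K (w a) (rep (v (fun j => imul r (a j)))) i != 0.
  move: i; apply: (iffRL (pairing_orbit K _ _)); rewrite orbitK wE -!cE.
  apply: HN => l; case: (ltnP l p.+1) => lp; last by rewrite !seq_of_ge // subrr normr0.
  rewrite !cube_ofK //; case: l lp => [//|l] lp; by rewrite /ins /= subrr normr0.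
split=> //; first by move=> a b ab; rewrite (vw _ _ ab) (vr _ _ ab).
apply: continuous_transport => //.
apply: (@comp_std_cont R _ p p v (fun a j => imul r (a j)) vv cv) => j' j'p.
by apply: contM; [exact: cont_cst|exact: continuous_coord].
Qed.

End CubeLifting.

(** * Cubes in the Borel construction *)

Local Open Scope complex_scope.
Local Open Scope quotient_scope.

Section FiberCoordinates.
Variable R : realType.
Local Notation I := (itv01 R).
Local Notation seqI := (nat -> I).

Definition tl (p : nat) (a : seqI) : seqI := fun j => a (p + j)%N.
Definition pad (p : nat) (b : seqI) : seqI := fun j => if (j < p)%N then i0 else b (j - p)%N.
(** Coordinate [p] is a deformation parameter: at 1 nothing changes, at 0 the base coordinates
    collapse to the corner. *)
Definition sc (p : nat) (a : seqI) : seqI := fun j => if (j < p)%N then imul (a p) (a j) else a j.+1.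

Lemma tl_pad p b : tl p (pad p b) = b.
Proof. by apply/funext => j; rewrite /tl /pad ltnNge leq_addr /= addKn. Qed.

Lemma tl_ins p j e a : tl p (ins (p + j) e a) = ins j e (tl p a).
Proof.
apply/funext => l; rewrite /tl /ins ltn_add2l eqn_add2l; case: ltngtP => // jl.
by congr a; lia.
Qed.

Lemma pad_ins p j e b : pad p (ins j e b) = ins (p + j) e (pad p b).
Proof.
apply/funext => l; rewrite /pad /ins; case: (ltnP l p) => lp.
  by rewrite ltn_addr.
have -> : (l < p + j)%N = (l - p < j)%N by lia.
have -> : (l == p + j)%N = (l - p == j)%N by lia.
case: ltngtP => // jl; have -> : (l.-1 < p)%N = false by lia.
by congr b; lia.
Qed.

Lemma sc_ins1 p a : sc p (ins p i1 a) = a.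
Proof.
apply/funext => j; rewrite /sc /ins ltnn eqxx; case: (ltnP j p) => jp.
  by rewrite imul1.
have -> : (j.+1 < p)%N = false by lia.
by have -> : (j.+1 == p) = false by lia.
Qed.

Lemma sc_ins0 p a : sc p (ins p i0 a) = pad p (tl p a).
Proof.
apply/funext => j; rewrite /sc /ins ltnn eqxx /pad /tl; case: (ltnP j p) => jp.
  by rewrite imul0.
have -> : (j.+1 < p)%N = false by lia.
have -> : (j.+1 == p) = false by lia.
by congr a; lia.
Qed.

Lemma sc_ins_gt p j e a : sc p (ins (p.+1 + j) e a) = ins (p + j) e (sc p a).
Proof.
apply/funext => l; rewrite /sc /ins addSn ltnS leq_addr; case: (ltnP l p) => lp.
  by rewrite (ltn_addr _ lp) ltnS (leq_trans (ltnW lp)) ?leq_addr.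
rewrite ltnS eqSS; case: ltngtP => // jl; have -> : (l.-1 < p)%N = false by lia.
by congr a; lia.
Qed.

Lemma valid_ins_ge (T : Type) p j e (u : seqI -> T) : valid p u -> u \o ins (p + j) e = u.
Proof.
move=> vu; apply/funext => a; apply: vu => l lp; rewrite /ins.
by rewrite (leq_trans lp) ?leq_addr.
Qed.

End FiberCoordinates.

Section BorelCubes.
Variables (R : realType) (n : nat) (X : topologicalType) (a : torus_action R n X).
Local Notation raw T := ((nat -> itv01 R) -> T).
Local Notation orb := (orbit (ET_action R n)).
Local Notation orbY := (orbit (diag_action a)).
Local Notation prj := (@borel_proj R n X a).

Lemma borel_orbit D x z : orbY (a D x, ET_act D z) = orbY (x, z).
Proof. by apply/esym; apply: (iffRL (orbitP (diag_action a) (x, z) _)); exists D. Qed.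

(* The [x] such that [y] is the orbit of [(x, z)]; junk unless [y] lies over the
   orbit of [z]. *)
Definition kap (z : ET R n) (y : borel a) : X :=
  if pselect (exists D, ET_act D (rep y).2 = z) is left e then a (projT1 (cid e)) (rep y).1
  else (rep y).1.

Lemma kapP z y : prj y = orb z -> orbY (kap z y, z) = y.
Proof.
move=> yz; rewrite /kap; case: pselect => [e|[]]; last by apply: (iffLR (orbitP _ _ _)) yz.
case: cid => D /= DE; rewrite -[z in orbY (_, z)]DE borel_orbit.
by rewrite -[RHS]orbitK; case: (rep y).
Qed.

Lemma ET_free D z : ET_act D z = z -> D = torus1 R n.
Proof.
move=> Dz; apply: torP => i; rewrite tent1; have [l l0] := ent_neq0 z i.
by apply: (mulIf l0); rewrite -ent_act Dz mul1r.
Qed.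

Lemma kap_orbit z x : kap z (orbY (x, z)) = x.
Proof.
have := kapP (borel_projE a x z); move: (kap _ _) => x' /orbitP[D [Dx]].
by move/ET_free => D1; move: Dx; rewrite D1 act1.
Qed.

Section Chart.
Variable k : 'I_n -> nat.

(** The first component once the second is normalized in the chart [k]. It does not depend on the
    representative and differs from [kap] by an explicit torus element, which is how [kap], defined
    by choice, is seen to be continuous. *)
Definition theta (y : borel a) : X := a (tor (fun i => (ent (rep y).2 (k i) i)^*%R)) (rep y).1.

Lemma theta_orbit x z : chart k z -> theta (orbY (x, z)) = a (tor (fun i => (ent z (k i) i)^*%R)) x.
Proof.
move=> cz; rewrite /theta; have [D <-] := rep_orbit (diag_action a) (x, z).
rewrite -actM; congr (a _ x); apply: torP => i; rewrite tentM !tent_tor ent_act rmorphM.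
rewrite phaseM ?conjC_eq0 ?tent_neq0 //.
rewrite (@phase_id _ (tent D i)^*%R) ?norm_conjC ?norm_tent //.
by rewrite mulrAC conj_norm1 ?mul1r // norm_tent.
Qed.

Lemma phase_conj (C : numClosedFieldType) (x : C) : phase x^*%R = (phase x)^*%R.
Proof.
rewrite /phase conjC_eq0 norm_conjC; case: eqVneq => _; first by rewrite conjC1.
by rewrite rmorphM fmorphV /= (conj_Creal (normr_real _)).
Qed.

Lemma kap_theta z y : chart k z -> prj y = orb z -> kap z y = a (tor (fun i => ent z (k i) i)) (theta y).
Proof.
move=> cz yz; rewrite -{2}(kapP yz) theta_orbit // -actM -[LHS](act1 a); congr (a _ _).
apply: torP => i; rewrite tentM !tent_tor tent1 phase_conj mulrC conj_norm1 //.
exact: norm_phase.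
Qed.

Lemma continuous_theta y : bchart k (prj y) -> {for y, continuous theta}.
Proof.
move=> cy; pose U : set (X * ET R n) := [set q | chart k q.2].
have oU : open U by apply: open_comp => [q _|]; [exact: cvg_snd|exact: open_chart].
rewrite -(orbitK y); case E: (rep y) => [x z].
have cz : chart k z by move: cy; rewrite -{1}(orbitK y) E borel_projE => /bchart_orbit.
apply: (continuous_orbit_at oU) => // [D [x' z'] /=|]; first exact: chart_act.
apply: continuous_open_val => //.
rewrite (_ : (fun q => _) = fun q : U => a (tor (fun i => (ent (\val q).2 (k i) i)^*%R)) (\val q).1).
  have c2 : continuous (fun q : U => (\val q).2).
    by move=> q; exact: (continuous_comp (@continuous_val _ U q) (@cvg_snd _ _ _ _ _)).
  have c1 : continuous (fun q : U => (tor (fun i => (ent (\val q).2 (k i) i)^*%R), (\val q).1)).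
    apply: continuous_pair; last first.
      by move=> q; exact: (continuous_comp (@continuous_val _ U q) (@cvg_fst _ _ _ _ _)).
    apply: continuous_torusP => i; under [X in continuous X]eq_fun do rewrite tent_tor.
    apply: continuous_phase; first by move=> q; rewrite conjC_eq0; exact: (set_valP q i).
    by apply: contJ => q; exact: (continuous_comp (c2 q) (@continuous_ent _ _ _ i _)).
  by move=> q; exact: (continuous_comp (c1 q) (@act_continuous _ _ _ a _)).
apply/funext => q /=; case: q => -[x' z'] /= Hq; apply: theta_orbit.
exact: (set_mem Hq).
Qed.

End Chart.

Lemma cont_kap (W : topologicalType) (f : W -> ET R n) (u : W -> borel a) :
  continuous f -> continuous u -> (forall w, prj (u w) = orb (f w)) ->
  continuous (fun w => kap (f w) (u w)).
Proof.
move=> fc uc fu w; have /choice[k kw] := ent_neq0 (f w).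
pose U : set W := [set w' | chart k (f w')].
have oU : open U by apply: open_comp => [w' _|]; [exact: fc|exact: open_chart].
apply: (continuous_open_val oU _ (kw : U w)).
rewrite (_ : (fun x => _) = fun x : U => a (tor (fun i => ent (f (\val x)) (k i) i)) (theta k (u (\val x)))).
  have c1 : continuous (fun x : U => (tor (fun i => ent (f (\val x)) (k i) i), theta k (u (\val x)))).
    apply: continuous_pair.
      apply: continuous_torusP => i; under [X in continuous X]eq_fun do rewrite tent_tor.
      apply: continuous_phase; first by move=> x; exact: (set_valP x i).
      move=> x; exact: (continuous_comp (continuous_comp (@continuous_val _ U x) (fc _)) (@continuous_ent _ _ _ i _)).
    move=> x; apply: (continuous_comp (continuous_comp (@continuous_val _ U x) (uc _))).
    by apply: continuous_theta; rewrite fu; apply/bchart_orbit; exact: set_valP x.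
  by move=> x; exact: (continuous_comp (c1 x) (@act_continuous _ _ _ a _)).
apply/funext => x; apply: kap_theta; last exact: fu.
exact: set_valP x.
Qed.

Lemma continuous_prj : continuous prj.
Proof.
move=> y; rewrite -(orbitK y).
apply: (@continuous_orbit_at _ _ _ _ _ _ setT) => //; first exact: openT.
move=> q _; rewrite (_ : _ \o _ = orb \o snd).
  exact: (continuous_comp (@cvg_snd _ _ _ _ _) (@continuous_orbit _ _ _ (ET_action R n) _)).
by apply/funext => -[x z] /=; exact: borel_projE.
Qed.

Variable p : nat.

Definition join (x : raw X) (w : raw (ET R n)) : raw (borel a) := fun s => orbY (x (tl p s), w s).

Definition fib (w : raw (ET R n)) (u : raw (borel a)) : raw X :=
  fun b => kap (w (fun=> i0)) (u (pad p b)).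

(* With [s], [tau] and [t] the first [p], the next one and the remaining
   coordinates, and [u (s, t)] the orbit of [(x (s, t), w s)], this is the orbit of
   [(x (tau s, t), w s)]: it deforms [u], over a fixed base cube, to a product. *)
Definition hmt (w : raw (ET R n)) (u : raw (borel a)) : raw (borel a) :=
  fun s => orbY (kap (w (sc p s)) (u (sc p s)), w s).

Section Identities.
Variable w : raw (ET R n).
Hypothesis vw : valid p w.

Lemma w_pad b : w (pad p b) = w (fun=> i0).
Proof. by apply: vw => j jp; rewrite /pad jp. Qed.

Lemma join_ins x j e : join x w \o ins (p + j) e = join (x \o ins j e) w.
Proof.
apply/funext => s; rewrite /join /= tl_ins; congr (orbY (_, _)).
exact: (congr1 (fun f => f s) (valid_ins_ge j e vw)).
Qed.

Lemma fib_ins u j e : fib w (u \o ins (p + j) e) = fib w u \o ins j e.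
Proof. by apply/funext => b; rewrite /fib /= pad_ins. Qed.

Lemma hmt_ins u j e : hmt w u \o ins (p.+1 + j) e = hmt w (u \o ins (p + j) e).
Proof.
apply/funext => s; rewrite /hmt /= sc_ins_gt; congr (orbY (kap _ _, _)).
  exact: (congr1 (fun f => f (sc p s)) (valid_ins_ge j e vw)).
by rewrite addSnnS; exact: (congr1 (fun f => f s) (valid_ins_ge j.+1 e vw)).
Qed.

Lemma hmt_ins0 u : hmt w u \o ins p i0 = join (fib w u) w.
Proof.
apply/funext => s; rewrite /hmt /join /fib /= sc_ins0 w_pad; congr (orbY (_, _)).
by have := congr1 (fun f => f s) (valid_ins_ge 0 i0 vw); rewrite /= addn0.
Qed.

Lemma hmt_ins1 u : (forall s, prj (u s) = orb (w s)) -> hmt w u \o ins p i1 = u.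
Proof.
move=> uw; apply/funext => s; rewrite /hmt /= sc_ins1.
have -> : w (ins p i1 s) = w s.
  by have := congr1 (fun f => f s) (valid_ins_ge 0 i1 vw); rewrite /= addn0.
exact: kapP.
Qed.

Lemma prj_join x s : prj (join x w s) = orb (w s).
Proof. exact: borel_projE. Qed.

Lemma prj_hmt u s : prj (hmt w u s) = orb (w s).
Proof. exact: borel_projE. Qed.

Lemma fib_join D x w' : valid p w' -> ET_act D (w' (fun=> i0)) = w (fun=> i0) ->
  fib w (join x w') = a D \o x.
Proof.
move=> vw' DE; apply/funext => b; rewrite /fib /join /= tl_pad.
have -> : w' (pad p b) = w' (fun=> i0) by apply: vw' => j jp; rewrite /pad jp.
by rewrite -DE -(borel_orbit D) kap_orbit.
Qed.

End Identities.

Lemma valid_join q x w : valid p w -> valid q x -> valid (p + q) (join x w).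
Proof.
move=> vw vx s s' ss; rewrite /join (vw s s') => [|j jp]; last by apply: ss; rewrite ltn_addr.
by rewrite (vx (tl p s) (tl p s')) // => j jq; apply: ss; rewrite ltn_add2l.
Qed.

Lemma valid_fib q u w : valid (p + q) u -> valid q (fib w u).
Proof.
move=> vu s s' ss; rewrite /fib (vu (pad p s) (pad p s')) // => j jq.
by rewrite /pad; case: ltnP => // pj; apply: ss; lia.
Qed.

Lemma valid_hmt q u w : valid p w -> valid (p + q) u -> valid (p + q).+1 (hmt w u).
Proof.
move=> vw vu s s' ss.
have scE j : (j < p + q)%N -> sc p s j = sc p s' j.
  by move=> jq; rewrite /sc; case: ltnP => jp; rewrite ?ss //; lia.
rewrite /hmt (vu _ _ scE) (vw (sc p s) (sc p s')) => [|j jp]; last by apply: scE; lia.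
by rewrite (vw s s') // => j jp; apply: ss; lia.
Qed.

Lemma scube_join q x w : scube setT p w -> scube setT q x -> scube setT (p + q) (join x w).
Proof.
move=> [vw cw _] [vx cx _]; split=> //; first exact: valid_join.
have c1 : continuous (fun t : cube R (p + q) => (x (tl p (seq_of t)), w (seq_of t))).
  apply: continuous_pair.
    by apply: (comp_std_cont (s := tl p) vx cx) => j _; exact: continuous_coord.
  by apply: (comp_std_cont (s := id) vw cw) => j _; exact: continuous_coord.
by move=> t; exact: (continuous_comp (c1 t) (@continuous_orbit _ _ _ (diag_action a) _)).
Qed.

Lemma scube_fib q u w : scube setT p w -> scube setT (p + q) u ->
  (forall s, prj (u s) = orb (w s)) -> scube setT q (fib w u).
Proof.
move=> [vw cw _] [vu cu _] uw; split=> //; first exact: valid_fib.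
apply: cont_kap => [| |t]; first exact: cst_continuous.
  apply: (comp_std_cont (s := pad p) vu cu) => j _; rewrite /pad; case: ltnP => jp.
    exact: cont_cst.
  exact: continuous_coord.
by rewrite uw; congr orb; exact: w_pad.
Qed.

Lemma scube_hmt q u w : scube setT p w -> scube setT (p + q) u ->
  (forall s, prj (u s) = orb (w s)) -> scube setT (p + q).+1 (hmt w u).
Proof.
move=> [vw cw _] [vu cu _] uw; split=> //; first exact: valid_hmt.
have csc j : continuous (fun t : cube R (p + q).+1 => val (sc p (seq_of t) j) : R).
  rewrite /sc; case: ltnP => jp; last exact: continuous_coord.
  by apply: contM; exact: continuous_coord.
have c1 : continuous (fun t : cube R (p + q).+1 =>
    (kap (w (sc p (seq_of t))) (u (sc p (seq_of t))), w (seq_of t))).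
  apply: continuous_pair.
    apply: cont_kap => [| |t]; last exact: uw.
      exact: (comp_std_cont (s := sc p) vw cw).
    exact: (comp_std_cont (s := sc p) vu cu).
  by apply: (comp_std_cont (s := id) vw cw) => j _; exact: continuous_coord.
by move=> t; exact: (continuous_comp (c1 t) (@continuous_orbit _ _ _ (diag_action a) _)).
Qed.

End BorelCubes.

(** * The torus acts trivially on cohomology *)

Local Open Scope complex_scope.

Section Bounding.
Variables (R : realType) (M : zmodType) (X : topologicalType).
Local Notation raw T := ((nat -> itv01 R) -> T).
Implicit Types F : raw X -> M.

Definition bounds q F := if q is q'.+1
  then exists G : raw X -> M, nrm q' G /\ forall x, scube setT q x -> cob q' G x = F x
  else forall x, scube setT 0 x -> F x = 0.

Lemma cob_0 (T : Type) k (u : raw T) : cob k (fun _ : raw T => 0 : M) u = 0.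
Proof. by apply: cob_eq0. Qed.

Lemma eq_bounds q F F' : (forall x, scube setT q x -> F x = F' x) -> bounds q F -> bounds q F'.
Proof.
case: q => [|q] FF /=; first by move=> F0 x sx; rewrite -FF // F0.
by move=> [G [nG dG]]; exists G; split=> // x sx; rewrite dG // FF.
Qed.

Lemma bounds_zero q F : (forall x, scube setT q x -> F x = 0) -> bounds q F.
Proof.
move=> F0; apply: (@eq_bounds q (fun=> 0)) => [x sx|]; first by rewrite F0.
by case: q {F0} => [//|q]; exists (fun=> 0); split=> // x _; exact: cob_0.
Qed.

Lemma boundsD q F F' : bounds q F -> bounds q F' -> bounds q (F \+ F').
Proof.
case: q => [|q] /=; first by move=> F0 F0' x sx; rewrite F0 // F0' // addr0.
move=> [G [nG dG]] [G' [nG' dG']]; exists (G \+ G'); split; first exact: nrmD.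
by move=> x sx; rewrite cobD dG // dG'.
Qed.

Lemma boundsB q F F' : bounds q F -> bounds q F' -> bounds q (F \- F').
Proof.
case: q => [|q] /=; first by move=> F0 F0' x sx; rewrite F0 // F0' // subr0.
move=> [G [nG dG]] [G' [nG' dG']]; exists (G \- G'); split; first exact: nrmB.
by move=> x sx; rewrite cobB dG // dG'.
Qed.

Lemma acyclic_bounds q F : @acyclic R M X q setT set0 -> nrm q F ->
  (forall x, scube setT q.+1 x -> cob q F x = 0) -> bounds q F.
Proof.
move=> aX nF dF; have F0 u : scube set0 q u -> F u = 0 by move=> [_ _ /(_ (fun=> i0))].
have := aX F nF F0 dF; case: q {aX F0 dF nF} => [//|q] [G [nG _ dG]].
by exists G.
Qed.

End Bounding.

Section TorusHomotopy.
Variables (R : realType) (n : nat) (X : topologicalType) (a : torus_action R n X).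
Local Notation C := (cplx R).
Local Notation raw T := ((nat -> itv01 R) -> T).

(** The segment from 1 to [r] misses 0 because [r] is not -1, and its square joins 1 to [d]. If the
    chosen root is -1, then [d = 1] and [r = 1] works. *)
Lemma root_neqN1 (C' : numClosedFieldType) (d : C') : `|d| = 1 ->
  exists r : C', [/\ r ^+ 2 = d, `|r| = 1 & r != -1].
Proof.
move=> d1; have r2 : sqrtC d ^+ 2 = d by exact: sqrtCK.
have n1 : `|sqrtC d| = 1.
  by apply/eqP; rewrite -(@eqrXn2 _ 2) ?normr_ge0 ?ler01 // -normrX r2 expr1n d1.
have [r1|r1] := eqVneq (sqrtC d) (-1); last by exists (sqrtC d).
exists 1; rewrite normr1 expr1n -r2 r1 sqrrN expr1n; split=> //.
by rewrite -subr_eq0 opprK -(natrD _ 1 1) pnatr_eq0.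
Qed.

Lemma segment_neq0 (r : C) (s : R) : 0 <= s <= 1 -> `|r| = 1 -> r != -1 ->
  (1 - s%:C) + s%:C * r != 0.
Proof.
move=> /andP[s0 s1] r1 rN1; apply/eqP => E.
have E1 : s%:C * r = (s - 1)%:C by apply/eqP; rewrite rmorphB rmorph1 -subr_eq0 opprB addrC E.
have : `|s%:C * r| = `|(s - 1)%:C : C| by rewrite E1.
rewrite normrM r1 mulr1 !normc_def /= !expr0n !addr0 !sqrtr_sqr.
rewrite ger0_norm // ler0_norm ?subr_le0 // => /complexI ss.
have s2 : s = 2^-1 by lra.
move/eqP: rN1; apply; apply: (@mulfI _ (s%:C)); last first.
  by rewrite E1 s2 mulrN1 -rmorphN; congr (_%:C); lra.
by rewrite -(rmorph0 (real_complex R)) (inj_eq (@complexI R)) s2 invr_eq0 pnatr_eq0.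
Qed.

Lemma torus_path (D : torus R n) : exists d : itv01 R -> torus R n, [/\ d i0 = torus1 R n, d i1 = D &
  forall (W : topologicalType) (f : W -> itv01 R), continuous (fun x => val (f x) : R) ->
    continuous (fun x => d (f x))].
Proof.
have /choice[r rP] : forall i, exists r : C, [/\ r ^+ 2 = tent D i, `|r| = 1 & r != -1].
  by move=> i; exact: root_neqN1 (norm_tent D i).
pose g (s : itv01 R) i : C := ((1 - (val s)%:C) + (val s)%:C * r i) ^+ 2.
exists (fun s => tor (g s)); split.
- by apply: torP => i; rewrite tent_tor /g /= subr0 mul0r addr0 expr1n tent1 phase_id ?normr1.
- apply: torP => i; have [r2 r1 _] := rP i.
  by rewrite tent_tor /g /= subrr add0r mul1r r2 phase_id // norm_tent.
- move=> W f fc; apply: continuous_torusP => i; under [X in continuous X]eq_fun do rewrite tent_tor.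
  apply: continuous_phase => [x|].
    by rewrite expf_eq0 /=; have [_ r1 rN1] := rP i; apply: (segment_neq0 (valP (f x)) r1 rN1).
  apply: contM; (apply: contD; [apply: contB; [exact: cont_cst|exact: contC]|apply: contM; [exact: contC|exact: cont_cst]]).
Qed.

(** Connectedness: a path from 1 to [D] gives a homotopy, whose prism operator is the primitive. *)
Lemma torus_trivial (M : zmodType) D q (F : raw X -> M) : nrm q F ->
  (forall x, scube setT q.+1 x -> cob q F x = 0) ->
  bounds q (fun x => F (a D \o x) - F x).
Proof.
move=> nF dF; have [d [d0 d1 dc]] := torus_path D.
pose H s x := a (d s) x.
have hcT m x : scube setT m x -> scube setT m.+1 (homotopy_cube H x).
  move=> sx; apply: (homotopy_cube_scube sx) => //.
  have [_ cx _] := scube_shift sx.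
  have c1 : continuous (fun t : cube R m.+1 => (d (seq_of t 0%N), x (shift (seq_of t)))).
    by apply: continuous_pair => //; apply: dc; exact: continuous_coord.
  by move=> t; exact: (continuous_comp (c1 t) (@act_continuous _ _ _ a _)).
have h1 x : homotopy_cube H x \o ins 0 i1 = a D \o x.
  by apply/funext => s; rewrite /homotopy_cube /= ins0 ins_shift /H d1.
have h0 x : homotopy_cube H x \o ins 0 i0 = x.
  by apply/funext => s; rewrite /homotopy_cube /= ins0 ins_shift /H d0 act1.
case: q nF dF => [|q] nF dF.
  by move=> x /hcT/dF; rewrite cob0 h1 h0.
exists (F \o homotopy_cube H); split; first exact: nrm_homotopy.
move=> x /hcT/dF; rewrite (cob_cone _ _ (fun i e => homotopy_cube_ins H x i e)) h1 h0.
by move=> /eqP; rewrite subr_eq0 eq_sym => /eqP.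
Qed.

End TorusHomotopy.

(** * Reduction along the filtration *)

Local Open Scope complex_scope.
Local Open Scope quotient_scope.

Section FiberSums.
Variables (R : realType) (M : zmodType) (T : Type).
Local Notation raw T := ((nat -> itv01 R) -> T).

(** The coboundary along the [q] fiber directions, with signs counted from the first of them; hence
    the factor (-1)^p in [cob_split]. *)
Definition fsum q p (F : raw T -> M) (u : raw T) : M :=
  \sum_(0 <= j < q) fdiff F u (p + j) *~ (-1) ^+ j.+1.

Lemma sign_mulz (m : M) p : m *~ (-1) ^+ p *~ (-1) ^+ p = m.
Proof. by rewrite -mulrzA -exprD addnn -signr_odd odd_double. Qed.

Lemma cob_split p q (F : raw T -> M) u : cob (p + q) F u =
  \sum_(0 <= i < p) fdiff F u i *~ (-1) ^+ i.+1 + fsum q.+1 p F u *~ (-1) ^+ p.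
Proof.
have pk : (p <= (p + q).+1)%N by lia.
rewrite /cob (big_cat_nat (leq0n p) pk) /=; congr (_ + _).
rewrite -{1}[p]add0n big_addn /fsum mulrz_suml -addnS addKn; apply: eq_bigr => j _.
by rewrite -mulrzA -exprD addSn [(p + j)%N]addnC.
Qed.

Lemma cob_fiber p q (F : raw T -> M) u :
  (forall i (b : bool), (i < p)%N -> F (u \o ins i (if b then i1 else i0)) = 0) ->
  cob (p + q) F u = fsum q.+1 p F u *~ (-1) ^+ p.
Proof.
move=> F0; rewrite cob_split big_nat big1 ?add0r // => i /= ip.
by rewrite /fdiff (F0 i false ip) (F0 i true ip) subr0 mul0rz.
Qed.

End FiberSums.

Section SerreFiltration.
Variables (R : realType) (n : nat) (X : topologicalType) (a : torus_action R n X) (M : zmodType).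
Local Notation raw T := ((nat -> itv01 R) -> T).
Local Notation orb := (orbit (ET_action R n)).
Local Notation prj := (@borel_proj R n X a).
Local Notation Y := (borel a).
Implicit Types (y f g : raw Y -> M) (u : raw Y) (v : raw (BT R n)).

Definition fil p k f := nrm k f /\
  forall u, (0 < p)%N -> scube setT k u -> valid p.-1 (prj \o u) -> f u = 0.

(** That is, the coboundary of [f] has filtration at least [p.+1]. *)
Definition dvanish p k f := forall u, scube setT k.+1 u -> valid p (prj \o u) -> cob k f u = 0.

Lemma valid_ins_weak (T : Type) m (v : raw T) i e : valid m v -> valid m (v \o ins i e).
Proof.
move=> vv; case: (ltnP i m) => im; last first.
  by rewrite -(subnKC im) valid_ins_ge.
case: m im vv => // m im vv; apply: (valid_le (leqnSn m)); exact: valid_ins.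
Qed.

Lemma scube_prj p k u : scube setT k u -> valid p (prj \o u) -> scube setT p (prj \o u).
Proof.
move=> [vu cu _] vpu; split=> //.
apply: (comp_std_cont (k := k) (s := id)) => [| |j _]; last exact: continuous_coord.
  by move=> s s' ss /=; rewrite (vu s s').
by move=> t; exact: (continuous_comp (cu t) (@continuous_prj _ _ _ a _)).
Qed.

Lemma fil_cob p k f : fil p k f -> fil p k.+1 (cob k f).
Proof.
move=> [nf f0]; split; first exact: nrm_cob.
move=> u p0 su vu; apply: cob_eq0 => i e ik; apply: f0 => //; first exact: scube_ins.
exact: (@valid_ins_weak _ _ (prj \o u)).
Qed.

Lemma fil_weak p k f : fil p.+1 k f -> fil p k f.
Proof.
move=> [nf f0]; split=> // u p0 su vu; apply: f0 => //=.
exact: valid_le (leq_pred p) vu.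
Qed.

Lemma fil_face p k f u i e : fil p k f -> scube setT k.+1 u -> valid p (prj \o u) ->
  (i < p)%N -> (i <= k)%N -> f (u \o ins i e) = 0.
Proof.
move=> [_ f0] su vu ip ik; apply: f0; first exact: leq_ltn_trans ip; first exact: scube_ins.
by case: p ip vu => // p ip vu; exact: (@valid_ins _ _ _ _ _ (prj \o u)).
Qed.

(** Evaluate the vanishing coboundary on [hmt p w u]. Faces in base directions vanish because of the
    filtration, direction [p] gives the two terms on the left, and the later directions give the
    right side. *)
Lemma fiber_homotopy p q y u w : fil p (p + q) y -> dvanish p (p + q) y ->
  scube setT (p + q) u -> scube setT p w -> (forall s, prj (u s) = orb (w s)) ->
  y u - y (join a p (fib p w u) w) = fsum q p (y \o hmt p w) u.
Proof.
move=> fy dy su sw uw; have [vw _ _] := sw.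
have sh := scube_hmt sw su uw.
have vh : valid p (prj \o hmt p w u).
  by move=> s s' ss /=; rewrite !prj_hmt (vw s s').
have := dy _ sh vh; rewrite cob_fiber; last first.
  by move=> i b ip; apply: (fil_face _ fy sh vh ip); lia.
move=> /(congr1 (fun m => m *~ (-1) ^+ p)); rewrite sign_mulz mul0rz /fsum big_nat_recl //.
rewrite addn0 /fdiff hmt_ins0 // hmt_ins1 // expr1 mulrN1z opprB => E.
apply/eqP; rewrite -subr_eq0 -[X in _ == X]E; apply/eqP; congr (_ + _).
rewrite -sumrN; apply: eq_bigr => j _; rewrite addnS -addSn !hmt_ins //=.
by rewrite [in RHS]exprS mulN1r mulrNz.
Qed.

Definition lft p v : raw (ET R n) :=
  if pselect (scube setT p v) is left e then projT1 (cid (cube_lift e)) else fun=> rep (v (fun=> i0)).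

Lemma lftP p v : scube setT p v -> scube setT p (lft p v) /\ forall s, orb (lft p v s) = v s.
Proof. by move=> sv; rewrite /lft; case: pselect => [e|//]; case: cid. Qed.

Definition generic p v := scube setT p v /\ ~ ((0 < p)%N /\ valid p.-1 v).

Lemma prj_ins_ge p u j e : valid p (prj \o u) -> prj \o (u \o ins (p + j) e) = prj \o u.
Proof. by move=> vu; exact: (@valid_ins_ge R _ p j e (prj \o u)). Qed.

(** Over each generic base cube [y] is first deformed to its value on a product cube, by
    [fiber_homotopy], and there it bounds by hypothesis. The cochain [g] adds the two primitives;
    its factor (-1)^p cancels the sign in [cob_fiber]. *)
Lemma reduce_filtration p q y : fil p (p + q) y -> dvanish p (p + q) y ->
  (forall v, generic p v -> bounds q (fun x => y (join a p x (lft p v)))) ->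
  if q is q'.+1 then exists g, fil p (p + q') g /\ fil p.+1 (p + q) (y \- cob (p + q') g)
  else fil p.+1 (p + q) y.
Proof.
move=> fy dy yb; have [ny y0] := fy.
have dichotomy u : scube setT (p + q) u -> valid p (prj \o u) ->
    ((0 < p)%N /\ valid p.-1 (prj \o u)) \/ generic p (prj \o u).
  move=> su vu; case: (pselect ((0 < p)%N /\ valid p.-1 (prj \o u))) => [?|ng]; first by left.
  by right; split=> //; exact: scube_prj su vu.
case: q fy dy yb ny y0 dichotomy => [|q] fy dy yb ny y0 dichotomy.
  split=> // u _ su vu; have [[p0 vu']|gv] := dichotomy u su vu; first exact: y0.
  have [sw wE] := lftP (proj1 gv).
  have /eqP := fiber_homotopy fy dy su sw (fun s => esym (wE s)).
  rewrite /fsum big_geq // subr_eq0 => /eqP ->; apply: (yb _ gv).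
  exact: (@scube_fib _ _ _ _ _ 0%N).
have /choice[G GP] : forall v, exists G : raw X -> M, generic p v -> nrm q G /\
    forall x, scube setT q.+1 x -> cob q G x = y (join a p x (lft p v)).
  move=> v; case: (pselect (generic p v)) => [gv|ng]; last by exists (fun=> 0).
  by have [G GP] := yb v gv; exists G.
pose g u := if pselect (generic p (prj \o u)) then
  (y (hmt p (lft p (prj \o u)) u) + G (prj \o u) (fib p (lft p (prj \o u)) u)) *~ (-1) ^+ p else 0.
have fg : fil p (p + q) g.
  split=> u.
    move=> pq0 vu; rewrite /g; case: pselect => // gv; have [sv ng] := gv.
    have [sw _] := lftP sv; have [vw _ _] := sw; have [nG _] := GP _ gv.
    case: (posnP q) => q0.
      case: ng; rewrite q0 addn0 in pq0 vu *; split=> // s s' ss /=; by rewrite (vu s s').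
    have pqE : (p + q).-1 = (p + q.-1)%N by lia.
    have vf : valid q.-1 (fib p (lft p (prj \o u)) u) by apply: valid_fib; rewrite -pqE.
    have vh : valid (p + q.+1).-1 (hmt p (lft p (prj \o u)) u).
      rewrite addnS /=; have := @valid_hmt _ _ _ a p q.-1 u _ vw; rewrite -pqE => /(_ vu).
      by rewrite prednK.
    have -> : y (hmt p (lft p (prj \o u)) u) = 0 by apply: ny vh; rewrite addnS.
    have -> : G (prj \o u) (fib p (lft p (prj \o u)) u) = 0 by apply: nG vf.
    by rewrite addr0 mul0rz.
  move=> p0 su vu; rewrite /g; case: pselect => // -[_ []]; by split.
have dg := fil_cob fg; rewrite -addnS in dg.
exists g; split=> //; split; first by apply: nrmB => //; case: dg.
move=> u _ su vu /=; have [[p0 vu']|gv] := dichotomy u su vu.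
  by rewrite y0 // (proj2 dg) // subrr.
have [sw wE] := lftP (proj1 gv); have [vw _ _] := sw; have [nG dG] := GP _ gv.
set w := lft p (prj \o u) in sw wE vw dG.
have gE j e : g (u \o ins (p + j) e) =
    (y (hmt p w (u \o ins (p + j) e)) + G (prj \o u) (fib p w u \o ins j e)) *~ (-1) ^+ p.
  rewrite /g prj_ins_ge //; case: pselect => [gv'|/(_ gv)//].
  by rewrite -/w fib_ins.
have -> : cob (p + q) g u = fsum q.+1 p (y \o hmt p w) u + cob q (G (prj \o u)) (fib p w u).
  rewrite cob_fiber => [|i b ip]; last first.
    by apply: (fil_face _ fg _ vu ip); rewrite -?addnS //; lia.
  rewrite /fsum mulrz_suml /cob -big_split; apply: eq_bigr => j _ /=.
  rewrite /fdiff !gE -mulrzBl -!mulrzA mulrC mulrzA mulrzA sign_mulz -mulrzDl; congr (_ *~ _).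
  by rewrite opprD addrACA.
rewrite dG; last exact: scube_fib.
by rewrite -(fiber_homotopy fy dy su sw) // subrK subrr.
Qed.

End SerreFiltration.

Local Open Scope complex_scope.
Local Open Scope quotient_scope.

(** Makes a cohomology group of the fiber available as a coefficient group, with [sec] choosing
    representing cocycles. Containment of [B] in [Z] is not assumed, as [bounds] says nothing about
    values on discontinuous cubes. *)
Lemma subquotient (A : zmodType) (Z B : A -> Prop) :
  Z 0 -> (forall x y, Z x -> Z y -> Z (x - y)) -> B 0 -> (forall x y, B x -> B y -> B (x - y)) ->
  exists (Q : zmodType) (cls : A -> Q) (sec : Q -> A), [/\ forall m, Z (sec m), cancel sec cls,
    forall x y, Z x -> Z y -> cls (x - y) = cls x - cls y &
    forall x, Z x -> cls x = 0 <-> B x].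
Proof.
move=> Z0 ZB B0 BB.
have BN x : B x -> B (- x) by move=> Bx; rewrite -sub0r; exact: BB.
have BD x y : B x -> B y -> B (x + y) by move=> Bx By; rewrite -[y]opprK; apply: BB => //; exact: BN.
have ZN x : Z x -> Z (- x) by move=> Zx; rewrite -sub0r; exact: ZB.
have ZD x y : Z x -> Z y -> Z (x + y) by move=> Zx Zy; rewrite -[y]opprK; apply: ZB => //; exact: ZN.
pose S x : set A := [set y | Z y /\ B (x - y)].
pose r x := xget 0 (S x).
have rS x : Z x -> S x (r x) by move=> Zx; rewrite /r; case: xgetP => [z _ //|/(_ x)[]]; rewrite /S /= subrr.
have Zr x : Z x -> Z (r x) by move=> /rS[].
have rE x y : B (x - y) -> r x = r y.
  move=> Bxy; rewrite /r; congr xget; apply/seteqP; split=> z [Zz Bz]; split=> //.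
    by rewrite -(subrK x y) -addrA; apply: BD => //; rewrite -opprB; exact: BN.
  by rewrite -(subrK y x) -addrA; exact: BD.
have rr x : Z x -> r (r x) = r x by move=> /rS[_ Bx]; apply: rE; rewrite -opprB; exact: BN.
pose T := {x : A | `[< Z x /\ r x = x >]}.
have TP (m : T) : Z (val m) /\ r (val m) = val m by exact/asboolP/(valP m).
have clsP x : `[< Z (if pselect (Z x) then r x else r 0) /\
    r (if pselect (Z x) then r x else r 0) = if pselect (Z x) then r x else r 0 >].
  by apply/asboolP; case: pselect => Zx; split; rewrite ?rr //; exact: Zr.
pose cl x : T := exist (fun x => is_true `[< Z x /\ r x = x >]) _ (clsP x).
have vcl x : Z x -> val (cl x) = r x by move=> Zx /=; case: pselect.
have clE x y : Z x -> Z y -> B (x - y) -> cl x = cl y.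
  by move=> Zx Zy Bxy; apply: val_inj; rewrite !vcl //; exact: rE.
have clK (m : T) : cl (val m) = m by apply: val_inj; have [Zm rm] := TP m; rewrite vcl.
have Bcl x : Z x -> B (x - val (cl x)) by move=> Zx; rewrite vcl //; have [] := rS x Zx.
pose ad (m m' : T) := cl (val m + val m').
pose op (m : T) := cl (- val m).
have Zv (m : T) : Z (val m) by have [] := TP m.
have adE x y : Z x -> Z y -> ad (cl x) (cl y) = cl (x + y).
  move=> Zx Zy; apply: clE; [exact: ZD|exact: ZD|].
  rewrite -opprB; apply: BN; rewrite opprD addrACA; apply: BD; exact: Bcl.
have opE x : Z x -> op (cl x) = cl (- x).
  move=> Zx; apply: clE; [exact: ZN|exact: ZN|].
  by rewrite opprK addrC; exact: Bcl.
have adA : associative ad.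
  move=> x y z; rewrite -(clK x) -(clK y) -(clK z) !adE ?addrA //; exact: ZD.
have adC : commutative ad by move=> x y; rewrite /ad addrC.
have ad0 : left_id (cl 0) ad by move=> x; rewrite -(clK x) adE // add0r.
have adN : left_inverse (cl 0) op ad.
  by move=> x; rewrite -(clK x) opE // adE ?addNr //; exact: ZN.
pose Q : zmodType := HB.pack T (GRing.isZmodule.Build T adA adC ad0 adN).
exists Q, cl, val; split=> //.
  by move=> x y Zx Zy; rewrite -adE -?opE //; exact: ZN.
move=> x Zx; split=> [cx|Bx]; last by apply: clE; rewrite ?subr0.
have := congr1 val cx; rewrite -[0]/(cl 0) !vcl // => rx0.
have [_ B1] := rS x Zx; have [_ B2] := rS 0 Z0.
rewrite -(subrK (r x) x); apply: BD => //; rewrite rx0 -[r 0]opprK; apply: BN.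
by rewrite -sub0r.
Qed.

Section LiftIndependence.
Variables (R : realType) (n : nat) (X : topologicalType) (a : torus_action R n X) (M : zmodType).
Local Notation raw T := ((nat -> itv01 R) -> T).
Local Notation orb := (orbit (ET_action R n)).
Local Notation prj := (@borel_proj R n X a).
Local Notation Y := (borel a).
Variables (p q : nat) (y : raw Y -> M).
Hypotheses (fy : fil p (p + q) y) (dy : dvanish p (p + q) y).
Implicit Types (w : raw (ET R n)) (x : raw X).

Lemma nrm_join w : valid p w -> nrm q (fun x => y (join a p x w)).
Proof.
move=> vw x q0 vx; have [ny _] := fy; apply: ny; first by rewrite addn_gt0 q0 orbT.
by have := valid_join a vw vx; congr valid; lia.
Qed.

Lemma cob_join w x : scube setT p w -> scube setT q.+1 x -> cob q (fun x => y (join a p x w)) x = 0.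
Proof.
move=> sw sx; have [vw _ _] := sw; have sj := scube_join a sw sx.
have vj : valid p (prj \o join a p x w).
  by move=> s s' ss /=; rewrite !prj_join (vw s s').
rewrite addnS in sj; have := dy sj vj; rewrite cob_fiber; last first.
  by move=> i b ip; apply: (fil_face _ fy sj vj ip); lia.
move=> /(congr1 (fun m => m *~ (-1) ^+ p)); rewrite sign_mulz mul0rz => <-.
by apply: eq_bigr => j _; rewrite /fdiff !join_ins.
Qed.

(** At the corner the lifts differ by some [D]. Comparing the product over [w'] with [w] by
    [fiber_homotopy] gives the product over [w] of the translated cube [a D \o x], up to a bounding
    term, and translation by [D] is absorbed by [torus_trivial]. *)
Lemma lift_independent w w' : scube setT p w -> scube setT p w' ->
  (forall s, orb (w s) = orb (w' s)) ->
  bounds q (fun x => y (join a p x w') - y (join a p x w)).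
Proof.
move=> sw sw' ww'; have [vw _ _] := sw; have [vw' _ _] := sw'.
have [D DE] : exists D, ET_act D (w' (fun=> i0)) = w (fun=> i0).
  by apply: (iffLR (orbitP (ET_action R n) _ _)); rewrite ww'.
pose F x := y (join a p x w).
have bT : bounds q (fun x => F (a D \o x) - F x).
  by apply: torus_trivial; [exact: nrm_join|move=> x; exact: cob_join].
have bH : bounds q (fun x => fsum q p (y \o hmt p w) (join a p x w')).
  case: q fy => [|q'] fy'; first by move=> x _; rewrite /fsum big_geq.
  exists (fun x => y (hmt p w (join a p x w'))); split.
    move=> x q0 vx; have [ny _] := fy'; apply: ny; first by rewrite addnS.
    by have := valid_hmt vw (valid_join a vw' vx); congr valid; lia.
  by move=> x _; apply: eq_bigr => j _; rewrite /fdiff /= !join_ins.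
apply: eq_bounds (boundsD bH bT) => x sx /=.
rewrite -(fiber_homotopy fy dy (scube_join a sw' sx) sw); last by move=> s; rewrite prj_join ww'.
by rewrite (fib_join a x vw' DE) /F subrKA.
Qed.

End LiftIndependence.

(** * Base cubes of odd dimension *)

Local Open Scope complex_scope.
Local Open Scope quotient_scope.

Section OddBase.
Variables (R : realType) (n : nat) (X : topologicalType) (a : torus_action R n X) (M : zmodType).
Local Notation raw T := ((nat -> itv01 R) -> T).
Local Notation orb := (orbit (ET_action R n)).
Local Notation prj := (@borel_proj R n X a).
Local Notation Y := (borel a).
Implicit Types (v : raw (BT R n)) (x : raw X) (F : raw X -> M).

Definition cocycle q F := nrm q F /\ forall x, scube setT q.+1 x -> cob q F x = 0.

Lemma cocycleB q F F' : cocycle q F -> cocycle q F' -> cocycle q (F - F').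
Proof.
move=> [nF dF] [nF' dF']; split; first exact: (nrmB nF nF').
by move=> x sx; rewrite [LHS](cobB q F F') dF // dF' // subrr.
Qed.

Lemma scube_act D q x : scube setT q x -> scube setT q (a D \o x).
Proof.
apply: scube_map => // z _.
have c : continuous (fun x : X => (D, x)) by apply: continuous_pair => z'; [exact: cst_continuous|].
exact: (continuous_comp (c z) (@act_continuous _ _ _ a _)).
Qed.

Lemma cocycle_act D q F : cocycle q F -> cocycle q (fun x => F (a D \o x)).
Proof.
move=> [nF dF]; split=> [x q0 vx|x sx].
  by apply: nF => // s s' ss /=; rewrite (vx s s').
exact: dF (scube_act D sx).
Qed.

Lemma join_ins_base p x (w : raw (ET R n)) i e : (i <= p)%N ->
  join a p.+1 x w \o ins i e = join a p x (w \o ins i e).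
Proof.
move=> ip; apply/funext => s; rewrite /join /=; congr (orbit _ (x _, _)).
apply/funext => j; rewrite /tl /ins; have -> : (p.+1 + j < i)%N = false by lia.
by have -> : (p.+1 + j == i)%N = false by lia.
Qed.

Section Reduction.
Variables (p q : nat) (y : raw Y -> M).
Local Notation k := (p + q)%N.
Hypotheses (op : odd p.+1) (fy : fil p.+1 k.+1 y) (dy : dvanish p.+2 k.+1 y).

(** The whole coboundary of [y] vanishes on these product cubes, so the base faces equal, up to
    sign, a coboundary in the fiber directions. This is the cocycle condition for the classes on
    [BT]. *)
Lemma face_sum_bounds (w : raw (ET R n)) : scube setT p.+2 w ->
  bounds q (fun x => \sum_(0 <= i < p.+2) fdiff y (join a p.+2 x w) i *~ (-1) ^+ i.+1).
Proof.
move=> sw; have [vw _ _] := sw; have [ny _] := fy.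
have dj q' x : q' = q -> scube setT q' x -> cob k.+1 y (join a p.+2 x w) = 0.
  move=> -> sx; have sj := scube_join a sw sx; rewrite !addSn in sj; apply: dy sj _.
  by move=> s s' ss /=; rewrite !prj_join (vw s s').
case: (q) ny dj => [|q'] ny dj.
  by move=> x sx; have := dj 0%N x erefl sx; rewrite addn0.
exists (fun x => - (y (join a p.+2 x w) *~ (-1) ^+ p.+2)); split.
  move=> x q0 vx; rewrite ny ?mul0rz ?oppr0 //.
  by have := valid_join a vw vx; congr valid; lia.
move=> x sx; have := dj q'.+1 x erefl sx.
have -> : (p + q'.+1).+1 = (p.+2 + q')%N by lia.
rewrite cob_split => /eqP; rewrite addr_eq0 => /eqP ->.
rewrite /fsum mulrz_suml -sumrN; apply: eq_bigr => j _.
rewrite /fdiff !join_ins //= -opprD mulNrz -mulrzBl; congr (- _).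
by rewrite -!mulrzA mulrC.
Qed.

(** The classes of [y] along the fibers form a cocycle [ybar] of odd degree [p.+1] on [BT] with
    values in [Q]. A primitive [eta], realized by the cocycles [sec (eta v)], gives [g]; subtracting
    its coboundary leaves classes equal to zero. *)
Lemma odd_base_reduction : exists g : raw Y -> M, fil p k g /\
  [/\ fil p.+1 k.+1 (y \- cob k g), dvanish p.+1 k.+1 (y \- cob k g) &
  forall v, generic p.+1 v -> bounds q (fun x => (y \- cob k g) (join a p.+1 x (lft p.+1 v)))].
Proof.
have dy' : dvanish p.+1 (p.+1 + q) y.
  by move=> u su vu; apply: dy su _; exact: valid_le (leqnSn _) vu.
have fy' : fil p.+1 (p.+1 + q) y by [].
have [||||Q [cls [sec [Zsec secK clsB cls0]]]] := @subquotient (raw X -> M) (cocycle q) (bounds q).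
- by split=> [x _ _|x _]; [|exact: cob_0].
- exact: cocycleB.
- exact: bounds_zero.
- by move=> F F' bF bF'; exact: boundsB.
(* [cls] is additive on cocycles only, so sums of classes are computed through this relation. *)
pose E F m := cocycle q F /\ cls F = m.
have E0 : E 0 0.
  split; first by split=> [x _ _|x _]; [|exact: cob_0].
  by apply: (iffRL (cls0 _ _)); [split=> [x _ _|x _]; [|exact: cob_0]|exact: bounds_zero].
have EB F F' m m' : E F m -> E F' m' -> E (F - F') (m - m').
  by move=> [ZF <-] [ZF' <-]; split; [exact: cocycleB|exact: clsB].
have EN F m : E F m -> E (- F) (- m) by move=> EF; rewrite -[- F]sub0r -[- m]sub0r; exact: EB.
have ED F F' m m' : E F m -> E F' m' -> E (F + F') (m + m').
  by move=> EF EF'; rewrite -[F']opprK -[m']opprK; apply: EB => //; exact: EN.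
have Esign F m i : E F m -> E (fun x => F x *~ (-1) ^+ i) (m *~ (-1) ^+ i).
  by move=> EF; rewrite -signr_odd; case: (odd i) => //; rewrite expr1 mulrN1z; exact: EN.
have Esum N (F : nat -> raw X -> M) (m : nat -> Q) : (forall i, (i < N)%N -> E (F i) (m i)) ->
    E (fun x => \sum_(0 <= i < N) F i x) (\sum_(0 <= i < N) m i).
  elim: N => [|N IH] EF.
    rewrite big_geq // (_ : (fun x => _) = 0) //.
    by apply/funext => x; rewrite big_geq.
  rewrite big_nat_recr //= (_ : (fun x => _) = (fun x => \sum_(0 <= i < N) F i x) + F N).
    by apply: ED; [apply: IH => i iN; apply: EF; exact: ltnW|exact: EF].
  by apply/funext => x; rewrite big_nat_recr.
have Ebounds F : E F 0 -> bounds q F by move=> [ZF cF]; apply: (iffLR (cls0 _ ZF)).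
have Eeq F F' m : cocycle q F' -> bounds q (fun x => F' x - F x) -> E F m -> E F' m.
  move=> ZF' bF [ZF <-]; split=> //; apply/eqP; rewrite -subr_eq0 -clsB //; apply/eqP.
  by apply/cls0 => //; exact: cocycleB.
have Zj (w : raw (ET R n)) : scube setT p.+1 w -> cocycle q (fun x => y (join a p.+1 x w)).
  move=> sw; have [vw _ _] := sw; split; first exact: (nrm_join fy').
  by move=> x; exact: (cob_join fy' dy').
pose ybar v : Q := if pselect (scube setT p.+1 v) then cls (fun x => y (join a p.+1 x (lft p.+1 v))) else 0.
have ybarE v (w : raw (ET R n)) : scube setT p.+1 w -> (forall s, orb (w s) = v s) ->
    E (fun x => y (join a p.+1 x w)) (ybar v).
  move=> sw wv; have sv : scube setT p.+1 v.
    rewrite (_ : v = orb \o w); last by apply/funext => s /=; rewrite wv.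
    by apply: scube_map sw => // z _; exact: continuous_orbit.
  have [sl lv] := lftP sv; apply: Eeq (Zj _ sw) (lift_independent fy' dy' sl sw _) _.
    by move=> s; rewrite lv wv.
  by split; [exact: Zj|rewrite /ybar; case: pselect].
have nybar : nrm p.+1 ybar.
  move=> v _ vv; rewrite /ybar; case: pselect => // sv; have [sl lv] := lftP sv.
  apply/cls0; first exact: Zj.
  apply: bounds_zero => x sx; apply: (proj2 fy) => //; first exact: (scube_join a sl sx).
  by move=> s s' ss /=; rewrite !prj_join !lv (vv s s').
have dybar v : scube setT p.+2 v -> cob p.+1 ybar v = 0.
  move=> sv; have [sl lv] := lftP sv.
  have Eface i e : (i <= p.+1)%N ->
      E (fun x => y (join a p.+2 x (lft p.+2 v) \o ins i e)) (ybar (v \o ins i e)).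
    move=> ip; rewrite (_ : (fun x => _) = (fun x => y (join a p.+1 x (lft p.+2 v \o ins i e)))).
      by apply: ybarE => [|s]; [exact: scube_ins|exact: lv].
    by apply/funext => x; rewrite join_ins_base.
  have [Zs cs] := Esum p.+2 _ _ (fun i (ip : (i < p.+2)%N) =>
    Esign _ _ i.+1 (EB _ _ _ _ (Eface i i0 ip) (Eface i i1 ip))).
  by rewrite /cob /fdiff -cs; apply/cls0 => //; exact: face_sum_bounds.
have [|eta [neta _ deta]] := @acyclic_BT R n Q p.+1 op ybar nybar _ dybar.
  by move=> u [_ _ /(_ (fun=> i0))].
pose g (u : raw Y) := if pselect (generic p (prj \o u)) then
  sec (eta (prj \o u)) (fib p (lft p (prj \o u)) u) else 0.
have gF u : ~ generic p (prj \o u) -> g u = 0 by rewrite /g; case: pselect.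
have fg : fil p k g.
  split=> u.
    move=> k0 vu; rewrite /g; case: pselect => // -[sv ng].
    have [nS _] := Zsec (eta (prj \o u)).
    case: (posnP q) => q0; last first.
      apply: nS => //; apply: valid_fib; rewrite (_ : (p + q.-1)%N = k.-1) //; lia.
    case: ng; rewrite q0 addn0 in k0 vu; split=> // s s' ss /=; by rewrite (vu s s').
  by move=> p0 su vu; rewrite /g; case: pselect => // -[_ []].
have dg := fil_cob fg.
(* The coboundary of [g] gains a filtration step: over a generic [p]-cube it is the fiber coboundary
   of a cocycle. *)
have fyg : fil p.+1 k.+1 (y \- cob k g).
  split; first by apply: nrmB; [case: fy|case: dg].
  move=> u _ su vu /=; rewrite (proj2 fy) // sub0r.
  case: (pselect ((0 < p)%N /\ valid p.-1 (prj \o u))) => [[p0 vu']|ng].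
    by rewrite (proj2 dg) // oppr0.
  have gv : generic p (prj \o u) by split=> //; exact: scube_prj su vu.
  have [sl lv] := lftP (proj1 gv).
  rewrite cob_fiber => [|i b ip]; last by apply: (fil_face _ fg su vu ip); lia.
  have -> : fsum q.+1 p g u = cob q (sec (eta (prj \o u))) (fib p (lft p (prj \o u)) u).
    apply: eq_bigr => j _; rewrite /fdiff /g !prj_ins_ge //; case: pselect => [gv'|/(_ gv)//].
    by rewrite !fib_ins.
  rewrite (proj2 (Zsec _)) ?mul0rz ?oppr0 //.
  by apply: (scube_fib sl) => [|s]; rewrite ?addnS // lv.
have dyg : dvanish p.+1 k.+1 (y \- cob k g).
  by move=> u su vu; rewrite cobB cob_cob subr0; exact: dy'.
exists g; split=> //; split=> // v gv; have [sl lv] := lftP (proj1 gv).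
(* A face of the chosen lift need not be the chosen lift of the face; they differ at the corner by a
   torus element, which does not change the class. On a degenerate face both sides are zero. *)
have gface i e : (i <= p)%N -> E (fun x => g (join a p.+1 x (lft p.+1 v) \o ins i e)) (eta (v \o ins i e)).
  move=> ip; set w := lft p.+1 v \o ins i e.
  have sw : scube setT p w by exact: scube_ins.
  have [vw _ _] := sw.
  have sv : scube setT p (v \o ins i e) by apply: scube_ins => //; case: gv.
  have pE x : prj \o (join a p.+1 x (lft p.+1 v) \o ins i e) = v \o ins i e.
    by rewrite join_ins_base //; apply/funext => s /=; rewrite prj_join lv.
  rewrite /g; under eq_fun do rewrite pE join_ins_base //.
  case: pselect => [gv'|ng].
    have [sl' lv'] := lftP sv.
    have [D DE] : exists D, ET_act D (w (fun=> i0)) = lft p (v \o ins i e) (fun=> i0).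
      by apply: (iffLR (orbitP (ET_action R n) _ _)); rewrite lv' /w /= lv.
    under eq_fun do rewrite (fib_join a _ vw DE).
    have ZS := Zsec (eta (v \o ins i e)).
    have bS : bounds q (fun x => sec (eta (v \o ins i e)) (a D \o x) - sec (eta (v \o ins i e)) x).
      by case: ZS; exact: torus_trivial.
    by apply: (Eeq _ _ _ (cocycle_act D ZS) bS); split.
  have -> : eta (v \o ins i e) = 0.
    case: (pselect ((0 < p)%N /\ valid p.-1 (v \o ins i e))) => [[p0 vv]|ng'].
      exact: neta.
    by case: ng.
  exact: E0.
apply: Ebounds; rewrite -(subrr (ybar v)); apply: (EB); first exact: ybarE.
rewrite -deta; last by case: gv.
rewrite (_ : (fun x => _) = (fun x => \sum_(0 <= i < p.+1)
  fdiff g (join a p.+1 x (lft p.+1 v)) i *~ (-1) ^+ i.+1)).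
  by apply: Esum => i ip; apply: Esign; apply: EB; exact: gface.
apply/funext => x; rewrite /cob (big_cat_nat (leq0n p.+1)) ?ltnS ?leq_addr //=.
rewrite -[RHS]addr0; congr (_ + _); rewrite big_nat big1 // => i /andP[pi _].
have g0 e : g (join a p.+1 x (lft p.+1 v) \o ins i e) = 0.
  rewrite -(subnKC pi) join_ins; last by case: sl.
  apply: gF => -[[vv _ _] _]; case: (proj2 gv); split=> // s s' ss.
  by have := vv s s' ss; rewrite /= !prj_join !lv.
by rewrite /fdiff !g0 subrr mul0rz.
Qed.

End Reduction.
End OddBase.

(** * Collapse of the spectral sequence *)

Local Open Scope complex_scope.
Local Open Scope quotient_scope.

Section OddDegree.
Variables (R : realType) (n : nat) (X : topologicalType) (a : torus_action R n X) (M : zmodType).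
Local Notation raw T := ((nat -> itv01 R) -> T).
Local Notation Y := (borel a).
Hypothesis acyclic_odd : forall q, odd q -> @acyclic R M X q setT set0.

Lemma filD p k (f g : raw Y -> M) : fil p k f -> fil p k g -> fil p k (f \+ g).
Proof.
move=> [nf f0] [ng g0]; split; first exact: nrmD.
by move=> u p0 su vu /=; rewrite f0 // g0 // addr0.
Qed.

Lemma fil_pred p k (f : raw Y -> M) : fil p k f -> fil p.-1 k f.
Proof. by case: p => // p; exact: fil_weak. Qed.

(** The step lost in [p.-1] comes from odd [p], where the primitive on the base has degree one less;
    for even [p] the correction stays in filtration [p]. *)
Lemma odd_degree_reduction p k (y : raw Y -> M) : odd k.+1 -> fil p k.+1 y -> dvanish p.+1 k.+1 y ->
  exists g : raw Y -> M, fil p.-1 k g /\ fil p.+1 k.+1 (y \- cob k g).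
Proof.
move=> ok fy dy.
have trivial : fil p.+1 k.+1 y -> exists g : raw Y -> M, fil p.-1 k g /\ fil p.+1 k.+1 (y \- cob k g).
  move=> fy'; exists (fun=> 0); split=> //; split=> [u u0 vu|u p0 su vu] /=.
    by rewrite cob_0 subr0; apply: (proj1 fy').
  by rewrite cob_0 subr0; apply: (proj2 fy').
case: (leqP p k.+1) => pk; last first.
  (* Every cube of degree [k.+1] has filtration at most [k.+1], so here [y] already vanishes on all
     continuous cubes. *)
  apply: trivial; split; first by case: fy.
  move=> u _ su vu; have [vu' _ _] := su; apply: (proj2 fy) => //; first exact: leq_ltn_trans pk.
  by move=> s s' ss /=; rewrite (vu' s s') // => j jk; apply: ss; lia.
have dy' : dvanish p k.+1 y by move=> u su vu; apply: dy su _; exact: valid_le (leqnSn _) vu.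
case: (boolP (odd p)) => op.
  case: p op pk fy dy dy' trivial => // p op pk fy dy dy' trivial.
  have [q kE] : exists q, k = (p + q)%N by exists (k - p)%N; lia.
  move: fy dy dy' trivial; rewrite kE => fy dy dy' trivial.
  have [g [fg [fyg dyg byg]]] := odd_base_reduction op fy dy.
  have := @reduce_filtration _ _ _ a M p.+1 q (y \- cob (p + q) g) fyg dyg byg.
  case: q {kE fy dy dy' trivial fyg dyg byg} fg => [|q] fg; first by exists g.
  move=> [g' [fg' fygg']]; exists (g \+ g'); split.
    by apply: filD => //; rewrite addnS; apply: fil_weak.
  suff -> : y \- cob (p + q.+1) (g \+ g') = (y \- cob (p + q.+1) g) \- cob (p.+1 + q) g' by [].
  by apply/funext => u /=; rewrite cobD opprD addrA -addSnnS.
have [q kE] : exists q, k = (p + q)%N.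
  have pk' : (p <= k)%N by rewrite -ltnS ltn_neqAle pk andbT; apply: contraNneq op => ->.
  by exists (k - p)%N; lia.
have oq : odd q.+1 by move: ok; rewrite kE -addnS oddD (negbTE op).
move: fy dy'; rewrite kE -addnS => fy dy'.
have [|g [fg fyg]] := @reduce_filtration _ _ _ a M p q.+1 y fy dy'.
  move=> v gv; have [sl lv] := lftP (proj1 gv); have [vl _ _] := sl.
  apply: acyclic_bounds; [exact: acyclic_odd|exact: (nrm_join fy)|].
  by move=> x sx; exact: (cob_join fy dy').
by exists g; split=> //; exact: fil_pred.
Qed.

End OddDegree.

(** * Comparison of raw cochains with cochains on singular cubes *)

Section SingularCochains.
Variables (R : realType) (E : topologicalType).
Local Notation raw T := ((nat -> itv01 R) -> T).

Definition raw_cube k (s : singular_cube R k E) : raw E := fun b => s (cube_of k b).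

Lemma scube_raw_cube k (s : singular_cube R k E) : scube setT k (raw_cube s).
Proof.
split=> // [b c bc|].
  rewrite /raw_cube; congr (s _); apply/val_inj/rowP => j; rewrite !mxE bc //.
rewrite /raw_cube; under [X in continuous X]eq_fun do rewrite seq_ofK.
by move=> t; exact: cts_fun.
Qed.

Definition sing k (u : raw E) (su : scube setT k u) : singular_cube R k E :=
  HB.pack (fun t : cube R k => u (seq_of t))
    (isContinuous.Build _ _ (fun t : cube R k => u (seq_of t)) (let: And3 _ c _ := su in c)).

Lemma singE k (u : raw E) (su : scube setT k u) t : sing su t = u (seq_of t).
Proof. by []. Qed.

Lemma raw_cubeK k (s : singular_cube R k E) : sing (scube_raw_cube s) = s.
Proof. by apply/continuousEP => t; rewrite singE /raw_cube seq_ofK. Qed.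

Lemma raw_cube_sing k (u : raw E) (su : scube setT k u) : raw_cube (sing su) = u.
Proof.
apply/funext => b; rewrite /raw_cube singE; have [vu _ _] := su; apply: vu => j jk.
exact: cube_ofK.
Qed.

Definition of_raw k (F : raw E -> int) : cochain R E k := fun s => F (raw_cube s).

(** The value 0 off the continuous cubes keeps the extension normalized. *)
Definition to_raw k (f : cochain R E k) : raw E -> int :=
  fun u => if pselect (scube setT k u) is left su then f (sing su) else 0.

Lemma to_rawK k (f : cochain R E k) : of_raw (to_raw f) = f.
Proof.
apply/funext => s; rewrite /of_raw /to_raw; case: pselect => [su|[]]; last exact: scube_raw_cube.
by rewrite (Prop_irrelevance su (scube_raw_cube s)) raw_cubeK.
Qed.

Lemma raw_cube_face k (s : singular_cube R k.+1 E) (i : 'I_k.+1) e :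
  raw_cube (cube_face s i e) = raw_cube s \o ins i (if e then i1 else i0).
Proof.
apply/funext => b; rewrite /raw_cube /cube_face /=; congr (s _).
apply/val_inj/rowP => j; rewrite /= !mxE /ins; case: unliftP => [j' ->|->].
  rewrite mxE /= /bump; case: (leqP i j') => ij.
    have -> : (1 + j' < i)%N = false by lia.
    by have -> : (1 + j' == i)%N = false by lia.
  by rewrite add0n ij.
by rewrite ltnn eqxx; case: e.
Qed.

Lemma coboundary_of_raw k (F : raw E -> int) :
  coboundary (of_raw F : cochain R E k) = of_raw (cob k F).
Proof.
apply/funext => s; rewrite /coboundary /of_raw /cob big_mkord; apply: eq_bigr => i _.
by rewrite !raw_cube_face /fdiff mulrzz mulrC.
Qed.

Lemma coboundaryK k (f : cochain R E k) : coboundary (coboundary f) = 0.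
Proof.
rewrite -(to_rawK f) !coboundary_of_raw; apply/funext => s; exact: cob_cob.
Qed.

Lemma coboundaryB k (f g : cochain R E k) : coboundary (f - g) = coboundary f - coboundary g.
Proof.
rewrite -(to_rawK f) -(to_rawK g) !coboundary_of_raw; apply/funext => s.
rewrite -[RHS](cobB k (to_raw f) (to_raw g)) -[RHS]/(of_raw (cob k (to_raw f \- to_raw g)) s).
by rewrite -coboundary_of_raw.
Qed.

Lemma coboundary0 k : coboundary (0 : cochain R E k) = 0.
Proof. by rewrite -(subrr 0) coboundaryB subrr. Qed.

Section Filtration.
Variables (B : Type) (prj : E -> B).
Local Notation F := (serre_filtration (R := R) prj).

Lemma serre_filtrationB p k (f g : cochain R E k) : F p f -> F p g -> F p (f - g).
Proof.
move=> [nf f0] [ng g0]; split=> [u du|m u mp du].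
  by rewrite -[LHS]/(f u - g u) nf // ng // subr0.
by rewrite -[LHS]/(f u - g u) (f0 m) // (g0 m) // subr0.
Qed.

Lemma serre_filtration0 p k : F p (0 : cochain R E k).
Proof. by split. Qed.

Lemma serre_filtrationD p k (f g : cochain R E k) : F p f -> F p g -> F p (f + g).
Proof.
move=> Ff Fg; rewrite -[g]opprK; apply: serre_filtrationB => //.
by rewrite -sub0r; apply: serre_filtrationB => //; exact: serre_filtration0.
Qed.

Lemma serre_filtrationS p p' k (f : cochain R E k) : p <= p' -> F p' f -> F p f.
Proof. by move=> pp [nf f0]; split=> // m u mp; apply: f0; exact: lt_le_trans pp. Qed.

Lemma serre_filtration_eq0 p k (f : cochain R E k) : k%:Z < p -> F p f -> f = 0.
Proof.
move=> kp [_ f0]; apply/funext => u; apply: (f0 k) => // s t st /=.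
by congr (prj (u _)); apply/val_inj/rowP => i; exact: st.
Qed.

Lemma serre_filtration_neg p k (f : cochain R E k) : p < 0 -> F p f -> F (p + 1) f.
Proof. by move=> p0 [nf f0]; split=> // m u mp; exfalso; lia. Qed.

End Filtration.
End SingularCochains.

Section EquivariantFormality.
Variables (R : realType) (n : nat) (X : topologicalType) (a : torus_action R n X).
Hypothesis acyclic_odd : forall q, odd q -> @acyclic R int X q setT set0.
Local Notation raw T := ((nat -> itv01 R) -> T).
Local Notation prj := (@borel_proj R n X a).
Local Notation F := (serre_filtration (R := R) prj).

Lemma valid_sing p k (u : raw (borel a)) (su : scube setT k u) :
  valid p (prj \o u) -> depends_on_first p (prj \o sing su).
Proof.
move=> vu s t st; apply: vu => j jp.
case: (ltnP j k) => jk; last by rewrite !seq_of_ge.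
by apply/val_inj; rewrite !seq_of_lt; apply: st.
Qed.

Lemma fil_to_raw (p : nat) k (f : cochain R (borel a) k) : F p f -> fil p k (to_raw f).
Proof.
move=> [nf f0]; split=> [u k0 vu|u p0 su vu]; rewrite /to_raw; case: pselect => // su'.
  apply: nf; split=> // s t st; apply: vu => j jk.
  have jk' : (j < k)%N by lia.
  by apply/val_inj; rewrite !(seq_of_lt _ jk'); apply: st.
by apply: (f0 p.-1); [lia|exact: valid_sing].
Qed.

Lemma of_raw_fil (p : int) (p' : nat) k (g : raw (borel a) -> int) : p <= p' -> fil p' k g -> F p (of_raw g : cochain R (borel a) k).
Proof.
move=> pp [ng g0]; split=> [s [k0 ds]|m s mp ds]; rewrite /of_raw.
  apply: ng => // b c bc; rewrite /raw_cube; apply: ds => i ik /=; by rewrite !mxE bc.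
apply: g0; [lia|exact: scube_raw_cube|] => b c bc; rewrite /raw_cube /=.
apply: ds => i im /=; rewrite !mxE bc //; lia.
Qed.

Lemma odd_degree_step p k (y : cochain R (borel a) k.+1) : odd k.+1 -> F p y ->
  F (p + 2) (coboundary y) -> exists g : cochain R (borel a) k,
  F (p - 1) g /\ F (p + 1) (y - coboundary g).
Proof.
move=> ok Fy Fdy; case: (ltrP p 0) => p0.
  exists 0; rewrite coboundary0 subr0; split; first exact: serre_filtration0.
  exact: serre_filtration_neg.
case: p p0 Fy Fdy => // p _ Fy Fdy.
have dy : dvanish p.+1 k.+1 (to_raw y).
  move=> u su vu; rewrite -(raw_cube_sing su) -[LHS]/(of_raw (cob k.+1 (to_raw y)) (sing su)).
  rewrite -coboundary_of_raw to_rawK; apply: (proj2 Fdy p.+1); first by lia.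
  exact: valid_sing.
have [g [fg fyg]] := odd_degree_reduction acyclic_odd ok (fil_to_raw Fy) dy.
exists (of_raw g); split; first by apply: of_raw_fil fg; lia.
have -> : y - coboundary (of_raw g) = of_raw (to_raw y \- cob k g).
  by rewrite coboundary_of_raw -{1}(to_rawK y).
by apply: of_raw_fil fyg; lia.
Qed.

(** Iterating the step keeps every correction in filtration [p + 1], while the remainder climbs by
    one each time; in a fixed degree the filtration is eventually zero. *)
Lemma odd_cocycle_exact p k (y : cochain R (borel a) k.+1) : odd k.+1 -> F (p + 2) y ->
  coboundary y = 0 -> exists2 w : cochain R (borel a) k, F (p + 1) w & coboundary w = y.
Proof.
move=> ok Fy dy0.
have H (N : nat) : exists2 w : cochain R (borel a) k, F (p + 1) w & F (p + 2 + N%:Z) (y - coboundary w).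
  elim: N => [|N [w Fw Fyw]].
    exists 0; first exact: serre_filtration0.
    by rewrite coboundary0 subr0 addr0.
  have [|g [Fg Fyg]] := odd_degree_step ok Fyw.
    by rewrite coboundaryB dy0 coboundaryK subr0; exact: serre_filtration0.
  exists (w + g).
    by apply: serre_filtrationD => //; apply: serre_filtrationS Fg; lia.
  have -> : y - coboundary (w + g) = y - coboundary w - coboundary g.
    suff -> : coboundary (w + g) = coboundary w + coboundary g by rewrite opprD addrA.
    by apply/eqP; rewrite -subr_eq -coboundaryB addrK.
  by apply: serre_filtrationS Fyg; lia.
have [w Fw Fyw] := H (`|k.+1%:Z - p|)%N.
exists w => //; apply/esym/eqP; rewrite -subr_eq0; apply/eqP.
by apply: serre_filtration_eq0 Fyw; lia.
Qed.

Theorem equivariantly_formal_odd : equivariantly_formal a.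
Proof.
move=> r r2 p k x [Fx Fdx].
(* Such a [b] puts the coboundary of [x] into the denominator with first summand 0. In odd degree
   [b] is a correction of [x] itself; in even degree its coboundary is an odd cocycle of filtration
   [p + r], at least [p + 2]. *)
have [b Fb db] : exists2 b : cochain R (borel a) k, F (p + 1) b & coboundary b = coboundary x.
  case: (boolP (odd k)) => ok; last first.
    apply: odd_cocycle_exact => //; last exact: coboundaryK.
    by apply: serre_filtrationS Fdx; lia.
  case: k ok x Fx Fdx => // k ok x Fx Fdx.
  have [|g [Fg Fxg]] := odd_degree_step ok Fx.
    by apply: serre_filtrationS Fdx; lia.
  by exists (x - coboundary g) => //; rewrite coboundaryB coboundaryK subr0.
exists 0; first by split; [exact: serre_filtration0|rewrite coboundary0; exact: serre_filtration0].
exists b; last by rewrite add0r db.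
split; first by apply: serre_filtrationS Fb; lia.
by rewrite db; apply: serre_filtrationS Fdx; lia.
Qed.

End EquivariantFormality.

Theorem corollary8 (R : realType) (n : nat) (h : 'I_n -> 'I_n)
    (lambda : 'I_n -> R) (h_hess : hessenberg_function h)
    (lambda_incr : forall i j : 'I_n, (i < j)%N -> lambda i < lambda j) :
  equivariantly_formal (conj_action h lambda).
Proof.
have [h_ge h_step] := h_hess.
have h_mono (i j : 'I_n) : (i <= j)%N -> (h i <= h j)%N.
  move=> ij; have [d dE] : exists d, (j = i + d :> nat)%N by exists (j - i)%N; lia.
  elim: d j dE {ij} => [|d IH] j dE.
    by have -> : j = i by apply/val_inj; rewrite /= dE addn0.
  have kn : (i + d < n)%N by have := ltn_ord j; lia.
  apply: leq_trans (IH (Ordinal kn) erefl) _; apply: h_step.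
  by rewrite dE /= addnS.
have lambda_inj : injective lambda.
  move=> i j E; apply/val_inj; case: (ltngtP i j) => // /lambda_incr; by rewrite E ltxx.
by apply: equivariantly_formal_odd => q oq; exact: acyclic_Xh.
Qed.
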